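(* Let $\mathcal{L}$ be a finite relational language all of whose symbols have arity at most two. Let $\mathcal{F}$ be a finite set of finite irreducible $\mathcal{L}$-structures, and let $\mathcal{K}=\mathrm{Forb}(\mathcal{F})$. Let $\mathbf{K}$ be the Fra\''iss\'e limit of $\mathcal{K}$ and $G=\mathrm{Aut}(\mathbf{K})$. Then $\mathbf{K}$ admits a big Ramsey structure in a finite relational language, and the topological group $G$ has a metrizable universal completion flow, which is unique up to isomorphism.
   Context: An $\mathcal{L}$-structure is irreducible if any two distinct vertices appear together in some tuple of some relation. $\mathrm{Forb}(\mathcal{F})$ is the class of all finite $\mathcal{L}$-structures into which no member of $\mathcal{F}$ embeds (it is a Fra\''iss\'e class). For structures $\mathbf{A},\mathbf{B}$, $\mathrm{Emb}(\mathbf{A},\mathbf{B})$ is the set of embeddings. For $\mathbf{A}\in\mathcal{K}$, the big Ramsey degree of $\mathbf{A}$ is the least $\ell<\omega$ (if it exists) such that for every $r<\omega$ and every $\chi:\mathrm{Emb}(\mathbf{A},\mathbf{K})\to r$ there is $\eta\in\mathrm{Emb}(\mathbf{K},\mathbf{K})$ with $|\chi[\{\eta\circ f: f\in \mathrm{Emb}(\mathbf{A},\mathbf{K})\}]|\le \ell$. If $\mathbf{M}$ is a structure and $f:S\to\mathbf{M}$ an injection, $\mathbf{M}\cdot f$ denotes the structure on $S$ making $f$ an embedding. A big Ramsey structure for $\mathbf{K}$ is a structure $\mathbf{K}'$ in a language $\mathcal{L}'\supseteq\mathcal{L}$ such that: (1) the $\mathcal{L}$-reduct of $\mathbf{K}'$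 is $\mathbf{K}$; (2) every $\mathbf{A}\in\mathcal{K}$ has only finitely many $\mathcal{L}'$-expansions (on the same underlying set) which embed into $\mathbf{K}'$; call this set $\mathbf{K}'(\mathbf{A})$; (3) every $\mathbf{A}\in\mathcal{K}$ has big Ramsey degree $|\mathbf{K}'(\mathbf{A})|$; (4) for each $\mathbf{A}\in\mathcal{K}$, the map $\gamma_{\mathbf{A}}:\mathrm{Emb}(\mathbf{A},\mathbf{K})\to\mathbf{K}'(\mathbf{A})$, $\gamma_{\mathbf{A}}(f)=\mathbf{K}'\cdot f$, satisfies $|\gamma_{\mathbf{A}}[\{\eta\circ f: f\in\mathrm{Emb}(\mathbf{A},\mathbf{K})\}]|=|\mathbf{K}'(\mathbf{A})|$ for every $\eta\in\mathrm{Emb}(\mathbf{K},\mathbf{K})$. $\mathbf{K}$ admits a big Ramsey structure if one exists. Dynamics: $G$ carries the pointwise convergence topology; a $G$-flow is a compact Hausdorff space $X$ with a continuous right action of $G$. The left completion $\widehat{G}$ of $G$ is identified with the semigroup $\mathrm{Emb}(\mathbf{K},\mathbf{K})$ (pointwise convergence topology), and every $G$-flow action extends continuously to an action $X\times\mathrm{Emb}(\mathbf{K},\mathbf{K})\to X$. A point $x_0\in X$ is a completion point if $x_0\cdot\eta$ has dense $G$-orbit for every $\eta\in\mathrm{Emb}(\mathbf{K},\mathbf{K})$; $X$ is a completion flow if it has a completion point. A universal completion flow is a completion flow admitting a surjective continuous $G$-equivariant map onto every completion flow. *)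

(* Defs.v *)
From HB Require Import structures.
From mathcomp Require Import all_boot all_order all_algebra.
From mathcomp Require Import all_classical all_reals all_analysis.

Set Implicit Arguments.
Unset Strict Implicit.
Unset Printing Implicit Defensive.

Local Open Scope classical_set_scope.
Local Open Scope card_scope.
Local Open Scope group_scope.

(* Relation symbols have positive arity: with nullary symbols Forb(F) would
   fail joint embedding, already for the empty structures. *)
Record language := Language {
  symbol :> Type;
  arity : symbol -> nat;
  arity_gt0 : forall s, (0 < arity s)%N }.

Definition interp (L : language) (V : Type) :=
  forall s : L, set ((arity s).-tuple V).

Record structure (L : language) := Structure {
  vertex :> Type;
  rel_of : interp L vertex }.

Section Structures.
Variable L : language.
Implicit Types A B C K : structure L.

(* The structure M . f on S, for f : S -> M. *)
Definition pullback (S V : Type) (f : S -> V) (I : interp L V) : interp L S :=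
  fun s => [set t | I s (map_tuple f t)].

Definition is_embedding A B (f : A -> B) :=
  injective f /\ pullback f (@rel_of L B) = @rel_of L A.

Record emb A B := Emb {
  emb_fun :> A -> B;
  embP : is_embedding emb_fun }.

Lemma emb_ext A B (f g : emb A B) : f =1 g -> f = g.
Proof.
case: f g => f pf [g pg] /= /funext fg; case: _ / fg in pg *.
by rewrite (Prop_irrelevance pf pg).
Qed.

Lemma pullback_id V (I : interp L V) : pullback id I = I.
Proof.
apply: functional_extensionality_dep => s; rewrite predeqE => t.
by rewrite /pullback /=; have -> : map_tuple id t = t
  by apply: val_inj; rewrite /= map_id.
Qed.

Lemma pullback_comp S T V (f : S -> T) (g : T -> V) (I : interp L V) :
  pullback (g \o f) I = pullback f (pullback g I).
Proof.
apply: functional_extensionality_dep => s; rewrite predeqE => t.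
rewrite /pullback /=; have -> // : map_tuple (g \o f) t = map_tuple g (map_tuple f t).
by apply: val_inj; rewrite /= map_comp.
Qed.

Lemma is_embedding_id A : is_embedding (@id A).
Proof. by split; [exact: inj_id | exact: pullback_id]. Qed.

Lemma is_embedding_comp A B C (g : B -> C) (f : A -> B) :
  is_embedding g -> is_embedding f -> is_embedding (g \o f).
Proof.
move=> [gi ge] [fi fe]; split; first exact: inj_comp.
by rewrite pullback_comp ge.
Qed.

Definition emb_id A : emb A A := Emb (is_embedding_id A).

Definition emb_comp A B C (g : emb B C) (f : emb A B) : emb A C :=
  Emb (is_embedding_comp (embP g) (embP f)).

Definition embeds A B := inhabited (emb A B).

Definition finite_structure A := finite_set [set: A].

Definition irreducible A := forall u v : A, u <> v ->
  exists (s : L) (t : (arity s).-tuple A) (i j : 'I_(arity s)),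
    [/\ rel_of t, tnth t i = u & tnth t j = v].

Definition Forb (F : set (structure L)) : set (structure L) :=
  [set A | finite_structure A /\ forall B, F B -> ~ embeds B A].

Record aut A := Aut {
  aut_emb :> emb A A;
  aut_bij : bijective aut_emb }.

Definition ultrahomogeneous K :=
  forall A, finite_structure A -> forall f g : emb A K,
    exists a : aut K, g = emb_comp a f.

Definition fraisse_limit (Kcl : set (structure L)) K :=
  [/\ countable [set: K],
      forall A, finite_structure A -> (Kcl A <-> embeds A K) &
      ultrahomogeneous K].

Definition big_ramsey_bound K A (l : nat) :=
  forall (r : nat) (chi : emb A K -> 'I_r), exists eta : emb K K,
    chi @` [set emb_comp eta f | f in [set: emb A K]] #<= `I_l.

Definition big_ramsey_degree K A (l : nat) :=
  big_ramsey_bound K A l /\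
  forall m, big_ramsey_bound K A m -> (l <= m)%N.

End Structures.

(* A language extending L is presented as the disjoint union of L and of the
   language M of the new symbols. *)
Definition lang_sum (L M : language) : language :=
  @Language (L + M)%type
    (fun s => match s with inl s => arity s | inr s => arity s end)
    (fun s => match s with inl s => arity_gt0 s | inr s => arity_gt0 s end).

Definition reduct (L M : language) (V : Type) (I : interp (lang_sum L M) V) :
  interp L V := fun s => I (inl s).

(* The expansions of A, on the vertex set of A, which embed into (K, K'). *)
Definition expansions (L M : language) (K : structure L)
    (K' : interp (lang_sum L M) K) (A : structure L) :
    set (interp (lang_sum L M) A) :=
  [set I | reduct I = @rel_of L A /\ embeds (Structure I) (Structure K')].
Arguments expansions {L M K} K' A.

Definition big_ramsey_structure (L M : language) (Kcl : set (structure L))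
    (K : structure L) (K' : interp (lang_sum L M) K) :=
  [/\ reduct K' = @rel_of L K,
      forall A, Kcl A -> finite_set (expansions K' A),
      forall A, Kcl A ->
        exists2 n, expansions K' A #= `I_n & big_ramsey_degree K A n &
      forall A, Kcl A -> forall eta : emb K K,
        [set pullback (emb_comp eta f) K' | f in [set: emb A K]]
          #= expansions K' A].

Section MonoidGroup.
Variables (L : language) (K : structure L).

HB.instance Definition _ A B := gen_eqMixin (@emb L A B).
HB.instance Definition _ A B := gen_choiceMixin (@emb L A B).

Let emb_compA : associative (@emb_comp L K K K).
Proof. by move=> f g h; apply: emb_ext. Qed.
Let emb_comp1g : left_id (emb_id K) (@emb_comp L K K K).
Proof. by move=> f; apply: emb_ext. Qed.
Let emb_compg1 : right_id (emb_id K) (@emb_comp L K K K).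
Proof. by move=> f; apply: emb_ext. Qed.

HB.instance Definition _ :=
  isMonoid.Build (emb K K) emb_compA emb_comp1g emb_compg1.

HB.instance Definition _ := gen_eqMixin (aut K).
HB.instance Definition _ := gen_choiceMixin (aut K).

Lemma aut_ext (f g : aut K) : f =1 g -> f = g.
Proof.
case: f g => f pf [g pg] /= /emb_ext fg; case: _ / fg in pg *.
by rewrite (Prop_irrelevance pf pg).
Qed.

Definition aut_id : aut K := @Aut L K (emb_id K) (inv_bij (fun=> erefl)).

Definition aut_comp (g h : aut K) : aut K :=
  @Aut L K (emb_comp g h) (bij_comp (aut_bij g) (aut_bij h)).

Lemma aut_inv_exists (g : aut K) : exists h : aut K, cancel g h /\ cancel h g.
Proof.
have [h gK hK] := aut_bij g.
have hP : is_embedding h.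
  split; first exact: can_inj hK.
  have [_ gE] := embP g.
  rewrite -[in LHS]gE -pullback_comp.
  have -> : g \o h = id by apply/funext => x; exact: hK.
  exact: pullback_id.
by exists (@Aut L K (Emb hP) (Bijective hK gK)).
Qed.

Definition aut_inv (g : aut K) : aut K := sval (cid (aut_inv_exists g)).

Let aut_compA : associative aut_comp.
Proof. by move=> f g h; apply: aut_ext. Qed.
Let aut_comp1g : left_id aut_id aut_comp.
Proof. by move=> f; apply: aut_ext. Qed.
Let aut_compg1 : right_id aut_id aut_comp.
Proof. by move=> f; apply: aut_ext. Qed.
Let aut_compVg : left_inverse aut_id aut_inv aut_comp.
Proof.
by move=> g; apply: aut_ext => x; rewrite /aut_inv; case: cid => h [gK hK] /=.
Qed.
Let aut_compgV : right_inverse aut_id aut_inv aut_comp.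
Proof.
by move=> g; apply: aut_ext => x; rewrite /aut_inv; case: cid => h [gK hK] /=.
Qed.

HB.instance Definition _ := isGroup.Build (aut K)
  aut_compA aut_comp1g aut_compg1 aut_compVg aut_compgV.

End MonoidGroup.

(* Pointwise convergence, the target being discrete; [{classic B}] is B with
   its classical choiceType structure. *)
Definition emb_ptws L (A B : structure L) (f : emb A B) :
  {ptws A -> discrete_topology {classic B}} := f.

HB.instance Definition _ L (A B : structure L) :=
  Topological.copy (emb A B) (initial_topology (@emb_ptws L A B)).

HB.instance Definition _ L (K : structure L) :=
  Topological.copy (aut K) (initial_topology (@aut_emb L K)).

Definition homeomorphism (X Y : topologicalType) (f : X -> Y) :=
  continuous f /\ exists g, [/\ cancel f g, cancel g f & continuous g].

Definition metrizable (R : realType) (X : topologicalType) :=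
  exists (M : metricType R) (f : X -> M), homeomorphism f.

Section Flows.
Variables (L : language) (K : structure L).

Record flow := Flow {
  space :> topologicalType;
  act : space -> aut K -> space;
  flow_compact : compact [set: space];
  flow_hausdorff : hausdorff_space space;
  act_continuous : continuous (fun p : space * aut K => act p.1 p.2);
  act1 : forall x, act x 1 = x;
  actM : forall x g h, act x (g * h) = act (act x g) h }.

Implicit Types X Y : flow.

(* Every flow X has such an e, and only one: X is Hausdorff and aut K is dense
   in emb K K when K is ultrahomogeneous. *)
Definition extends_action X (e : X -> emb K K -> X) :=
  [/\ continuous (fun p : X * emb K K => e p.1 p.2),
      forall x (g : aut K), e x g = act x g &
      forall x (eta theta : emb K K), e x (eta * theta) = e (e x eta) theta].

Definition orbit_of X (x : X) : set X := range (act x).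

Definition completion_point X (x0 : X) :=
  exists2 e : X -> emb K K -> X,
    extends_action e & forall eta, dense (orbit_of (e x0 eta)).

Definition completion_flow X := exists x0 : X, completion_point x0.

Definition equivariant X Y (phi : X -> Y) :=
  forall x g, phi (act x g) = act (phi x) g.

Definition universal_completion_flow X :=
  completion_flow X /\
  forall Y, completion_flow Y -> exists phi : X -> Y,
    [/\ continuous phi, equivariant phi & range phi = [set: Y]].

Definition flow_isomorphic X Y :=
  exists2 phi : X -> Y, homeomorphism phi & equivariant phi.

End Flows.

(* Main.v *)
(* The vertices of K are enumerated together with auxiliary points, each of
   which announces the types that later vertices have over a small set of
   vertices; in the resulting sequence every amalgam forbidden by F becomes
   visible at the level of some auxiliary point.  The one-vertex types over
   initial segments of the sequence form a tree, and a Halpern-Lauchli theorem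
   for this tree, proved by a forcing argument, yields a Ramsey theorem for its
   self-embeddings.  A finite set of vertices has an envelope in the tree, whose
   levels are the values of finitely many terms; comparing these values gives
   finitely many new relations, and every colouring depends only on them on a
   suitable copy of K.  A copy of this expansion which realises as few types as
   possible is a big Ramsey structure K'.

   The universal completion flow is the orbit closure X of K' in the compact space
   of expansions.  It maps onto a completion flow Y with completion point y0:
   continuous functions on Y colour the copies of finite structures, so on a
   copy of K they are determined up to a small error by the types of K', and
   an ultralimit along such copies defines the map.  Counting types shows that a
   surjective endomorphism of X is injective, which gives uniqueness. *)

From HB Require Import structures.
From mathcomp Require Import all_boot all_order all_algebra.
From mathcomp Require Import all_classical all_reals all_analysis.
Require Import Defs.
From mathcomp Require Import zify lra.

Set Implicit Arguments.
Unset Strict Implicit.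
Unset Printing Implicit Defensive.

(** * Structures on the naturals with prescribed types, and their morphisms *)

Section Free.
Variables (Q : finType) (q0 : Q) (Bad : forall V : Type, (V -> V -> Q) -> Prop).

Definition irr V (e : V -> V -> Q) :=
  forall x y, x <> y -> e x y <> q0 \/ e y x <> q0.

Definition freeon W (P : W -> Prop) (e : W -> W -> Q) :=
  forall (V : Type) (f : V -> W), injective f -> (forall v, P (f v)) ->
  irr (fun x y => e (f x) (f y)) -> ~ Bad (fun x y => e (f x) (f y)).

Lemma freeon_emb W W' (P : W -> Prop) (P' : W' -> Prop) e e' (g : W -> W') :
  (forall x y, P x -> P y -> g x = g y -> x = y) ->
  (forall x, P x -> P' (g x)) ->
  (forall x y, P x -> P y -> e x y = e' (g x) (g y)) ->
  freeon P' e' -> freeon P e.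
Proof.
move=> gi gP ge fr V f fi fP.
have -> : (fun x y => e (f x) (f y)) = (fun x y => e' (g (f x)) (g (f y))).
  by apply/funext => x; apply/funext => y; apply: ge.
apply: (fr V (g \o f)) => [x y /= /gi xy|v]; last exact: gP.
by apply: fi; apply: xy; apply: fP.
Qed.

(* An irreducible substructure cannot meet both sides of the amalgam. *)
Lemma freeon_amalgam W (P P1 P2 : W -> Prop) (e : W -> W -> Q) :
  (forall x, P x -> P1 x \/ P2 x) ->
  (forall x y, P x -> P y -> ~ P2 x -> ~ P1 y -> e x y = q0 /\ e y x = q0) ->
  freeon P1 e -> freeon P2 e -> freeon P e.
Proof.
move=> cov cross f1 f2 V f fi fP ir.
have [/f1|/existsNP[v nv]] := pselect (forall v, P1 (f v)); first exact.
apply: (f2 V f fi) => // w; apply: contrapT => nw.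
have [e1 e2] := cross _ _ (fP w) (fP v) nw nv.
have vw : w <> v by move=> wv; subst w; case: (cov _ (fP v)).
by case: (ir _ _ vw).
Qed.

Definition letter := (Q * Q)%type.
Definition a0 : letter := (q0, q0).

(* A sequence is a structure on [nat]; [wd b n] is the type of the vertex [n]
   over the vertices below it. *)
Definition wd (b : nat -> nat -> Q) n : seq letter :=
  mkseq (fun i => (b i n, b n i)) n.

Definition cmb (b : nat -> nat -> Q) W (C : W -> W -> Q) (x : W -> seq letter)
    (u v : nat + W) : Q :=
  match u, v with
  | inl i, inl j => b i j
  | inl i, inr c => (nth a0 (x c) i).1
  | inr c, inl i => (nth a0 (x c) i).2
  | inr c, inr d => C c d
  end.

Definition below W n (u : nat + W) := if u is inl i then (i < n)%N : Prop else True.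

(* The structure [C], whose vertices realise the types [x] over the first [n]
   vertices of [b], can be added to these vertices. *)
Definition allowed b n W (C : W -> W -> Q) x := freeon (@below W n) (cmb b C x).

Lemma size_wd b n : size (wd b n) = n. Proof. by rewrite size_mkseq. Qed.

Lemma nth_wd b n i : (i < n)%N -> nth a0 (wd b n) i = (b i n, b n i).
Proof. by move=> ni; rewrite nth_mkseq. Qed.

Lemma allowed_emb b b' n n' W W' (C : W -> W -> Q) (C' : W' -> W' -> Q) x x'
    (g : W -> W') :
  (n <= n')%N -> injective g -> (forall c d, C c d = C' (g c) (g d)) ->
  (forall c i, (i < n)%N -> nth a0 (x c) i = nth a0 (x' (g c)) i) ->
  (forall i j, (i < n)%N -> (j < n)%N -> b i j = b' i j) ->
  allowed b' n' C' x' -> allowed b n C x.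
Proof.
move=> nn gi gC gx bb.
apply: (@freeon_emb _ _ _ _ _ _
  (fun u => match u with inl i => inl i | inr c => inr (g c) end)).
- case=> [i|c] [j|d] //= _ _ []; [by move=> ->|by move=> /gi ->].
- by case=> [i|c] //= iN; exact: leq_trans nn.
- by case=> [i|c] [j|d] //= ? ?; rewrite ?gx // bb.
Qed.

Lemma allowed_eq b n W (C : W -> W -> Q) x x' :
  (forall c i, (i < n)%N -> nth a0 (x c) i = nth a0 (x' c) i) ->
  allowed b n C x -> allowed b n C x'.
Proof. by move=> xx; apply: (@allowed_emb _ _ _ _ _ _ _ _ _ _ id) => // c i /xx ->. Qed.

Lemma allowed_le b n n' W (C : W -> W -> Q) x :
  (n <= n')%N -> allowed b n' C x -> allowed b n C x.
Proof. by move=> nn; apply: (@allowed_emb _ _ _ _ _ _ _ _ _ _ id). Qed.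

Definition addv b n W (C : W -> W -> Q) (x : W -> seq letter) (u v : option W) :=
  match u, v with
  | None, None => b n n
  | None, Some c => (nth a0 (x c) n).1
  | Some c, None => (nth a0 (x c) n).2
  | Some c, Some d => C c d
  end.

Definition addx W (t : seq letter) (x : W -> seq letter) (u : option W) :=
  if u is Some c then x c else t.

Lemma allowedS b n W (C : W -> W -> Q) x :
  allowed b n.+1 C x <-> allowed b n (addv b n C x) (addx (wd b n) x).
Proof.
split.
- apply: (@freeon_emb _ _ _ _ _ _ (fun u : nat + option W => match u with
    | inl i => inl i | inr None => inl n | inr (Some c) => inr c end)).
  + case=> [i|[c|]] [j|[d|]] //= Hi Hj; try by case=> ->.
    * by case=> E; subst i; rewrite ltnn in Hi.
    * by case=> E; subst j; rewrite ltnn in Hj.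
  + by case=> [i|[c|]] //= Hi; apply: leq_trans Hi _.
  + by case=> [i|[c|]] [j|[d|]] //= Hi Hj; rewrite nth_wd.
- apply: (@freeon_emb _ _ _ _ _ _ (fun u : nat + W => match u with
    | inl i => if i == n then inr None else inl i | inr c => inr (Some c) end)).
  + case=> [i|c] [j|d] //=; try by case: eqP.
    * by case: eqP => [->|_]; case: eqP => [->|_] // _ _ [->].
    * by move=> _ _ [->].
  + by case=> [i|c] //=; rewrite ltnS leq_eqVlt; case: eqP.
  + case=> [i|c] [j|d] //=.
    * rewrite !ltnS => Hi Hj; case: (eqVneq i n) => [E|ni]; case: (eqVneq j n) => [E'|nj] //=;
        rewrite ?E ?E' // nth_wd //; lia.
    * by move=> _ _; case: (eqVneq i n) => [->|].
    * by move=> _ _; case: (eqVneq j n) => [->|].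
Qed.

Lemma allowed_zero b m m' I (P : I -> Prop) (q : I -> seq letter) W
    (C : W -> W -> Q) (x : W -> I) :
  (m <= m')%N ->
  (forall W' (C' : W' -> W' -> Q) (x' : W' -> I), (forall c, P (x' c)) ->
     allowed b m C' (q \o x') -> allowed b m' C' (q \o x')) ->
  (forall i, ~ P i -> forall j, (m <= j < m')%N -> nth a0 (q i) j = a0) ->
  allowed b m C (q \o x) -> allowed b m' C (q \o x).
Proof.
move=> mm HP Hz Ha.
apply: (@freeon_amalgam _ _ (@below W m) (fun u : nat + W => match u with
  | inl i => (i < m')%N : Prop | inr c => P (x c) end)).
- by case=> [i|c] /= H; [right|left].
- case=> [i|c] [j|d] //= Hi Hj H2 H1.
  by rewrite Hz //= leqNgt Hj andbT; apply/negP.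
- exact: Ha.
- pose W' := {c : W | P (x c)}.
  have H : allowed b m' (fun c d : W' => C (sval c) (sval d))
      (q \o (fun c : W' => x (sval c))).
    apply: HP => [[c pc] //|].
    apply: (@allowed_emb _ _ _ _ _ _ _ _ _ _ (@sval _ _)) Ha => //.
    by case=> c pc [d pd] /= cd; subst d; rewrite (Prop_irrelevance pc pd).
  move=> V f fi fP; have Hk : forall v, exists u : nat + W',
      below m' u /\ f v = match u with inl i => inl i | inr c => inr (sval c) end.
    move=> v; have := fP v; case E: (f v) => [i|c] Hv; first by exists (inl i).
    by exists (inr (exist _ c Hv)).
  have [k Hk'] := choice Hk.
  have fk : forall v w, cmb b C (q \o x) (f v) (f w) =
      cmb b (fun c d : W' => C (sval c) (sval d)) (q \o (fun c => x (sval c))) (k v) (k w).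
    by move=> v w; have [_ ->] := Hk' v; have [_ ->] := Hk' w; case: (k v) (k w) => [?|?] [?|?].
  have -> : (fun v w => cmb b C (q \o x) (f v) (f w)) = (fun v w =>
      cmb b (fun c d : W' => C (sval c) (sval d)) (q \o (fun c => x (sval c))) (k v) (k w)).
    by apply/funext => v; apply/funext => w; exact: fk.
  apply: (H V k) => [v w vw|v]; last by have [] := Hk' v.
  by apply: fi; have [_ ->] := Hk' v; have [_ ->] := Hk' w; rewrite vw.
Qed.

Definition valid b := forall n, freeon (fun i : nat => (i < n)%N : Prop) b.

Lemma allowed_pad b m m' W (C : W -> W -> Q) x :
  valid b -> (m <= m')%N ->
  (forall c j, (m <= j < m')%N -> nth a0 (x c) j = a0) ->
  allowed b m C x -> allowed b m' C x.
Proof.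
move=> vb mm Hz; apply: (@allowed_zero b m m' _ (fun=> False) x _ C id) => //.
  move=> W' C' x' F _; apply: (@freeon_emb _ _ _ _ _ _
    (fun u : nat + W' => if u is inl i then i else 0) _ _ _ (vb m')).
  - case=> [i|c] [j|d]; [by move=> _ _ /= ->|by case: (F d)|by case: (F c)|by case: (F c)].
  - by case=> [i|c]; [|case: (F c)].
  - by case=> [i|c] [j|d]; [|case: (F d)|case: (F c)|case: (F c)].
by move=> c _ j; exact: Hz.
Qed.

Definition pt (u : Q) (_ _ : unit) := u.

Definition generic g :=
  [/\ valid g & forall m t u N, size t = m -> allowed g m (pt u) (fun=> t) ->
    exists n, [/\ (N <= n)%N, (m <= n)%N, wd g n = t ++ nseq (n - m) a0 & g n n = u]].

Section Generic.
Variable star : Q.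
Hypothesis starP : forall (V : Type) (e : V -> V -> Q),
  (forall x y : V, x = y) -> (forall x, e x x = star) -> ~ Bad e.

Let ofcol (col : nat -> seq letter * Q) i j :=
  if (i < j)%N then (nth a0 (col j).1 i).1
  else if (j < i)%N then (nth a0 (col i).1 j).2 else (col i).2.

Let dflt : seq letter * Q := ([::], star).

Let next (l : seq (seq letter * Q)) : seq letter * Q :=
  let n := size l in
  if unpickle (logn 2 n.+1) is Some r then
    if pselect (size (r.1 : seq letter) <= n /\
       allowed (ofcol (nth dflt l)) (size r.1) (pt r.2) (fun=> r.1))%N
    then (r.1 ++ nseq (n - size r.1) a0, r.2) else (nseq n a0, star)
  else (nseq n a0, star).

Let Fixpoint st n := if n is k.+1 then rcons (st k) (next (st k)) else [::].

Let size_st n : size (st n) = n.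
Proof. by elim: n => //= n IH; rewrite size_rcons IH. Qed.

Let col n := next (st n).

Let nth_st n i : (i < n)%N -> nth dflt (st n) i = col i.
Proof.
elim: n => // n IH; rewrite ltnS leq_eqVlt /= nth_rcons size_st.
by case: eqP => [->|_ /= ni]; [rewrite ltnn|rewrite ni IH].
Qed.

Let G := ofcol col.

Let G_st n i j : (i < n)%N -> (j < n)%N -> ofcol (nth dflt (st n)) i j = G i j.
Proof. by move=> ni nj; rewrite /G /ofcol !nth_st. Qed.

Let colP n : size (col n).1 = n /\
  (((col n) = (nseq n a0, star)) \/ exists t u, [/\ (size t <= n)%N,
     allowed G (size t) (pt u) (fun=> t) & col n = (t ++ nseq (n - size t) a0, u)]).
Proof.
rewrite /col /next size_st; case: unpickle => [[t u]|] /=; last first.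
  by rewrite size_nseq; split=> //; left.
case: pselect => [[/= tn al]|_] /=; last by rewrite size_nseq; split=> //; left.
split; first by rewrite size_cat size_nseq subnKC.
right; exists t, u; split=> //.
apply: (@allowed_emb _ _ _ _ _ _ _ _ _ _ id) al => // i j it jt.
by rewrite G_st //; apply: leq_trans tn.
Qed.

Let wdG n : wd G n = (col n).1.
Proof.
have [sz _] := colP n.
apply: (@eq_from_nth _ a0); first by rewrite size_wd sz.
rewrite size_wd => i ni; rewrite nth_wd // /G /ofcol ni ltnNge (ltnW ni) /=.
by rewrite -surjective_pairing.
Qed.

Let GP n : G n n = (col n).2.
Proof. by rewrite /G /ofcol ltnn. Qed.

Let extend n : freeon (fun i : nat => (i < n)%N : Prop) G ->
  allowed G n (pt (G n n)) (fun=> wd G n) ->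
  freeon (fun i : nat => (i < n.+1)%N : Prop) G.
Proof.
move=> _; apply: (@freeon_emb _ _ _ _ _ _
  (fun i : nat => if i == n then inr tt else inl i)).
- move=> i j _ _; case: (eqVneq i n) => [->|_]; case: (eqVneq j n) => [->|_] //; by case.
- by move=> i; rewrite ltnS leq_eqVlt; case: (eqVneq i n).
- move=> i j; rewrite !ltnS => Hi Hj.
  case: (eqVneq i n) => [E|ni]; case: (eqVneq j n) => [E'|nj] //=;
    rewrite ?E ?E' // nth_wd //; lia.
Qed.

Let validG : valid G.
Proof.
elim=> [|n IH]; first by move=> V f fi fP _; apply: starP => v; have := fP v.
apply: extend => //.
have noW k (W : Type) (C : W -> W -> Q) x : (k <= n)%N -> (W -> False) -> allowed G k C x.
  move=> kn F; apply: (@freeon_emb _ _ _ _ _ _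
    (fun u : nat + W => if u is inl i then i else 0) _ _ _ IH).
  - case=> [i|c] [j|d]; [by move=> _ _ /= ->|by case: (F d)|by case: (F c)|by case: (F c)].
  - by case=> [i|c]; [move=> /= ik; apply: leq_trans kn|case: (F c)].
  - by case=> [i|c] [j|d]; [|case: (F d)|case: (F c)|case: (F c)].
have [_ [E|[t [u [tn al E]]]]] := colP n.
  have : allowed G 0 (pt (G n n)) (fun=> wd G n).
    move=> V f fi fP ir; apply: starP => [v w|v].
      by apply: fi; have := fP v; have := fP w; case: (f v) (f w) => [?|[]] [?|[]].
    by have := fP v; case: (f v) => [?|[]] //= _; rewrite /pt GP E.
  apply: (@allowed_zero G 0 n _ (fun=> False) (fun=> wd G n) unit _ (fun=> tt)) => //.
  - by move=> W' C' x' F _; apply: noW => // c; apply: (F c).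
  - by move=> _ _ j /= jn; rewrite wdG E nth_nseq jn.
have : allowed G (size t) (pt (G n n)) (fun=> wd G n).
  rewrite GP E; apply: allowed_eq al => _ i it.
  by rewrite wdG E nth_cat it.
apply: (@allowed_zero G _ n _ (fun=> False) (fun=> wd G n) unit _ (fun=> tt)) => //.
- by move=> W' C' x' F _; apply: noW => // c; apply: (F c).
- move=> _ _ j /andP[tj jn]; rewrite wdG E nth_cat ltnNge tj /= nth_nseq.
  by case: ifP.
Qed.

Lemma generic_exists : exists g, generic g.
Proof.
exists G; split; first exact: validG.
move=> _ t u N <- al.
pose k := pickle (t, u); pose n := ((2 ^ k * (N + size t).*2.+1).-1)%N.
have k2 : (0 < 2 ^ k)%N by rewrite expn_gt0.
have n1 : n.+1 = (2 ^ k * (N + size t).*2.+1)%N by rewrite /n prednK // muln_gt0 k2.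
have kn : logn 2 n.+1 = k.
  by rewrite n1 lognM // pfactorK // logn_coprime ?addn0 // coprime2n /= odd_double.
have Nn : (N + size t <= n)%N.
  by rewrite -ltnS n1; apply: leq_trans (leq_pmull _ k2); rewrite ltnS -addnn leq_addr.
have tn : (size t <= n)%N by apply: leq_trans Nn; exact: leq_addl.
have {Nn}Nn : (N <= n)%N by apply: leq_trans Nn; exact: leq_addr.
have E : col n = (t ++ nseq (n - size t) a0, u).
  rewrite /col /next size_st kn /k pickleK /=.
  case: pselect => [//|[]]; split => //.
  apply: (@allowed_emb _ _ _ _ _ _ _ _ _ _ id) al => // i j /= it jt.
  by rewrite G_st //; [exact: leq_trans tn|exact: leq_trans tn].
by exists n; rewrite wdG GP E.
Qed.

End Generic.

(* Morphisms of sequences: the letters of the image of a type at the image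
   levels are those of the type, and no age is lost. *)
Definition morn n (b g : nat -> nat -> Q) (h : nat -> nat)
    (F : seq letter -> seq letter) :=
  [/\ forall t, (size t < n)%N -> size (F t) = h (size t),
      forall t s, ((size t).+1 < n)%N -> prefix (rcons (F t) s) (F (rcons t s)),
      forall i, (i < n)%N -> wd g (h i) = F (wd b i) /\ g (h i) (h i) = b i i &
      forall i W (C : W -> W -> Q) x, (i < n)%N -> (forall c, size (x c) = i) ->
        allowed b i C x -> allowed g (h i) C (F \o x)].

Definition mor b g h F := forall n, morn n b g h F.

Lemma morn_comp n b g k h F h' F' :
  morn n b g h F -> mor g k h' F' -> morn n b k (h' \o h) (F' \o F).
Proof.
move=> [s p v a] m'; have m0 N : morn N g k h' F' := m' N.
split.
- by move=> t tn /=; have [-> //] := m0 (size (F t)).+1; rewrite s.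
- move=> t c tn /=.
  have [s' p' _ _] := m0 (size (F (rcons t c))).+1.
  have /prefixP[r E] := p t c tn.
  have sz : ((size (F t)).+1 <= size (F (rcons t c)))%N.
    by rewrite E size_cat size_rcons leq_addr.
  rewrite E; have gen w : (size (rcons (F t) c ++ w) <= size (F (rcons t c)))%N ->
      prefix (rcons (F' (F t)) c) (F' (rcons (F t) c ++ w)).
    elim/last_ind: w => [|w d IH]; rewrite -?rcons_cat ?cats0 => H.
      by apply: p'.
    have := p' (rcons (F t) c ++ w) d; rewrite size_rcons in H.
    move/(_ H); apply: prefix_trans.
    by apply: prefix_trans (IH _) (prefix_rcons _ _); apply: leq_trans H.
  by apply: gen; rewrite -E.
- move=> i ni /=; have [E1 E2] := v i ni.
  have [_ _ /(_ (h i) (ltnSn _))[E3 E4] _] := m0 (h i).+1.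
  by rewrite E3 E1 E4.
- move=> i W C x ni sx al /=.
  have [_ _ _ a'] := m0 (h i).+1.
  apply: (a' (h i) W C (F \o x)) => //; last exact: a.
  by move=> c /=; rewrite s sx.
Qed.

Lemma mor_comp b g k h F h' F' :
  mor b g h F -> mor g k h' F' -> mor b k (h' \o h) (F' \o F).
Proof. by move=> m m' n; apply: morn_comp. Qed.

Lemma mor_id b : mor b b id id.
Proof. by move=> n; split=> // t s _; rewrite prefix_refl. Qed.

Lemma morn_le n n' b g h F : (n <= n')%N -> morn n' b g h F -> morn n b g h F.
Proof.
move=> nn [s p v a]; split=> [t tn|t c tn|i ni|i W C x ni].
- by apply: s; apply: leq_trans nn.
- by apply: p; apply: leq_trans nn.
- by apply: v; apply: leq_trans nn.
- by apply: a; apply: leq_trans nn.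
Qed.

End Free.

Local Open Scope classical_set_scope.

Lemma dependent_choice_seq T (P : seq T -> Prop) :
  P [::] -> (forall l, P l -> exists x, P (rcons l x)) ->
  exists g : nat -> T, forall n, P (mkseq g n).
Proof.
move=> P0 PS.
have /choice[next nextP] : forall l : {l | P l}, exists x, P (rcons (sval l) x).
  by case=> l Pl; apply: PS.
pose st := fix st n : {l | P l} :=
  if n is k.+1 then exist _ (rcons (sval (st k)) (next (st k))) (nextP (st k))
  else exist _ [::] P0.
exists (fun n => next (st n)) => n.
suff -> : mkseq (fun n => next (st n)) n = sval (st n) by exact: svalP.
by elim: n => // n IH; rewrite -[n.+1]addn1 /mkseq iotaD map_cat -/(mkseq _ n) IH cats1 addn1.
Qed.

Section Ramsey.
Variables (U : set_system nat) (UU : UltraFilter U) (Uoo : forall N, U [set n | N <= n]%N).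

Lemma filter_seq (T : eqType) (s : seq T) (P : T -> nat -> Prop) :
  (forall x, x \in s -> U (P x)) -> U [set n | forall x, x \in s -> P x n].
Proof.
elim: s => [|x s IH] H.
  by apply: filterS filterT => n _ y.
have H1 := H x (mem_head _ _).
have H2 : U [set n | forall x, x \in s -> P x n].
  by apply: IH => y ys; apply: H; rewrite in_cons ys orbT.
by apply: filterS2 H1 H2 => n h1 h2 y; rewrite in_cons => /orP[/eqP->|/h2].
Qed.

Lemma ultra_fin (T : finType) (f : nat -> T) : exists t, U [set n | f n = t].
Proof.
apply: contrapT => /forallNP H.
have /filter_ex[n /(_ (f n))] : U [set n | forall t, t \in enum T -> f n <> t].
  apply: (@filter_seq _ _ (fun t n => f n <> t)) => t _.
  by case: (@in_ultra_setVsetC _ _ [set n | f n = t] UU) => // /H.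
by rewrite mem_enum => /(_ isT).
Qed.

Variables (T : finType) (c : seq nat -> T).

Fixpoint ultra_lim k s : T :=
  if k is k'.+1 then sval (cid (ultra_fin (fun n => ultra_lim k' (rcons s n))))
  else c s.

Lemma ultra_limP k s :
  U [set n | ultra_lim k (rcons s n) = ultra_lim k.+1 s].
Proof. exact: svalP (cid (ultra_fin (fun n => ultra_lim k (rcons s n)))). Qed.

Lemma ramsey_seq r : exists g : nat -> nat, {homo g : x y / (x < y)%N} /\
  exists t, forall s, sorted ltn s -> size s = r -> c (map g s) = t.
Proof.
pose e := ultra_lim r [::].
pose P (l : seq nat) := sorted ltn l /\ forall s, subseq s l -> (size s <= r)%N ->
  ultra_lim (r - size s) s = e.
have [||g gP] := @dependent_choice_seq nat P.
- by split=> // s; rewrite subseq0 => /eqP->; rewrite subn0.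
- move=> l [sl lP].
  have H1 : U [set n | forall s, s \in [seq mask (tval m) l | m <- enum {: (size l).-tuple bool}] ->
      (size s < r)%N -> ultra_lim (r - (size s).+1) (rcons s n) = e].
    apply: (@filter_seq _ _ (fun s n => (size s < r)%N ->
      ultra_lim (r - (size s).+1) (rcons s n) = e)) => _ /mapP[m _ ->].
    have sub : subseq (mask m l) l by apply: mask_subseq.
    have [H|H] := ltnP (size (mask m l)) r; last by apply: filterS filterT.
    have E := lP _ sub (ltnW H).
    move: E; rewrite -(subnSK H) => E.
    by apply: filterS (ultra_limP (r - (size (mask m l)).+1) (mask m l)) => n H' _; exact: etrans H' E.
  have H2 : U [set n | forall x, x \in l -> (x < n)%N].
    by apply: (@filter_seq _ l (fun x n => (x < n)%N : Prop)) => x _; apply: Uoo.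
  have PU : ProperFilter U by exact: ultra_proper.
  have H3 : Filter U by exact: filter_filter.
  have [n [nl H]] := @filter_ex _ U PU _ (@filterI _ U H3 _ _ H2 H1).
  exists n; split.
    rewrite (sorted_pairwise ltn_trans) pairwise_rcons -(sorted_pairwise ltn_trans) sl andbT.
    exact/allP.
  move=> s; rewrite -subseq_rev rev_rcons.
  case/lastP: s => [|s x] /=; first by rewrite subn0.
  rewrite rev_rcons /=; case: eqP => [->|_]; last first.
    by rewrite -rev_rcons subseq_rev => sub sz; apply: lP.
  rewrite subseq_rev size_rcons => /subseqP[m sm ->] sz.
  by apply: H => //; apply/mapP; exists (Tuple (introT eqP sm)); rewrite ?mem_enum.
have gm : {homo g : x y / (x < y)%N}.
  move=> x y xy; have [+ _] := gP y.+1.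
  move/(sorted_ltn_nth ltn_trans 0)/(_ x y); rewrite !inE !size_mkseq.
  by rewrite !nth_mkseq ?ltnS ?(ltnW xy) //; apply.
exists g; split=> //; exists e => s ss sr.
pose n := (\max_(x <- s) x).+1.
have sub : subseq s (iota 0 n).
  have -> : s = [seq x <- iota 0 n | x \in s].
    apply: (irr_sorted_eq ltn_trans ltnn) => //.
      by apply: sorted_filter; [exact: ltn_trans|exact: iota_ltn_sorted].
    move=> x; rewrite mem_filter mem_iota /= add0n /n ltnS; apply/idP/andP => [xs|[]//].
    by split=> //; apply: leq_bigmax_seq.
  exact: filter_subseq.
have [_ /(_ (map g s))] := gP n.
by rewrite size_map sr subnn; apply=> //; apply: map_subseq.
Qed.

End Ramsey.

Lemma nat_ultrafilter : exists U : set_system nat, UltraFilter U /\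
  forall N, U [set n | (N <= n)%N].
Proof.
have [U [UU sU]] := @ultraFilterLemma nat \oo _.
by exists U; split=> // N; apply: sU; exact: nbhs_infty_ge.
Qed.

Section Polar.

Lemma no_injection G (i : (G -> Prop) -> G) : ~ injective i.
Proof.
move=> ii; pose D g := forall P, g = i P -> ~ P g.
have H : D (i D) -> False by move=> H; exact: (H D erefl).
by apply: (H) => P /ii <-.
Qed.

Lemma infinite_fiber G (i : G * nat -> G) (phi : (G -> Prop) -> G) : injective i ->
  exists z : nat -> (G -> Prop), injective z /\ exists g, forall n, phi (z n) = g.
Proof.
move=> ii; pose Z : choiceType := {classic (G -> Prop)}.
have [[g Hg]|H] := pselect (exists g, forall l : seq Z, exists z : Z, phi z = g /\ z \notin l).
  have [||z zP] := @dependent_choice_seq Z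
    (fun l => uniq l /\ forall z, z \in l -> phi z = g); first by split.
    move=> l [ul lP]; have [z [zg zl]] := Hg l; exists z.
    rewrite rcons_uniq zl ul; split=> // t; rewrite mem_rcons in_cons => /orP[/eqP->//|].
    exact: lP.
  suff zi : injective z.
    exists z; split=> //; exists g => n; have [_ zn] := zP n.+1.
    by apply: zn; apply: map_f; rewrite mem_iota add0n /=.
  move=> x y xy; have [u _] := zP (maxn x y).+1.
  have := @nth_uniq _ (z 0) _ x y _ _ u; rewrite !size_mkseq !ltnS leq_maxl leq_maxr.
  move=> /(_ isT isT); rewrite !nth_mkseq ?ltnS ?leq_maxl ?leq_maxr // xy eqxx.
  by move/esym/eqP.
have /choice[l lP] : forall g, exists l : seq Z, forall z : Z, phi z = g -> z \in l.
  move=> g; apply: contrapT => /forallNP Hl; apply: H; exists g => l.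
  have /existsNP[z zl] := Hl l; exists z; apply: contrapT => Hz; apply: zl => zg.
  by case: (boolP (z \in l)) => // nz; case: Hz.
exfalso; apply: (@no_injection G (fun P => i (phi P, index (P : Z) (l (phi P))))).
move=> P P' /ii[E E']; have Hn := nth_index (P : Z) (lP _ P erefl).
by rewrite -Hn E' E nth_index //; apply: lP.
Qed.

Lemma polarized (S : finType) (l : seq S) : uniq l -> exists Y : Type, inhabited Y /\
  forall (f : (S -> Y) -> nat) (y0 : S -> Y), exists a : S -> nat -> Y,
  (forall s, s \in l -> injective (a s)) /\
  exists v, forall i : S -> nat, f (fun s => if s \in l then a s (i s) else y0 s) = v.
Proof.
elim: l => [_|s l IH /= /andP[sl ul]].
  exists nat; split; first exact: (inhabits 0).
  by move=> f y0; exists (fun _ n => n); split=> //; exists (f y0).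
have [Y' [[y'] HY]] := IH ul.
pose G := (S -> Y') -> nat.
pose pr (p : G * nat) : G := fun x => pickle (p.1 x, p.2).
have pri : injective pr.
  move=> [g n] [g' n'] E.
  have E' x : g x = g' x /\ n = n'.
    by have := congr1 (fun h => h x) E; rewrite /pr /= => /(pcan_inj pickleK)[-> ->].
  by congr pair; [apply/funext => x; case: (E' x)|case: (E' (fun=> y'))].
exists (Y' + (G -> Prop))%type; split; first exact: (inhabits (inl y')).
move=> f y0.
pose phi (z : G -> Prop) : G := fun x =>
  f (fun t => if t == s then inr z else if t \in l then inl (x t) else y0 t).
have [z [zi [g gz]]] := infinite_fiber phi pri.
have [a [ai [v vP]]] := HY g (fun=> y').
exists (fun t n => if t == s then inr (z n) else inl (a t n)); split.
  move=> t; rewrite in_cons; case: eqP => [_ _|_ /= tl] n n'; first by move=> [/zi].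
  by move=> [/(ai _ tl)].
exists v => i; rewrite -(vP i) -(gz (i s)) /phi; congr f; apply/funext => t.
by rewrite in_cons; case: eqP => [->|_] //=; case: ifP.
Qed.

End Polar.

(** * The Halpern-Lauchli theorem for generic sequences *)

Lemma conflict_free d N (I : Type) (D : ('I_d -> nat) -> nat -> I) :
  (forall i k l, (k < N)%N -> (l < N)%N -> D i k = D i l -> k = l) ->
  forall n, exists b : 'I_d -> nat -> nat, (forall s, injective (b s)) /\
  forall i j, (forall s, i s < n)%N -> (forall s, j s < n)%N ->
  forall k l, (k < N)%N -> (l < N)%N ->
  D (fun s => b s (i s)) k = D (fun s => b s (j s)) l -> k = l.
Proof.
move=> Dinj n.
have [U [UU Uoo]] := nat_ultrafilter.
pose bits := {ffun 'I_d -> bool}.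
pose eqD (x y : 'I_d -> nat) (kl : 'I_N * 'I_N) := `[< D x kl.1 = D y kl.2 >].
pose c (x : seq nat) := [ffun p : bits * bits * ('I_N * 'I_N) =>
  eqD (fun s => nth 0 x (s.*2 + p.1.1 s)) (fun s => nth 0 x (s.*2 + p.1.2 s)) p.2].
have [g [gm [t gt]]] := ramsey_seq UU Uoo c d.*2.
have gi : injective g.
  move=> x y xy; case: (ltngtP x y) => // /gm; rewrite xy ltnn //.
pose K := (n + 4)%N.
exists (fun s m => g (s * K + m)%N); split=> [s x y /gi/addnI//|].
have key (i j : 'I_d -> nat) (kl : 'I_N * 'I_N) :
    (forall s, i s < K.-1)%N -> (forall s, j s < K.-1)%N ->
    eqD (fun s => g (s * K + i s)%N) (fun s => g (s * K + j s)%N) kl =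
    t ([ffun s => j s < i s], [ffun s => i s < j s], kl)%N.
  move=> iK jK.
  pose lo q := if insub q is Some s then minn (i s) (j s) else 0.
  pose hi q := if insub q is Some s then
    (if i s == j s then (i s).+1 else maxn (i s) (j s)) else 1.
  have lohi q : (lo q < hi q)%N.
    by rewrite /lo /hi; case: insub => // s; case: eqP; lia.
  have hiK q : (hi q < K)%N.
    by rewrite /hi; case: insub => [s|]; [have := iK s; have := jK s; case: eqP|]; rewrite /K; lia.
  pose v p := (p./2 * K + (if odd p then hi p./2 else lo p./2))%N.
  have vm : {homo v : x y / (x < y)%N}.
    move=> x y xy; rewrite /v.
    have Hx : ((if odd x then hi x./2 else lo x./2) < K)%N.
      by case: odd => //; apply: ltn_trans (lohi _) (hiK _).
    have [xy2|xy2|E] := ltngtP x./2 y./2; last 2 first.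
    - by have := half_leq (ltnW xy); lia.
    - have : odd x = false /\ odd y = true.
        by have := odd_double_half x; have := odd_double_half y; rewrite E; case: odd; case: odd; lia.
      by case=> -> ->; rewrite E ltn_add2l.
    - have : (x./2.+1 * K <= y./2 * K)%N by rewrite leq_mul2r xy2 orbT.
      by rewrite mulSn; lia.
  pose x := mkseq v d.*2.
  have sx : sorted ltn x.
    by apply: (homo_sorted vm); exact: iota_ltn_sorted.
  have := gt x sx (size_mkseq _ _) => /(congr1 (fun f : {ffun _ -> bool} =>
    f ([ffun s => j s < i s], [ffun s => i s < j s], kl)%N)).
  rewrite ffunE => <- /=.
  have nx (s : 'I_d) (e : bool) : nth 0 (map g x) (s.*2 + e) =
      g (s * K + (if e then hi s else lo s))%N.
    have sd : (s.*2 + e < d.*2)%N by have := ltn_ord s; case: e; lia.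
    rewrite (nth_map 0) ?size_mkseq // nth_mkseq // /v.
    have -> : (s.*2 + e)./2 = s by case: (e); rewrite ?addn0 ?addn1 /= ?uphalf_double ?doubleK.
    by rewrite oddD odd_double; case: (e).
  congr eqD; apply/funext => s; rewrite nx !ffunE /lo /hi valK; congr g; congr addn;
    case: (ltngtP (i s) (j s)) => //; lia.
move=> i j iN jN k l kN lN E.
have iK s : (i s < K.-1)%N by have := iN s; rewrite /K; lia.
have jK s : (j s < K.-1)%N by have := jN s; rewrite /K; lia.
pose kl := (Ordinal kN, Ordinal lN).
have Et : t ([ffun s => j s < i s], [ffun s => i s < j s], kl)%N.
  by rewrite -key //; apply/asboolP.
pose p (m : nat) s := if (i s < j s)%N then m else if (j s < i s)%N then (2 - m)%N else 0.
have pK m : (m <= 2)%N -> forall s, (p m s < K.-1)%N.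
  by move=> m2 s; rewrite /p /K; case: ifP => _; [|case: ifP => _]; lia.
have pt m m' : (m < m' <= 2)%N -> D (fun s => g (s * K + p m s)%N) k = D (fun s => g (s * K + p m' s)%N) l.
  move=> /andP[mm m2]; have m2' : (m <= 2)%N by lia.
  have : eqD (fun s => g (s * K + p m s)%N) (fun s => g (s * K + p m' s)%N) kl.
    rewrite key; [|exact: pK|exact: pK].
    have -> : [ffun s => p m' s < p m s]%N = [ffun s => j s < i s]%N :> bits.
      by apply/ffunP => s; rewrite !ffunE /p; case: (ltngtP (i s) (j s)) => _ //; lia.
    have -> // : [ffun s => p m s < p m' s]%N = [ffun s => i s < j s]%N :> bits.
    by apply/ffunP => s; rewrite !ffunE /p; case: (ltngtP (i s) (j s)) => _ //; lia.
  by move/asboolP.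
apply: (Dinj (fun s => g (s * K + p 1 s)%N)) => //.
by rewrite (pt 1 2) // -(pt 0 2) // (pt 0 1).
Qed.

Lemma In_cat T (x : T) s1 s2 : List.In x (s1 ++ s2) <-> List.In x s1 \/ List.In x s2.
Proof. by elim: s1 => [|y s IH] /=; [split=> [|[]]; auto|rewrite IH; tauto]. Qed.

Lemma In_filter T (p : pred T) x s : List.In x (seq.filter p s) <-> List.In x s /\ p x.
Proof.
elim: s => [|y s IH] /=; first by split=> // -[].
case: ifP => py /=; rewrite IH; split.
- by move=> [<-|[]]; auto.
- by case=> -[|]; auto.
- by case; auto.
- by case=> -[yx|] //; rewrite -yx py.
Qed.

Section Forcing.
Variables (T Sec Key : Type) (k : nat) (le : T -> T -> Prop) (key : Sec -> Key)
  (adm real : T -> Key -> Prop) (col : T -> Sec -> 'I_k).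
Hypotheses (le_refl : forall p, le p p)
  (le_trans : forall p q r, le r q -> le q p -> le r p)
  (real_ex : forall q c, adm q c -> exists r, le r q /\ real r c).

(* [(p, a, e)] stands for: [p] forces that the section [a] has colour [e]. *)
Definition good (R : set (T * Sec * 'I_k)) :=
  forall q c (L : seq (T * Sec * 'I_k)), adm q c ->
  (forall x, List.In x L -> [/\ R x, key x.1.2 = c & le q x.1.1]) ->
  exists r, [/\ le r q, real r c & forall x, List.In x L -> col r x.1.2 = x.2].

Lemma good_exists : exists R, good R /\
  forall B, R `<` B -> ~ good B.
Proof.
apply: Zorn_bigcup => F Fgood Ftot q c L adm_q HL.
have [X [XF XL]] : exists X, (F X \/ X = set0) /\ forall x, List.In x L -> X x.
  have : forall x, List.In x L -> (\bigcup_(X in F) X) x by move=> x /HL[].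
  elim: L {HL} => [_|x L IH H]; first by exists set0; split=> //; right.
  have [X [XF XL]] : exists X, (F X \/ X = set0) /\ forall x, List.In x L -> X x.
    by apply: IH => y yL; apply: H; right.
  have [Z ZF Zx] := H x (or_introl erefl).
  have [XZ|ZX] : X `<=` Z \/ Z `<=` X.
    by case: XF => [XF|->]; [have [|] := Ftot _ _ XF ZF; [left|right]|left; exact: sub0set].
  - by exists Z; split; [left|move=> y [<-//|/XL/XZ]].
  - by exists X; split=> // y [<-|/XL//]; exact: ZX.
case: XF => [XF|X0].
  by apply: (Fgood _ XF) => // x xL; split; [exact: XL|by have [] := HL _ xL|by have [] := HL _ xL].
have [r [rq rr]] := real_ex adm_q.
by exists r; split=> // x /XL; rewrite X0.
Qed.

Lemma forcing : exists R, good R /\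
  forall p a, adm p (key a) -> exists p' e, le p' p /\ R (p', a, e).
Proof.
have [R [gR Rmax]] := good_exists; exists R; split=> // p a adm_p.
apply: contrapT => H.
have nR q e : le q p -> ~ R (q, a, e) by move=> qp Rq; apply: H; exists q, e.
have : forall j, (j <= k)%N -> exists q L, [/\ le q p, adm q (key a),
    forall x, List.In x L -> [/\ R x, key x.1.2 = key a & le q x.1.1] &
    forall r, le r q -> real r (key a) -> (forall x, List.In x L -> col r x.1.2 = x.2) ->
      (j <= col r a)%N].
  elim=> [_|j IH jk]; first by exists p, [::]; split.
  have [q [L [qp adm_q HL Hr]]] := IH (ltnW jk).
  pose e := Ordinal jk.
  have : ~ good (R `|` [set (q, a, e)]).
    apply: Rmax; split; first by move=> x Rx; left.
    by move=> /(_ (q, a, e) (or_intror erefl)); exact: nR.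
  move=> /existsNP[q' /existsNP[c /existsNP[L' /not_implyP[adm_q' /not_implyP[HL' Hn]]]]].
  have [Hin|Hin] := pselect (List.In (q, a, e) L'); last first.
    case: Hn; apply: gR => // x xL; have [[Rx|Ex] k1 l1] := HL' _ xL; first by split.
    by case: Hin; rewrite -Ex.
  have [_ /= kc q'q] := HL' _ Hin; subst c.
  exists q', (L ++ [seq x <- L' | `[< R x >]]); split=> //.
  - exact: le_trans qp.
  - move=> x /In_cat[xL|].
      by have [? ? lx] := HL _ xL; split=> //; exact: le_trans lx.
    move=> /In_filter[xL' /asboolP Rx].
    by have [_ ? ?] := HL' _ xL'; split.
  - move=> r rq' rr Hx.
    have Hj : (j <= col r a)%N.
      apply: Hr => //; first exact: le_trans q'q.
      by move=> x xL; apply: Hx; apply/In_cat; left.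
    rewrite ltn_neqAle Hj andbT; apply/eqP => jE; apply: Hn; exists r; split=> //.
    move=> x xL'; have [[Rx|->] _ _] := HL' _ xL'; last exact/val_inj.
    by apply: Hx; apply/In_cat; right; apply/In_filter; split=> //; apply/asboolP.
move=> /(_ k (leqnn k))[q [L [qp adm_q HL Hr]]].
have [r [rq rr Hc]] := gR q (key a) L adm_q HL.
by have := Hr r rq rr Hc; rewrite leqNgt ltn_ord.
Qed.

End Forcing.

Lemma In_mapP (T : eqType) U (f : T -> U) s x :
  List.In x (map f s) <-> exists2 y, y \in s & x = f y.
Proof.
elim: s => [|y s IH] /=; first by split=> // -[].
rewrite IH; split=> [[<-|[z zs ->]]|[z]]; first by exists y; rewrite ?mem_head.
  by exists z; rewrite ?in_cons ?zs ?orbT.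
by rewrite in_cons => /orP[/eqP-> ->|zs ->]; [left|right; exists z].
Qed.

Section LevelSets.
Variables (Q : finType) (q0 : Q) (Bad : forall V : Type, (V -> V -> Q) -> Prop).
Variables (g : nat -> nat -> Q) (gen : generic q0 Bad g).
Notation al := (allowed q0 Bad g).
Notation z0 := (a0 q0).

Lemma allowed_cat m n W (C : W -> W -> Q) x : (m <= n)%N ->
  (forall c, size (x c) = m) -> al m C x -> al n C (fun c => x c ++ nseq (n - m) z0).
Proof.
move=> mn sx Ha; apply: (@allowed_pad _ _ _ _ m n) => //; first by case: gen.
  by move=> c j /andP[mj _]; rewrite nth_cat sx ltnNge mj /= nth_nseq; case: ifP.
by apply: allowed_eq Ha => c i im; rewrite nth_cat sx im.
Qed.

Variables (d : nat) (f : 'I_d -> seq (letter Q)) (N : nat) (w : 'I_d) (u : Q).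
Variables (k : nat) (c : nat -> ('I_d -> seq (letter Q)) -> 'I_k).
Hypothesis size_f : forall s, size (f s) = N.
Hypothesis adm_f : al N (pt u) (fun=> f w).

Section Conditions.
Variable Y : choiceType.

Record cond := Cond {
  dom : seq ('I_d * Y);
  lvl : nat;
  val : 'I_d * Y -> seq (letter Q);
  valP : forall i, i \in dom -> size (val i) = lvl }.

Definition cond_le r q :=
  [/\ {subset dom q <= dom r}, (lvl q <= lvl r)%N,
      forall i, i \in dom q -> prefix (val q i) (val r i) &
      forall W (C : W -> W -> Q) x, (forall c, x c \in dom q) ->
        al (lvl q) C (val q \o x) -> al (lvl r) C (val r \o x)].

Lemma cond_le_refl p : cond_le p p.
Proof. by split=> // i _; exact: prefix_refl. Qed.

Lemma cond_le_trans p q r : cond_le r q -> cond_le q p -> cond_le r p.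
Proof.
move=> [s1 l1 p1 a1] [s2 l2 p2 a2]; split.
- by move=> i /s2/s1.
- exact: leq_trans l1.
- by move=> i ip; apply: prefix_trans (p2 _ ip) (p1 _ (s2 _ ip)).
- by move=> W C x xp H; apply: a1 => [e|]; [exact: s2|exact: a2].
Qed.

Definition cond_adm q i := i \in dom q /\ al (lvl q) (pt u) (fun=> val q i).

Definition cond_real r i :=
  [/\ i \in dom r, wd g (lvl r) = val r i & g (lvl r) (lvl r) = u].

Lemma cond_real_ex q i : cond_adm q i -> exists r, cond_le r q /\ cond_real r i.
Proof.
move=> [iq Ha]; have [_ H] := gen.
have [n [_ qn E1 E2]] := H _ _ _ 0 (valP iq) Ha.
have valP' : forall j, j \in dom q -> size (val q j ++ nseq (n - lvl q) z0) = n.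
  by move=> j /valP; rewrite size_cat size_nseq => ->; rewrite subnKC.
exists (Cond valP'); split; last by split.
split=> //= [j jq|W C x xq]; first exact: prefix_prefix.
by apply: (allowed_cat qn) => e; apply: valP.
Qed.

Definition section_key (a : 'I_d -> Y) : 'I_d * Y := (w, a w).

Definition section_col r (a : 'I_d -> Y) := c (lvl r) (fun s => val r (s, a s)).

Definition graph_of (a : 'I_d -> Y) := [seq (s, a s) | s <- enum 'I_d].

Lemma base_valP a : forall i : 'I_d * Y, i \in graph_of a -> size (f i.1) = N.
Proof. by move=> i _; exact: size_f. Qed.

Definition base a := Cond (@base_valP a).

Lemma mem_graph a s : (s, a s) \in graph_of a.
Proof. by apply/mapP; exists s; rewrite ?mem_enum. Qed.

Definition enum_dom (p : cond) a := graph_of a ++ [seq i <- undup (dom p) | i \notin graph_of a].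

Lemma enum_dom_uniq p a : uniq (enum_dom p a).
Proof.
rewrite cat_uniq filter_uniq ?undup_uniq // andbT map_inj_uniq ?enum_uniq /=.
  by apply/hasPn => i; rewrite mem_filter => /andP[].
by move=> s t [].
Qed.

Lemma mem_enum_dom p a i : i \in dom p -> i \in enum_dom p a.
Proof. by move=> ip; rewrite mem_cat mem_filter mem_undup ip andbT orbN. Qed.

End Conditions.

(* The Halpern-Lauchli core: above some level set [t] all the level sets can
   be extended so that all their full sections get the colour [e]. *)
Lemma halpern_lauchli : exists M t e, [/\ (N <= M)%N,
  forall s, size (t s) = M /\ prefix (f s) (t s),
  forall W (C : W -> W -> Q) (x : W -> 'I_d), al N C (f \o x) -> al M C (t \o x) &
  forall (J : finType) (la : J -> 'I_d) (Psi : J -> seq (letter Q)) m (j0 : J),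
    (M <= m)%N -> (forall j, size (Psi j) = m /\ prefix (t (la j)) (Psi j)) ->
    la j0 = w -> al m (pt u) (fun=> Psi j0) ->
    exists n r, [/\ (m <= n)%N, forall j, size (r j) = n /\ prefix (Psi j) (r j),
      forall W (C : W -> W -> Q) (x : W -> J), al m C (Psi \o x) -> al n C (r \o x),
      wd g n = r j0 /\ g n n = u &
      forall si : 'I_d -> J, (forall s, la (si s) = s) -> si w = j0 ->
        (forall W (C : W -> W -> Q) (x : W -> 'I_d), al M C (t \o x) ->
           al m C (Psi \o si \o x)) ->
        c n (r \o si) = e]].
Proof.
have [Y0 [[y0] polar]] := @polarized 'I_d (enum 'I_d) (enum_uniq _).
pose Y : choiceType := {classic Y0}.
have [R [gR denseR]] := @forcing _ _ _ k (@cond_le Y) (@section_key Y) (@cond_adm Y)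
  (@cond_real Y) (@section_col Y) (@cond_le_refl Y) (@cond_le_trans Y) (@cond_real_ex Y).
have : forall a : 'I_d -> Y, exists pe : cond Y * 'I_k,
    cond_le pe.1 (base a) /\ R (pe.1, a, pe.2).
  move=> a; have [|p [e [? ?]]] := denseR (base a) a; last by exists (p, e).
  by split; [exact: mem_graph|exact: adm_f].
move=> /choice[pe peP]; pose p a := (pe a).1; pose ee a := (pe a).2.
pose code a := (size (enum_dom (p a) a), lvl (p a), ee a, map (fun i => (i.1, val (p a) i)) (enum_dom (p a) a)).
have [a [ai [v vP]]] := polar (fun a : 'I_d -> Y => pickle (code a)) (fun=> y0).
pose al_ (i : 'I_d -> nat) : 'I_d -> Y := fun s => a s (i s).
have codeE i j : code (al_ i) = code (al_ j).
  apply: (pcan_inj pickleK).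
  have E b : pickle (code (al_ b)) = v.
    by rewrite -(vP b); congr (pickle (code _)); apply/funext => s; rewrite mem_enum.
  by rewrite !E.
have {}ai s : injective (a s) by apply: ai; rewrite mem_enum.
pose i0 : 'I_d -> nat := fun=> 0.
pose K := size (enum_dom (p (al_ i0)) (al_ i0)); pose M := lvl (p (al_ i0)).
pose e := ee (al_ i0); pose L := map (fun i => (i.1, val (p (al_ i0)) i)) (enum_dom (p (al_ i0)) (al_ i0)).
pose E i := enum_dom (p (al_ i)) (al_ i).
have [szE lvE eE LE] : [/\ forall i, size (E i) = K, forall i, lvl (p (al_ i)) = M,
    forall i, ee (al_ i) = e & forall i, map (fun j => (j.1, val (p (al_ i)) j)) (E i) = L].
  by split=> i; have [] := codeE i i0.
pose df : 'I_d * Y := (w, y0 : Y).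
pose D i n := nth df (E i) n.
have Dinj i n n' : (n < K)%N -> (n' < K)%N -> D i n = D i n' -> n = n'.
  rewrite -(szE i) => nK nK' H; apply/eqP.
  rewrite -(@nth_uniq _ df (E i)) //; last exact: enum_dom_uniq.
  by apply/eqP.
have dK : (d <= K)%N.
  by rewrite -(szE i0) size_cat size_map size_enum_ord leq_addr.
have Ds i (s : 'I_d) : D i s = (s, al_ i s).
  rewrite /D /E nth_cat size_map size_enum_ord ltn_ord (nth_map s) ?size_enum_ord ?ltn_ord //.
  by rewrite nth_ord_enum.
pose V n := (nth (w, [::]) L n).2.
have VE i n : (n < K)%N -> val (p (al_ i)) (D i n) = V n.
  by move=> nK; rewrite /V -(LE i) (nth_map df) ?szE.
have DP i n : (n < K)%N -> D i n \in E i by move=> nK; rewrite mem_nth // szE.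
have Dex i x : x \in E i -> exists2 n, (n < K)%N & x = D i n.
  by move=> xE; exists (index x (E i)); rewrite ?/D ?nth_index // -(szE i) index_mem.
have base_sub i x : x \in E i -> x \in dom (p (al_ i)).
  rewrite mem_cat mem_filter mem_undup => /orP[/mapP[s _ ->]|/andP[]//].
  by have [[sub _ _ _] _] := peP (al_ i); apply: sub; apply: mem_graph.
pose t (s : 'I_d) := V s.
have tE i s : val (p (al_ i)) (s, al_ i s) = t s.
  by rewrite -Ds VE //; apply: leq_trans dK.
exists M, t, e; split.
- by have [[_ lM _ _] _] := peP (al_ i0).
- move=> s; rewrite -(tE i0); split.
    by apply: valP; rewrite -Ds; apply: base_sub; apply: DP; apply: leq_trans dK.
  have [[_ _ pre _] _] := peP (al_ i0).
  by have := pre (s, al_ i0 s) (mem_graph _ _).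
- move=> W C x H; have [[_ _ _ age] _] := peP (al_ i0).
  have := age W C (fun c => (x c, al_ i0 (x c))) (fun=> mem_graph _ _) H.
  by apply: allowed_eq => e' i _ /=; rewrite -(tE i0).
move=> J la Psi m j0 Mm PsiP laj0 admj0.
have [b [bi bD]] := conflict_free Dinj #|J|.
pose idx (j : J) : 'I_d * Y := (la j, a (la j) (b (la j) (enum_rank j))).
have idxi : injective idx.
  move=> j j' [E1]; move: (E1) => ->; move=> /ai/bi/ord_inj; exact: enum_rank_inj.
pose gp (si : 'I_d -> J) : 'I_d -> nat := fun s => b s (enum_rank (si s)).
have gpE si s : la (si s) = s -> (s, al_ (gp si) s) = idx (si s).
  by move=> E1; rewrite /idx E1.
have cf (si si' : 'I_d -> J) n n' : (n < K)%N -> (n' < K)%N -> D (gp si) n = D (gp si') n' -> n = n'.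
  move=> nK nK'; apply: (bD (fun s => enum_rank (si s)) (fun s => enum_rank (si' s))) => //;
  by move=> s; exact: ltn_ord.
have cfi (si : 'I_d -> J) n j : (n < K)%N -> D (gp si) n = idx j -> n = la j.
  move=> nK E1; apply: (cf si (fun=> j)) => //; first exact: leq_trans (ltn_ord _) dK.
  by rewrite E1 Ds /idx /al_ /gp.
pose secs := [seq si : {ffun 'I_d -> J} <- enum {ffun 'I_d -> J} | [forall s, la (si s) == s]].
pose isx x n := (n < K)%N /\ exists si : 'I_d -> J, x = D (gp si) n.
pose vq x := if [pick j | idx j == x] is Some j then Psi j else
  if pselect (exists n, isx x n) is left H then V (sval (cid H)) ++ nseq (m - M) z0 else [::].
have vq_idx j : vq (idx j) = Psi j.
  rewrite /vq; case: pickP => [j' /eqP/idxi->//|/(_ j)]; by rewrite eqxx.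
have vq_D si n : (n < K)%N -> (forall j, idx j <> D (gp si) n) ->
    vq (D (gp si) n) = V n ++ nseq (m - M) z0.
  move=> nK nj; rewrite /vq; case: pickP => [j /eqP/nj//|_].
  case: pselect => [H|[]]; last by exists n; split=> //; exists si.
  case: cid => n' /= [nK' [si' E1]]; congr (V _ ++ _); exact/esym/(cf si si').
have sV n : (n < K)%N -> size (V n) = M.
  by move=> nK; rewrite -(VE i0) // -(lvE i0); apply: valP; apply: base_sub; apply: DP.
pose dq := [seq idx j | j <- enum J] ++ flatten [seq E (gp si) | si : {ffun 'I_d -> J} <- secs].
have vqP x : x \in dq -> size (vq x) = m.
  rewrite mem_cat => /orP[/mapP[j _ ->]|/flattenP[s /mapP[si _ ->] /Dex[n nK ->]]].
    by rewrite vq_idx; case: (PsiP j).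
  have [[j ->]|nj] := pselect (exists j, D (gp si) n = idx j).
    by rewrite vq_idx; case: (PsiP j).
  rewrite vq_D //; first by rewrite size_cat size_nseq sV // subnKC.
  by move=> j Ej; apply: nj; exists j.
pose q := Cond vqP.
pose full (si : {ffun 'I_d -> J}) := `[< forall W (C : W -> W -> Q) (x : W -> 'I_d), al M C (t \o x) ->
           al m C (Psi \o si \o x) >].
pose tri := [seq (p (al_ (gp si)), al_ (gp si), e) | si : {ffun 'I_d -> J} <- secs & full si && (si w == j0)].
have [] := gR q (idx j0) tri.
- split; first by rewrite mem_cat map_f ?mem_enum.
  by rewrite /= vq_idx.
- move=> x xtri.
  have [si [sisec fsi siw ->]] : exists si, [/\ si \in secs, full si, si w = j0 &
      x = (p (al_ (gp si)), al_ (gp si), e)].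
    move: xtri => /In_mapP[si + ->]; rewrite mem_filter => /andP[/andP[fsi /eqP siw] sis].
    by exists si.
  have lasi s : la (si s) = s.
    by move: sisec; rewrite mem_filter => /andP[/forallP/(_ s)/eqP].
  have [ple Rp] := peP (al_ (gp si)).
  split=> /=; first by rewrite -/(ee (al_ (gp si))) in Rp *; rewrite -(eE (gp si)).
    by rewrite /section_key gpE ?lasi // siw.
  have subE : {subset dom (p (al_ (gp si))) <= dq}.
    move=> y /mem_enum_dom yE; rewrite mem_cat; apply/orP; right.
    apply/flattenP; exists (E (gp si)); last exact: yE.
    exact: (map_f (fun si : {ffun 'I_d -> J} => E (gp si)) sisec).
  have valE y : y \in dom (p (al_ (gp si))) ->
      (exists s, y = idx (si s)) /\ prefix (val (p (al_ (gp si))) y) (vq y) \/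
      vq y = val (p (al_ (gp si))) y ++ nseq (m - M) z0.
    move=> /(@mem_enum_dom _ _ (al_ (gp si)))/Dex[n nK ->].
    have [[j Ej]|nj] := pselect (exists j, D (gp si) n = idx j); last first.
      by right; rewrite vq_D ?VE // => j Ej; apply: nj; exists j.
    have En := cfi _ _ _ nK Ej.
    have jE : j = si (la j) by apply: idxi; rewrite -gpE ?lasi // -Ej En Ds.
    left; split; first by exists (la j); rewrite -jE.
    by rewrite VE // Ej vq_idx En; case: (PsiP j).
  split=> //=.
  + by rewrite lvE.
  + by move=> y yd; have [[_ //]|->] := valE _ yd; exact: prefix_prefix.
  + move=> W C x' xd Ha; rewrite lvE in Ha.
    pose vq' y := if y \in dom (p (al_ (gp si))) then vq y else [::].
    have Hvq : vq \o x' = vq' \o x' by apply/funext => c' /=; rewrite /vq' xd.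
    rewrite Hvq; apply: (@allowed_zero _ q0 Bad g M m _ (fun y => exists s, y = idx (si s))) => //.
    * move=> W' C' x'' /choice[s sP] H.
      have /(_ W' C' s) : forall W' (C' : W' -> W' -> Q) s, al M C' (t \o s) -> al m C' (Psi \o si \o s).
        by move: fsi => /asboolP.
      have Hs c' : idx (si (s c')) \in dom (p (al_ (gp si))).
        rewrite -gpE ?lasi //; apply: base_sub; rewrite -Ds; apply: DP.
        exact: leq_trans (ltn_ord _) dK.
      have EE c' : vq' (x'' c') = Psi (si (s c')) by rewrite sP /vq' Hs vq_idx.
      have -> : vq' \o x'' = Psi \o si \o s by apply/funext => c'; rewrite /= EE.
      apply; apply: allowed_eq H => c' i iM /=; rewrite EE.
      have [sz] := PsiP (si (s c')); rewrite lasi => /prefixP[r ->].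
      by rewrite nth_cat sV ?iM //; exact: leq_trans (ltn_ord _) dK.
    * move=> y ny j /andP[Mj jm]; rewrite /vq'; case: ifP => [yd|_]; last by rewrite nth_nil.
      have [[//]|->] := valE _ yd; rewrite nth_cat (valP yd) lvE ltnNge Mj /= nth_nseq.
      by case: ifP.
    * apply: allowed_eq Ha => c' i iM /=; rewrite /vq' xd.
      have [[_ /prefixP[r ->]]|->] := valE _ (xd c');
      by rewrite nth_cat (valP (xd c')) lvE iM.
- move=> r [[/= sub ml pre age] [_ wr ur] colr].
  have idq j : idx j \in dq by rewrite mem_cat map_f ?mem_enum.
  exists (lvl r), (fun j => val r (idx j)); split=> //.
  + move=> j; split; first by apply: valP; apply: sub.
    by rewrite -vq_idx; apply: pre.
  + move=> W C x H; apply: (age W C (idx \o x)) => [c'|]; first exact: idq.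
    by apply: allowed_eq H => c' i _ /=; rewrite vq_idx.
  + move=> si lasi siw fsi.
    pose sf := [ffun s => si s].
    have sfE : (sf : 'I_d -> J) = si by apply/funext => s; rewrite ffunE.
    have sfs : sf \in secs.
      by rewrite mem_filter mem_enum andbT; apply/forallP => s; rewrite ffunE lasi.
    have ff : full sf by apply/asboolP; rewrite sfE.
    have : List.In (p (al_ (gp sf)), al_ (gp sf), e) tri.
      apply/In_mapP; exists sf => //.
      by rewrite mem_filter ff sfs ffunE siw eqxx.
    move=> /colr /= <-; rewrite /section_col; congr c; apply/funext => s /=.
    by rewrite -gpE ?lasi // sfE.
Qed.

End LevelSets.

(** * Ramsey theorem for morphisms of sequences *)

Section Morphisms.
Variables (Q : finType) (q0 : Q) (Bad : forall V : Type, (V -> V -> Q) -> Prop).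
Notation word := (seq (letter Q)).
Notation z0 := (a0 q0).
Notation morn := (morn q0 Bad).
Notation mor := (mor q0 Bad).
Notation allowed := (allowed q0 Bad).

Definition ages b g m M (p : word -> word) :=
  forall W (C : W -> W -> Q) x, (forall c, size (x c) = m) ->
  allowed b m C x -> allowed g M C (p \o x).

Definition nextp m (r : word -> word) t := rcons (r (take m t)) (nth z0 t m).

Lemma size_nextp m n r : (forall t, size t = m -> size (r t) = n) ->
  forall t, size t = m.+1 -> size (nextp m r t) = n.+1.
Proof. by move=> sr t st; rewrite size_rcons sr // size_take st ltnSn. Qed.

Lemma ages_next b g m n r : ages b g m n r ->
  (forall t, size t = m -> size (r t) = n) -> wd g n = r (wd b m) ->
  g n n = b m m -> ages b g m.+1 n.+1 (nextp m r).
Proof.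
move=> ag sr ew ev W C x sx; rewrite !allowedS => Ha.
have st c : size (take m (x c)) = m by rewrite size_take sx ltnSn.
have E : addv q0 g n C (nextp m r \o x) = addv q0 b m C x.
  apply/funext => -[c|]; apply/funext => -[d|] //=;
  by rewrite /nextp nth_rcons sr // ltnn eqxx.
rewrite E; apply: allowed_eq (ag _ _ (addx (wd b m) (take m \o x)) _ _).
- by move=> [c|] i ni /=; rewrite ?ew // /nextp nth_rcons sr // ni.
- by move=> [c|] /=; rewrite ?size_wd.
- by apply: allowed_eq Ha => -[c|] i ni //=; rewrite nth_take.
Qed.

Definition ext_step b g m M p n r :=
  [/\ (M <= n)%N, forall t, size t = m -> size (r t) = n /\ prefix (p t) (r t),
      ages b g m n r & wd g n = r (wd b m) /\ g n n = b m m].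

Lemma mor_build b g (I : nat -> nat -> (word -> word) -> Prop)
    (Ex : nat -> nat -> (word -> word) -> Prop) :
  (forall m n r r', (forall t, size t = m -> r t = r' t) -> Ex m n r -> Ex m n r') ->
  I 0 0 (fun=> [::]) ->
  (forall m M p, I m M p -> (forall t, size t = m -> size (p t) = M) ->
     ages b g m M p -> exists n r, [/\ ext_step b g m M p n r, Ex m n r &
       I m.+1 n.+1 (nextp m r)]) ->
  exists h F, mor b g h F /\ forall m, Ex m (h m) F.
Proof.
move=> Exe I0 step.
have /choice[nx nxP] : forall x : nat * (nat * (word -> word)),
    exists y : nat * (word -> word), I x.1 x.2.1 x.2.2 ->
      (forall t, size t = x.1 -> size (x.2.2 t) = x.2.1) ->
      ages b g x.1 x.2.1 x.2.2 ->
      [/\ ext_step b g x.1 x.2.1 x.2.2 y.1 y.2, Ex x.1 y.1 y.2 &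
          I x.1.+1 y.1.+1 (nextp x.1 y.2)].
  move=> [m [M p]] /=; have [H|nI] := pselect (I m M p /\
      (forall t, size t = m -> size (p t) = M) /\ ages b g m M p); last first.
    by exists (0, p) => i s a; case: nI.
  by have [n [r ?]] := step m M p H.1 H.2.1 H.2.2; exists (n, r).
pose st := fix st m := if m is k.+1 then
  ((nx (k, st k)).1.+1, nextp k (nx (k, st k)).2) else (0, fun _ : word => [::]).
pose h m := (nx (m, st m)).1; pose r m := (nx (m, st m)).2.
have stP m : [/\ I m (st m).1 (st m).2,
    forall t, size t = m -> size ((st m).2 t) = (st m).1 & ages b g m (st m).1 (st m).2].
  elim: m => [|m [Im sm am]].
    split=> // W C x sx; apply: (@allowed_emb _ _ _ _ _ _ _ _ _ _ _ _ _ id) => //.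
  have [[_ sr ar [ew ev]] _ In] := nxP (m, st m) Im sm am.
  split=> //; first by apply: size_nextp => t /sr[].
  by apply: ages_next => // t /sr[].
have good m : [/\ ext_step b g m (st m).1 (st m).2 (h m) (r m) & Ex m (h m) (r m)].
  by have [i s a] := stP m; have [] := nxP (m, st m) i s a.
exists h, (fun t => r (size t) t); split; last first.
  by move=> m; have [_] := good m; apply: Exe => t <-.
move=> n; split.
- by move=> t _; have [[_ /(_ t erefl)[]]] := good (size t).
- move=> t s _; rewrite size_rcons; have [[_ H _ _] _] := good (size t).+1.
  have [_] := H (rcons t s) (size_rcons _ _); rewrite /= /nextp.
  by rewrite -[in take _ _]cats1 take_size_cat // nth_rcons ltnn eqxx.
- by move=> i _; have [[_ _ _ []]] := good i; rewrite size_wd.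
- move=> i W C x _ sx Ha; have [[_ _ ag _] _] := good i.
  by have := ag W C x sx Ha; apply: allowed_eq => c j _ /=; rewrite sx.
Qed.

Lemma valid_allowed b m : valid q0 Bad b -> allowed b m (pt (b m m)) (fun=> wd b m).
Proof.
move=> /(_ m.+1); apply: (@freeon_emb _ _ _ _ _ _ _ _ _
  (fun u : nat + unit => if u is inl i then i else m)).
- case=> [i|[]] [j|[]] //= Hi Hj; first by move=> ->.
  + by move=> E; rewrite E ltnn in Hi.
  + by move=> E; rewrite -E ltnn in Hj.
- by case=> [i|[]] //= Hi; apply: ltnW.
- by case=> [i|[]] [j|[]] //= Hi Hj; rewrite nth_wd.
Qed.

Section MorFacts.
Variables (n : nat) (b g : nat -> nat -> Q) (h : nat -> nat) (F : word -> word).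
Hypothesis mF : morn n b g h F.

Lemma morn_size t : (size t < n)%N -> size (F t) = h (size t).
Proof. by case: mF => s _ _ _; exact: s. Qed.

Lemma morn_lt i j : (i < j < n)%N -> (h i < h j)%N.
Proof.
move=> /andP[+ jn]; elim: j jn => // j IH jn; rewrite ltnS leq_eqVlt.
have H : (h j < h j.+1)%N.
  have [s p _ _] := mF; pose t := nseq j z0.
  have sj : size t = j by rewrite size_nseq.
  have /size_prefix : prefix (rcons (F t) z0) (F (rcons t z0)) by apply: p; rewrite sj.
  by rewrite size_rcons !s ?size_rcons sj // ltnW.
by case/orP => [/eqP->//|/(IH (ltnW jn))/ltn_trans]; apply.
Qed.

Lemma morn_prefix t i : (size t < n)%N -> (i <= size t)%N -> prefix (F (take i t)) (F t).
Proof.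
elim/last_ind: t => [|t s IH]; first by rewrite prefix_refl.
rewrite size_rcons => tn; rewrite leq_eqVlt => /orP[/eqP->|it].
  by rewrite -(size_rcons t s) take_size prefix_refl.
rewrite ltnS in it; rewrite -cats1 takel_cat // cats1.
apply: prefix_trans (IH (ltnW tn) it) _; have [_ p _ _] := mF.
exact: prefix_trans (prefix_rcons _ _) (p t s tn).
Qed.

Lemma morn_letter t i : (i < size t < n)%N -> nth z0 (F t) (h i) = nth z0 t i.
Proof.
move=> /andP[it tn]; have [s p _ _] := mF.
have := morn_prefix tn it; rewrite (take_nth z0) // => H.
have sti : size (take i t) = i by rewrite size_take it.
have /prefixP[r ->] : prefix (rcons (F (take i t)) (nth z0 t i)) (F t).
  by apply: prefix_trans (p _ _ _) H; rewrite sti; apply: leq_ltn_trans tn.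
have si : size (F (take i t)) = h i by rewrite s sti // (ltn_trans it).
by rewrite nth_cat size_rcons si ltnSn nth_rcons si ltnn eqxx.
Qed.

Lemma morn_rel i j : (i < n)%N -> (j < n)%N -> g (h i) (h j) = b i j.
Proof.
have H k l : (k < l)%N -> (l < n)%N -> (g (h k) (h l), g (h l) (h k)) = (b k l, b l k).
  move=> kl ln; have [_ _ v _] := mF; have [ew _] := v l ln.
  have hkl : (h k < h l)%N by apply: morn_lt; rewrite kl.
  rewrite -(nth_wd q0 _ hkl) ew morn_letter ?nth_wd // size_wd kl //.
move=> ni nj; case: (ltngtP i j) => [ij|ji|<-].
- by case: (H _ _ ij nj).
- by case: (H _ _ ji ni).
- by have [_ _ v _] := mF; have [] := v i ni.
Qed.

Definition top := if n is k.+1 then (h k).+1 else 0.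
Definition premap := if n is k.+1 then nextp k F else fun=> [::].

Lemma lt_top i : (i < n)%N -> (h i < top)%N.
Proof.
rewrite /top; move: (@morn_lt i n.-1); case: n => // k /= H.
rewrite ltnS leq_eqVlt => /orP[/eqP->//|ik].
by rewrite ltnS ltnW // H // ik ltnSn.
Qed.

Lemma size_premap t : size t = n -> size (premap t) = top.
Proof.
rewrite /premap /top; have := morn_size; case: n => // k H st.
have stk : size (take k t) = k by rewrite size_take st ltnSn.
by rewrite /nextp size_rcons H stk.
Qed.

Lemma premap_ages : ages b g n top premap.
Proof.
rewrite /premap /top; case: n mF => [_|k [s p v a]].
  by move=> W C x sx; apply: (@allowed_emb _ _ _ _ _ _ _ _ _ _ _ _ _ id).
have [ew ev] := v k (ltnSn _).
apply: (ages_next _ _ ew ev) => [W C x sx|t st]; first exact: a.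
by rewrite s st.
Qed.

Lemma premap_letter t i : size t = n -> (i < n)%N -> nth z0 (premap t) (h i) = nth z0 t i.
Proof.
rewrite /premap; have := lt_top; rewrite /top; have := morn_letter; have := morn_size.
have := morn_lt; case: n => // k Hlt Hs Hl Ht st ik; have stk : size (take k t) = k by rewrite size_take st ltnSn.
rewrite /nextp nth_rcons Hs stk //; case: (ltngtP (h i) (h k)) => [hik|hki|E].
- have ik' : (i < k)%N by move: ik; rewrite ltnS leq_eqVlt => /orP[/eqP E|//]; rewrite E ltnn in hik.
  by rewrite Hl ?nth_take // stk ik' /=.
- by have := Ht i ik; rewrite ltnS leqNgt hki.
- move: ik; rewrite ltnS leq_eqVlt => /orP[/eqP->//|ik].
  by have := Hlt i k; rewrite ik E ltnn ltnSn => /(_ isT).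
Qed.

Lemma premap_ages_inv W (C : W -> W -> Q) x : (forall c, size (x c) = n) ->
  allowed g top C (premap \o x) -> allowed b n C x.
Proof.
move=> sx; apply: (@freeon_emb _ _ _ _ _ _ _ _ _
  (fun u : nat + W => if u is inl i then inl (h i) else u)).
- case=> [i|c] [j|d] //= ni nj [] // E; congr inl.
  have := @morn_lt i j; have := @morn_lt j i; rewrite ni nj !andbT E ltnn.
  by case: ltngtP => // _; [move=> /(_ isT)|move=> _ /(_ isT)].
- by case=> [i|c] //= ni; apply: lt_top.
- by case=> [i|c] [j|d] //= ni nj; rewrite ?premap_letter ?morn_rel.
Qed.

End MorFacts.

Definition agree n (h : nat -> nat) (F : word -> word) h' F' :=
  (forall i, (i < n)%N -> h i = h' i) /\ (forall t, (size t < n)%N -> F t = F' t).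

Definition fixes N (h : nat -> nat) (F : word -> word) := agree N h F id id.

Lemma premap_ext n b g h F h' F' t : morn n.+1 b g h' F' -> agree n h F h' F' ->
  size t = n -> prefix (premap n F t) (F' t).
Proof.
move=> m [ah aF]; rewrite /premap; case: n ah aF m => [_ _ _ _|k _ aF m st]; first exact: prefix0s.
have stk : size (take k t) = k by rewrite size_take st ltnSn.
rewrite /nextp aF ?stk //; have [_ p _ _] := m.
have := p (take k t) (nth z0 t k); rewrite stk => /(_ (ltnSn _)).
by rewrite -take_nth ?st // -st take_size.
Qed.

End Morphisms.

Section Pigeonhole.
Variables (Q : finType) (q0 : Q) (Bad : forall V : Type, (V -> V -> Q) -> Prop).
Notation word := (seq (letter Q)).
Notation z0 := (a0 q0).
Notation morn := (morn q0 Bad).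
Notation mor := (mor q0 Bad).
Notation allowed := (allowed q0 Bad).
Notation ages := (ages q0 Bad).
Variables (g : nat -> nat -> Q) (gen : generic q0 Bad g).
Variables (b : nat -> nat -> Q) (vb : valid q0 Bad b).

Definition pad M (t : word) : word := t ++ nseq (M - size t) z0.

Lemma size_pad M t : (size t <= M)%N -> size (pad M t) = M.
Proof. by move=> tM; rewrite size_cat size_nseq subnKC. Qed.

Lemma nth_pad M t i : (size t <= i)%N -> nth z0 (pad M t) i = z0.
Proof. by move=> ti; rewrite nth_cat ltnNge ti /= nth_nseq; case: ifP. Qed.

Lemma prefix_pad M t : prefix t (pad M t).
Proof. exact: prefix_prefix. Qed.

Lemma prefix_take (t s : word) : prefix t s -> take (size t) s = t.
Proof. by case/prefixP => r ->; rewrite take_size_cat. Qed.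

Lemma nth_prefix (t s : word) i : prefix t s -> (i < size t)%N -> nth z0 t i = nth z0 s i.
Proof. by case/prefixP => r -> it; rewrite nth_cat it. Qed.

Lemma ages_zero b' m M n (p r : word -> word) (P : word -> Prop) :
  ages b' g m M p -> (M <= n)%N ->
  (forall t, size t = m -> size (p t) = M /\ prefix (p t) (r t)) ->
  (forall t, size t = m -> ~ P t -> forall j, (M <= j)%N -> nth z0 (r t) j = z0) ->
  (forall W (C : W -> W -> Q) x, (forall c, size (x c) = m /\ P (x c)) ->
    allowed g M C (p \o x) -> allowed g n C (r \o x)) ->
  ages b' g m n r.
Proof.
move=> ag Mn pr rz rP W C x sx Ha.
have Ha1 : allowed g M C (r \o x).
  apply: allowed_eq (ag W C x sx Ha) => c i iM /=.
  by have [sp pf] := pr _ (sx c); apply: nth_prefix => //; rewrite sp.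
apply: (@allowed_zero Q q0 Bad g M n _ (fun t : {t : word | size t = m} => P (sval t))
  (fun t => r (sval t)) W C (fun c => exist _ (x c) (sx c)) Mn) => //.
- move=> W' C' x' Px Ha'.
  apply: (rP W' C' (fun c => sval (x' c))) => [c|]; first by split; [exact: (svalP (x' c))|].
  apply: allowed_eq Ha' => c i iM /=; have [sp pf] := pr _ (svalP (x' c)).
  by apply/esym/nth_prefix => //; rewrite sp.
- by move=> [t st] /= nP j /andP[Mj _]; apply: rz.
Qed.

Definition extl n k (c : (nat -> nat) -> (word -> word) -> 'I_k) :=
  forall h F h' F', agree n h F h' F' -> c h F = c h' F'.

Section One.
Variables (n k : nat) (c : (nat -> nat) -> (word -> word) -> 'I_k).
Hypothesis cext : extl n.+1 c.
Variables (h0 : nat -> nat) (F0 : word -> word) (m0 : morn n b g h0 F0).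

Let N := top n h0.
Let d := #|{: n.-tuple (letter Q)}|.
Let f (s : 'I_d) : word := premap q0 n F0 (enum_val s).
Let wt : n.-tuple (letter Q) := Tuple (introT eqP (size_wd b n)).
Let w : 'I_d := enum_rank wt.
Let u := b n n.
Let rk (t : word) : 'I_d :=
  if insub t is Some s then enum_rank (s : n.-tuple _) else w.
Let c1 m (psi : 'I_d -> word) := c (fun i => if i == n then m else h0 i)
  (fun t => if size t == n then psi (rk t) else F0 t).

Let rkK t : size t = n -> tval (enum_val (rk t) : n.-tuple _) = t.
Proof. by move=> st; rewrite /rk; case: insubP => [s _ <-|/eqP//]; rewrite enum_rankK. Qed.

Let size_f s : size (f s) = N.
Proof. by apply: (size_premap m0); rewrite size_tuple. Qed.

Let f_inj : injective f.
Proof.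
move=> s s' E; apply: enum_val_inj; apply: val_inj.
apply: (@eq_from_nth _ z0); rewrite !size_tuple // => i ni.
have H t : nth z0 (enum_val t : n.-tuple _) i = nth z0 (f t) (h0 i).
  by rewrite (premap_letter m0) // size_tuple.
by rewrite !H E.
Qed.

Let fwE : f w = premap q0 n F0 (wd b n).
Proof. by rewrite /f enum_rankK. Qed.

Let adm_f : allowed g N (pt u) (fun=> f w).
Proof.
rewrite fwE; apply: (premap_ages m0 (x := fun=> wd b n)) => [_|]; first exact: size_wd.
exact: valid_allowed.
Qed.

Let ag_inv W (C : W -> W -> Q) (x : W -> 'I_d) : allowed g N C (f \o x) ->
  allowed b n C (fun v => enum_val (x v) : n.-tuple _).
Proof.
move=> H; apply: (premap_ages_inv m0) => [v|]; first by rewrite size_tuple.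
exact: H.
Qed.

Section Build.
Variables (M1 : nat) (t1 : 'I_d -> word) (e1 : 'I_k).
Hypothesis NM : (N <= M1)%N.
Hypothesis t1P : forall s, size (t1 s) = M1 /\ prefix (f s) (t1 s).
Hypothesis t1a : forall W (C : W -> W -> Q) (x : W -> 'I_d),
  allowed g N C (f \o x) -> allowed g M1 C (t1 \o x).
Hypothesis stage : forall (J : finType) (la : J -> 'I_d) (Psi : J -> word) m (j0 : J),
    (M1 <= m)%N -> (forall j, size (Psi j) = m /\ prefix (t1 (la j)) (Psi j)) ->
    la j0 = w -> allowed g m (pt u) (fun=> Psi j0) ->
    exists n r, [/\ (m <= n)%N, forall j, size (r j) = n /\ prefix (Psi j) (r j),
      forall W (C : W -> W -> Q) (x : W -> J),
        allowed g m C (Psi \o x) -> allowed g n C (r \o x),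
      wd g n = r j0 /\ g n n = u &
      forall si : 'I_d -> J, (forall s, la (si s) = s) -> si w = j0 ->
        (forall W (C : W -> W -> Q) (x : W -> 'I_d), allowed g M1 C (t1 \o x) ->
           allowed g m C (Psi \o si \o x)) ->
        c1 n (r \o si) = e1].

Let Ex m M (r : word -> word) :=
  ((m < N)%N -> M = m /\ forall t, size t = m -> r t = t) /\
  ((N <= m)%N -> g m m = u -> take N (wd g m) = f w ->
   forall si : 'I_d -> word, (forall s, size (si s) = m /\ take N (si s) = f s) ->
   si w = wd g m ->
   (forall W (C : W -> W -> Q) x, allowed g N C (f \o x) -> allowed g m C (si \o x)) ->
   c1 M (r \o si) = e1).

Let I m M (p : word -> word) := forall t, size t = m ->
  if (m <= N)%N then M = m /\ p t = t else
  (M1 <= M)%N /\ forall s, take N t = f s -> prefix (t1 s) (p t).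

Let first m M p : (N <= m)%N -> I m M p -> (forall t, size t = m -> size (p t) = M) ->
  ages g g m M p -> exists M' p', [/\ (M <= M')%N /\ (M1 <= M')%N,
    forall t, size t = m -> size (p' t) = M' /\ prefix (p t) (p' t), ages g g m M' p' &
    forall t s, size t = m -> take N t = f s -> prefix (t1 s) (p' t)].
Proof.
rewrite leq_eqVlt => /orP[/eqP <- Ip sp ag|Nm Ip sp ag]; last first.
  have Im t : size t = m -> (M1 <= M)%N /\ forall s, take N t = f s -> prefix (t1 s) (p t).
    by move=> st; have := Ip t st; rewrite leqNgt Nm.
  exists M, p; split=> //.
  - by split=> //; have [] := Im (nseq m z0) (size_nseq _ _).
  - by move=> t st; rewrite sp // prefix_refl.
  - by move=> t s st; have [_] := Im t st; apply.
have Im t : size t = N -> M = N /\ p t = t by move=> /Ip; rewrite leqnn.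
have [EM _] := Im (nseq N z0) (size_nseq _ _); subst M.
pose p' t := if [pick s | f s == t] is Some s then t1 s else pad M1 t.
have p'f s : p' (f s) = t1 s.
  by rewrite /p'; case: pickP => [s' /eqP/f_inj->//|/(_ s)]; rewrite eqxx.
have p'n t : (forall s, f s <> t) -> p' t = pad M1 t.
  by move=> nf; rewrite /p'; case: pickP => // s /eqP /nf.
have p'P t : size t = N -> size (p' t) = M1 /\ prefix t (p' t).
  move=> st; have [[s <-]|nf] := pselect (exists s, f s = t); first by rewrite p'f.
  by rewrite p'n ?prefix_pad ?size_pad ?st // => s fs; apply: nf; exists s.
exists M1, p'; split=> //.
- by move=> t st; have [_ ->] := Im t st; apply: p'P.
- apply: (@ages_zero g N N M1 p p' (fun t => exists s, f s = t)) => //.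
  + by move=> t st; have [_ ->] := Im t st; rewrite st; have [] := p'P t st.
  + move=> t st nf j Nj; rewrite p'n ?nth_pad ?st // => s fs; apply: nf; by exists s.
  + move=> W C x sx; have /choice[y yP] : forall v, exists s, f s = x v by move=> v; have [] := sx v.
    move=> Ha; apply: allowed_eq (t1a (x := y) _).
      by move=> v i _ /=; rewrite -yP p'f.
    apply: allowed_eq Ha => v i iN /=; have [sxv _] := sx v.
    by have [_ ->] := Im _ sxv; rewrite yP.
- move=> t s st; rewrite -st take_size => ->; rewrite p'f; exact: prefix_refl.
Qed.

Lemma one_build : exists h F, mor g g h F /\ forall m, Ex m (h m) F.
Proof.
apply: (@mor_build Q q0 Bad g g I Ex).
- move=> m M r r' rr [E1 E2]; split=> [mN|Nm gu tw si sP sw sa].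
    by have [-> H] := E1 mN; split=> // t st; rewrite -rr // H.
  rewrite -(E2 Nm gu tw si sP sw sa); congr c1; apply/funext => s /=.
  by rewrite rr //; have [] := sP s.
- by move=> t /size0nil ->; rewrite leq0n.
move=> m M p Ip sp ag; case: (ltnP m N) => [mN|Nm].
  have Im t : size t = m -> M = m /\ p t = t by move=> /Ip; rewrite ltnW.
  have [EM _] := Im (nseq m z0) (size_nseq _ _); subst M.
  exists m, id; split.
  - split=> //; first by move=> t st; have [_ ->] := Im t st; rewrite prefix_refl.
  - by split=> //; rewrite leqNgt mN.
  - move=> t st; rewrite mN; split=> //.
    by rewrite /nextp -take_nth ?st // -st take_size.
have [M' [p' [[MM' M1M'] p'P ag' p't]]] := first Nm Ip sp ag.
suff [n' [r [Mn rP ra rw rEx]]] : exists n' r, [/\ (M' <= n')%N,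
    forall t, size t = m -> size (r t) = n' /\ prefix (p' t) (r t), ages g g m n' r,
    wd g n' = r (wd g m) /\ g n' n' = g m m & Ex m n' r].
  exists n', r; split=> //.
    split=> //; first exact: leq_trans Mn.
    move=> t st; have [sr pr] := rP t st; have [_ pp] := p'P t st.
    by split=> //; apply: prefix_trans pr.
  move=> t st; rewrite leqNgt ltnS Nm /=; split.
    by apply: leq_trans M1M' _; apply: leq_trans Mn _.
  move=> s ts; have stm : size (take m t) = m by rewrite size_take st ltnSn.
  have := p't (take m t) s stm; rewrite take_takel // => /(_ ts) H.
  apply: prefix_trans H _; have [_ pr] := rP _ stm.
  by apply: prefix_trans pr _; apply: prefix_rcons.
have [[gu tw]|nst] := pselect (g m m = u /\ take N (wd g m) = f w); last first.
  have vg : valid q0 Bad g by case: gen.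
  have sw' : size (wd g m) = m by rewrite size_wd.
  have [sp' _] := p'P _ sw'.
  have Ha : allowed g M' (pt (g m m)) (fun=> p' (wd g m)).
    by apply: (ag' _ _ (fun=> wd g m)) => //; apply: valid_allowed.
  have [_ /(_ _ _ _ 0 sp' Ha)[n' [_ Mn ew ev]]] := gen.
  exists n', (fun t => pad n' (p' t)); split=> //.
  - by move=> t st; have [st' _] := p'P _ st; rewrite size_pad ?st' ?prefix_pad.
  - move=> W C x sx Hx; apply: (allowed_pad (m := M')) => //.
      by move=> v j /andP[Mj _] /=; rewrite nth_pad //; have [-> _] := p'P _ (sx v).
    apply: allowed_eq (ag' W C x sx Hx) => v i iM /=.
    by apply: nth_prefix (prefix_pad _ _) _; have [-> _] := p'P _ (sx v).
  - by rewrite ew /pad sp'.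
  - by split=> [|_ gu tw]; [rewrite ltnNge Nm|case: nst].
pose inJ (t : m.-tuple (letter Q)) := [exists s, take N t == f s].
pose J : finType := {t | inJ t}.
pose la (j : J) : 'I_d := xchoose (existsP (svalP j)).
have laP (j : J) : take N (tval (sval j)) = f (la j) by apply/eqP; apply: (xchooseP (existsP (svalP j))).
have wJ : inJ (Tuple (introT eqP (size_wd g m))) by apply/existsP; exists w; apply/eqP.
pose j0 : J := exist (fun t => inJ t) _ wJ.
have sJ (j : J) : size (tval (sval j)) = m by rewrite size_tuple.
have Psi1 (j : J) : size (p' (tval (sval j))) = M' /\ prefix (t1 (la j)) (p' (tval (sval j))).
  by have [-> _] := p'P _ (sJ j); split=> //; apply: p't.
have la0 : la j0 = w by apply: f_inj; rewrite -laP.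
have Ha0 : allowed g M' (pt u) (fun=> p' (tval (sval j0))).
  rewrite -gu; apply: (ag' _ _ (fun=> wd g m)) => //; first by move=> _; rewrite size_wd.
  by apply: valid_allowed; case: gen.
have [n' [r [Mn rP ra [rw ru] rc]]] := stage M1M' Psi1 la0 Ha0.
pose toJ (t : word) : option J := obind insub (insub t : option (m.-tuple _)).
have toJP t j : toJ t = Some j -> tval (sval j) = t.
  rewrite /toJ; case: insubP => //= t' _ <-; case: insubP => //= j' _ <- [<-] //.
have toJn t s : size t = m -> take N t = f s -> exists2 j, toJ t = Some j & la j = s.
  move=> st ts; rewrite /toJ insubT; first by apply/eqP.
  move=> st' /=; have H : inJ (Sub t st') by apply/existsP; exists s; apply/eqP.
  rewrite (insubT inJ H); exists (Sub (Sub t st') H) => //.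
  by apply: f_inj; rewrite -laP.
pose r' t := if toJ t is Some j then r j else pad n' (p' t).
exists n', r'; split=> //.
- move=> t st; rewrite /r'; case E: (toJ t) => [j|].
    by rewrite -(toJP _ _ E).
  by have [st' _] := p'P _ st; rewrite size_pad ?st' ?prefix_pad.
- apply: (@ages_zero g m M' n' p' r' (fun t => toJ t <> None)) => //.
  + move=> t st; have [st' _] := p'P _ st; split=> //; rewrite /r'; case E: (toJ t) => [j|].
      by have [_] := rP j; rewrite (toJP _ _ E).
    exact: prefix_pad.
  + move=> t st /contrapT nJ j Mj; rewrite /r' nJ nth_pad //; have [-> _] := p'P _ st; exact: Mj.
  + move=> W C x sx Hx; have /choice[y yP] : forall v, exists j, toJ (x v) = Some j.
      by move=> v; have [_] := sx v; case: (toJ _) => // j; exists j.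
    apply: allowed_eq (ra W C y _) => [v i _ /=|]; first by rewrite /r' yP.
    by apply: allowed_eq Hx => v i _ /=; rewrite (toJP _ _ (yP v)).
- have [j Ej _] := toJn _ _ (size_wd g m) tw; rewrite /r' Ej ru gu rw; split=> //.
  by congr r; apply: val_inj; apply: val_inj; exact: esym (toJP _ _ Ej).
split=> [|_ _ _ si sP sw sa]; first by rewrite ltnNge Nm.
have /choice[y yP] : forall s, exists j, toJ (si s) = Some j /\ la j = s.
  by move=> s; have [ss ts] := sP s; have [j j1 j2] := toJn _ _ ss ts; exists j.
have <- : c1 n' (r \o y) = e1.
  apply: rc => [s||W C x Hx]; first by have [] := yP s.
    by apply: val_inj; apply: val_inj; have [E _] := yP w; exact: etrans (toJP _ _ E) sw.
  apply: allowed_eq (ag' W C (si \o x) _ _) => [v i _ /=|v|].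
  - by have [E _] := yP (x v); rewrite (toJP _ _ E).
  - by have [] := sP (x v).
  - apply: sa; apply: allowed_eq (allowed_le NM Hx) => v i iM /=.
    by apply/esym/nth_prefix; [have [] := t1P (x v)|rewrite size_f].
by congr c1; apply/funext => s /=; rewrite /r'; have [-> _] := yP s.
Qed.

End Build.

Lemma pigeonhole : exists h F e, [/\ mor g g h F, fixes N h F &
  forall h' F', morn n.+1 b g h' F' -> agree n h0 F0 h' F' ->
    c (h \o h') (F \o F') = e].
Proof.
have [M1 [t1 [e [NM t1P t1a stage]]]] := halpern_lauchli gen c1 size_f adm_f.
have [h [F [mF ExF]]] := one_build NM t1P t1a stage.
exists h, F, e; have fN : fixes N h F.
  split=> [i iN|t tN]; first by have [/(_ iN)[]] := ExF i.
  by have [/(_ tN)[_ H] _] := ExF (size t); apply: H.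
split=> // h' F' m' ag; have [ah aF] := ag.
have sF t : size t = n -> size (F' t) = h' n.
  by move=> st; rewrite (morn_size m') ?st.
have pF t : size t = n -> prefix (premap q0 n F0 t) (F' t).
  exact: (premap_ext m' ag).
have tF t : size t = n -> take N (F' t) = premap q0 n F0 t.
  by move=> st; rewrite -(prefix_take (pF t st)) (size_premap m0).
have Nh : (N <= h' n)%N.
  have sn : size (nseq n z0) = n by rewrite size_nseq.
  by have /size_prefix := pF _ sn; rewrite (size_premap m0) // sF.
have [_ _ /(_ n (ltnSn n))[ew ev] a'] := m'.
have [_ /(_ Nh)] := ExF (h' n); rewrite ev ew => /(_ erefl) H.
rewrite -(H _ (fun s => F' (enum_val s : n.-tuple _))).
- apply: cext; split=> [i|t]; rewrite ltnS leq_eqVlt.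
    case: eqP => [->//|_ /= ni]; rewrite ah //= (fN.1) // -ah //.
    exact: (lt_top m0).
  case: eqP => [st _|_ /= tn] /=; first by rewrite rkK.
  rewrite -aF // fN.2 // (morn_size m0) //; exact: (lt_top m0).
- by rewrite fwE tF // size_wd.
- by move=> s; rewrite sF ?tF ?size_tuple.
- by rewrite enum_rankK.
- move=> W C x Hx; apply: (a' n W C (fun v => enum_val (x v) : n.-tuple _)) => //.
    by move=> v; rewrite size_tuple.
  exact: ag_inv.
Qed.

End One.
End Pigeonhole.

Section Fusion.
Variables (Q : finType) (q0 : Q) (Bad : forall V : Type, (V -> V -> Q) -> Prop).
Notation word := (seq (letter Q)).
Notation z0 := (a0 q0).
Notation morn := (morn q0 Bad).
Notation mor := (mor q0 Bad).
Notation allowed := (allowed q0 Bad).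
Notation ages := (ages q0 Bad).
Variables (g : nat -> nat -> Q) (gen : generic q0 Bad g).
Variables (b : nat -> nat -> Q) (vb : valid q0 Bad b).

Lemma agree_sym n h (F : word -> word) h' F' : agree n h F h' F' -> agree n h' F' h F.
Proof. by case=> a1 a2; split=> [i /a1|t /a2] ->. Qed.

Lemma agree_trans n h (F : word -> word) h1 F1 h2 F2 :
  agree n h F h1 F1 -> agree n h1 F1 h2 F2 -> agree n h F h2 F2.
Proof.
case=> a1 a2 [b1 b2]; split=> [i ni|t nt]; first by rewrite a1 // b1.
by rewrite a2 // b2.
Qed.

Lemma agree_le n n' h (F : word -> word) h' F' : (n <= n')%N ->
  agree n' h F h' F' -> agree n h F h' F'.
Proof. by move=> nn [a1 a2]; split=> [i|t] ni; [apply: a1|apply: a2]; apply: leq_trans nn. Qed.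

Lemma agree_compl n h (F : word -> word) h1 F1 h2 F2 : agree n h1 F1 h2 F2 ->
  agree n (h \o h1) (F \o F1) (h \o h2) (F \o F2).
Proof. by case=> a1 a2; split=> [i ni|t nt] /=; rewrite ?a1 ?a2. Qed.

Lemma fixes_comp n N h F h0 F0 : morn n b g h0 F0 -> (top n h0 <= N)%N ->
  fixes N h F -> agree n h0 F0 (h \o h0) (F \o F0).
Proof.
move=> m0 tN [f1 f2]; split=> [i ni|t nt] /=.
  by rewrite f1 //; apply: leq_trans tN; apply: (lt_top m0).
by rewrite f2 //; apply: leq_trans tN; rewrite (morn_size m0) //; apply: (lt_top m0).
Qed.

Lemma morn_agree n c h F h' F' : agree n h F h' F' -> morn n c g h F -> morn n c g h' F'.
Proof.
move=> [ah aF] [s p v a]; split=> [t nt|t c' nt|i ni|i W C x ni sx Ha].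
- by rewrite -aF // s // ah.
- by rewrite -!aF ?size_rcons //; [apply: p|apply: ltnW].
- by rewrite -ah // -aF ?size_wd //; apply: v.
- rewrite -ah //; apply: allowed_eq (a i W C x ni sx Ha) => v' j _ /=.
  by rewrite aF ?sx.
Qed.

Definition homog n k (c : (nat -> nat) -> (word -> word) -> 'I_k) h F h0 F0 :=
  forall h1 F1 h2 F2, morn n.+1 b g h1 F1 -> agree n h0 F0 h1 F1 ->
    morn n.+1 b g h2 F2 -> agree n h0 F0 h2 F2 ->
    c (h \o h1) (F \o F1) = c (h \o h2) (F \o F2).

Lemma extl_comp n k (c : (nat -> nat) -> (word -> word) -> 'I_k) h F :
  extl n c -> extl n (fun h' F' => c (h \o h') (F \o F')).
Proof. by move=> ce h1 F1 h2 F2 ag; apply: ce; apply: agree_compl. Qed.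

Lemma level_homog n k (c : (nat -> nat) -> (word -> word) -> 'I_k) N : extl n.+1 c ->
  exists h F, [/\ mor g g h F, fixes N h F &
    forall h0 F0, morn n b g h0 F0 -> top n h0 = N -> homog n c h F h0 F0].
Proof.
move=> cext.
pose T : finType := ({ffun 'I_n -> 'I_N.+1} * {ffun n.-bseq (letter Q) -> N.-bseq (letter Q)})%type.
pose code (h : nat -> nat) (F : word -> word) : T :=
  ([ffun i : 'I_n => inord (h i)], [ffun t : n.-bseq _ => insub_bseq N (F t)]).
have codeP h F h' F' : morn n b g h F -> top n h = N -> morn n b g h' F' -> top n h' = N ->
    code h F = code h' F' -> agree n h F h' F'.
  move=> m tN m' tN' [/ffunP E1 /ffunP E2]; split=> [i ni|t nt].
    have b1 : (h i < N.+1)%N by rewrite ltnS ltnW // -tN; apply: (lt_top m).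
    have b2 : (h' i < N.+1)%N by rewrite ltnS ltnW // -tN'; apply: (lt_top m').
    by have := congr1 (@nat_of_ord _) (E1 (Ordinal ni)); rewrite !ffunE /= !inordK.
  have := E2 (insub_bseq n t); rewrite !ffunE.
  have -> : insub_bseq n t = t :> word by rewrite insubdK // unfold_in ltnW.
  move/(congr1 (@bseqval _ _)); rewrite !insubdK //.
    by rewrite unfold_in (morn_size m') // ltnW // -tN'; apply: (lt_top m').
  by rewrite unfold_in (morn_size m) // ltnW // -tN; apply: (lt_top m).
suff H (l : seq T) : exists h F, [/\ mor g g h F, fixes N h F &
    forall h0 F0, morn n b g h0 F0 -> top n h0 = N -> code h0 F0 \in l -> homog n c h F h0 F0].
  have [h [F [m f H1]]] := H (enum T); exists h, F; split=> // h0 F0 m0 t0.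
  by apply: H1 => //; rewrite mem_enum.
elim: l => [|a l [h [F [m f Hl]]]].
  by exists id, id; split=> //; apply: mor_id.
have [[h0 [F0 [m0 t0 c0]]]|no] := pselect (exists h0 F0,
    [/\ morn n b g h0 F0, top n h0 = N & code h0 F0 = a]); last first.
  exists h, F; split=> // h1 F1 m1 t1; rewrite inE => /orP[/eqP c1|]; last exact: Hl.
  by case: no; exists h1, F1.
have [h1 [F1 [e [m1 f1 H1]]]] := pigeonhole gen vb (extl_comp h F cext) m0.
rewrite t0 in f1.
exists (h \o h1), (F \o F1); split; first exact: mor_comp m1 m.
  split=> [i iN|t tN] /=; first by rewrite f1.1 // f.1.
  by rewrite f1.2 // f.2.
move=> h2 F2 m2 t2 l2 h3 F3 h4 F4 m3 a3 m4 a4.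
case: (eqVneq (code h2 F2) a) => [E|ne].
  have a02 : agree n h0 F0 h2 F2 by apply: codeP => //; rewrite c0.
  have H3 := H1 h3 F3 m3 (agree_trans a02 a3); have H4 := H1 h4 F4 m4 (agree_trans a02 a4).
  exact: etrans H3 (esym H4).
have l2' : code h2 F2 \in l by move: l2; rewrite inE (negPf ne).
have tr h5 F5 : morn n.+1 b g h5 F5 -> agree n h2 F2 h5 F5 ->
    agree n h2 F2 (h1 \o h5) (F1 \o F5).
  move=> m5 a5; apply: agree_trans (fixes_comp m2 _ f1) _; first by rewrite t2.
  exact: agree_compl.
apply: (Hl h2 F2 m2 t2 l2' (h1 \o h3) (F1 \o F3) (h1 \o h4) (F1 \o F4)).
- exact: morn_comp m3 m1.
- exact: tr.
- exact: morn_comp m4 m1.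
- exact: tr.
Qed.

Let mp := ((nat -> nat) * (word -> word))%type.
Let pc (x y : mp) : mp := (x.1 \o y.1, x.2 \o y.2).

Lemma step_homog n k (c : (nat -> nat) -> (word -> word) -> 'I_k) : extl n.+1 c ->
  exists h F, mor g g h F /\ forall h0 F0, morn n b g h0 F0 -> homog n c h F h0 F0.
Proof.
move=> cext.
have /choice[nx nxP] : forall y : nat * mp, exists x : mp,
    [/\ mor g g x.1 x.2, fixes y.1 x.1 x.2 & forall h0 F0, morn n b g h0 F0 ->
      top n h0 = y.1 -> homog n (fun h F => c (y.2.1 \o h) (y.2.2 \o F)) x.1 x.2 h0 F0].
  move=> [N [h F]]; have [h' [F' H]] := level_homog N (extl_comp h F cext).
  by exists (h', F').
pose G := fix G N : mp := if N is k.+1 then pc (G k) (nx (k, G k)) else (id, id).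
pose P N := nx (N, G N).
pose R a := fix R k : mp := if k is k'.+1 then pc (R k') (P (a + k')) else (id, id).
have Pm N : mor g g (P N).1 (P N).2 by have [] := nxP (N, G N).
have Pf N : fixes N (P N).1 (P N).2 by have [] := nxP (N, G N).
have Rm a j : mor g g (R a j).1 (R a j).2.
  by elim: j => [|j IH]; [apply: mor_id|apply: mor_comp IH; apply: Pm].
have Rf a j : fixes a (R a j).1 (R a j).2.
  elim: j => [|j [IH1 IH2]]; first by [].
  have [P1 P2] := agree_le (leq_addr j a) (Pf (a + j)).
  by split=> [i ia|t ta] /=; [rewrite P1 // IH1|rewrite P2 // IH2].
have GR a j : G (a + j) = pc (G a) (R a j).
  elim: j => [|j IH]; first by rewrite addn0 /=; case: (G a).
  by rewrite addnS /= -/(P (a + j)) IH.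
have stab a j j' : (j <= j')%N ->
    agree (a + j) (R a j).1 (R a j).2 (R a j').1 (R a j').2.
  move=> /subnK <-; elim: (j' - j)%N => [|i IH] //=.
  apply: agree_trans IH _; have [P1 P2] := agree_le (n := a + j) (n' := a + (i + j)) (ltac:(lia)) (Pf _).
  by split=> [x ia|t ta] /=; [rewrite P1|rewrite P2].
pose lim a : mp := (fun i => (R a i.+1).1 i, fun t => (R a (size t).+1).2 t).
have limR a j : agree j (lim a).1 (lim a).2 (R a j).1 (R a j).2.
  split=> [i ij|t tj] /=.
    by have [H _] := stab a i.+1 j ij; apply: H; lia.
  by have [_ H] := stab a (size t).+1 j tj; apply: H; lia.
have limm a : mor g g (lim a).1 (lim a).2.
  by move=> j; apply: morn_agree (agree_sym (limR a j)) _; apply: Rm.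
have limf a : fixes a (lim a).1 (lim a).2.
  split=> [i ia|t ta] /=; first by have [H _] := Rf a i.+1; apply: H.
  by have [_ H] := Rf a (size t).+1; apply: H.
have GR0 j : G j = R 0 j by rewrite -[in LHS](add0n j) GR; case: (R 0 j).
have lim0 a : lim 0 = pc (G a) (lim a).
  have L1 i : (R 0 i.+1).1 i = (G a).1 ((R a i.+1).1 i).
    have [H _] := stab 0 i.+1 (a + i.+1) (leq_addl _ _).
    by rewrite (H i (ltnSn i)) -(GR0 (a + i.+1)) GR.
  have L2 t : (R 0 (size t).+1).2 t = (G a).2 ((R a (size t).+1).2 t).
    have [_ H] := stab 0 (size t).+1 (a + (size t).+1) (leq_addl _ _).
    by rewrite (H t (ltnSn _)) -(GR0 (a + (size t).+1)) GR.
  by congr pair; apply/funext => x; [exact: L1|exact: L2].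
exists (lim 0).1, (lim 0).2; split=> // h0 F0 m0 h1 F1 h2 F2 m1 a1 m2 a2.
pose N := top n h0.
rewrite (lim0 N.+1) /=; have [_ _ H] := nxP (N, G N).
have tr h5 F5 : morn n.+1 b g h5 F5 -> agree n h0 F0 h5 F5 ->
    agree n h0 F0 ((lim N.+1).1 \o h5) ((lim N.+1).2 \o F5).
  move=> m5 a5; apply: agree_trans (fixes_comp m0 _ (limf N.+1)) _; first exact: leqnSn.
  exact: agree_compl.
apply: (H h0 F0 m0 erefl ((lim N.+1).1 \o h1) ((lim N.+1).2 \o F1)
  ((lim N.+1).1 \o h2) ((lim N.+1).2 \o F2)).
- exact: morn_comp m1 (limm N.+1).
- exact: tr.
- exact: morn_comp m2 (limm N.+1).
- exact: tr.
Qed.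

Theorem morphism_ramsey n k (c : (nat -> nat) -> (word -> word) -> 'I_k) : extl n c ->
  exists h F, mor g g h F /\ forall h1 F1 h2 F2, morn n b g h1 F1 -> morn n b g h2 F2 ->
    c (h \o h1) (F \o F1) = c (h \o h2) (F \o F2).
Proof.
elim: n c => [|n IH] c cext.
  by exists id, id; split=> [|h1 F1 h2 F2 _ _]; [apply: mor_id|apply: cext].
have [h [F [m H]]] := step_homog cext.
pose E (h' : nat -> nat) (F' : word -> word) : set mp :=
  [set x | morn n.+1 b g x.1 x.2 /\ agree n h' F' x.1 x.2].
pose c' h' F' := let x := xget ((id, id) : mp) (E h' F') in c (h \o x.1) (F \o x.2).
have c'ext : extl n c'.
  move=> h1 F1 h2 F2 a12; rewrite /c'; have -> // : E h1 F1 = E h2 F2.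
  apply/seteqP; split=> x [mx ax]; split=> //; first exact: agree_trans (agree_sym a12) ax.
  exact: agree_trans ax.
have [h' [F' [m' H']]] := IH c' c'ext.
have key h1 F1 : morn n.+1 b g h1 F1 ->
    c' (h' \o h1) (F' \o F1) = c (h \o (h' \o h1)) (F \o (F' \o F1)).
  move=> m1; have m2 : morn n.+1 b g (h' \o h1) (F' \o F1) by apply: morn_comp m1 m'.
  rewrite /c'; case: xgetP => [x _ [mx ax]|/(_ (h' \o h1, F' \o F1))[]]; last by [].
  by apply: (H (h' \o h1) (F' \o F1)) => //; apply: morn_le m2.
exists (h \o h'), (F \o F'); split=> [|h1 F1 h2 F2 m1 m2]; first exact: mor_comp m' m.
have := H' h1 F1 h2 F2 (morn_le (leqnSn n) m1) (morn_le (leqnSn n) m2).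
by rewrite !key.
Qed.

Lemma mor_exists : exists h F, mor b g h F.
Proof.
suff [h [F [m _]]] : exists h F, mor b g h F /\ forall m : nat, True by exists h, F.
apply: (@mor_build Q q0 Bad b g (fun _ _ _ => True) (fun _ _ _ => True)) => // m M p _ sp ag.
have sw : size (p (wd b m)) = M by rewrite sp ?size_wd.
have Ha : allowed g M (pt (b m m)) (fun=> p (wd b m)).
  by apply: (ag _ _ (fun=> wd b m)) => [_|]; rewrite ?size_wd //; apply: valid_allowed.
have [vg /(_ _ _ _ 0 sw Ha)[n' [_ Mn ew ev]]] := gen.
exists n', (fun t => pad q0 n' (p t)); split=> //; split=> //.
- by move=> t st; rewrite size_pad ?sp ?prefix_pad.
- move=> W C x sx Hx; apply: (allowed_pad (m := M)) => //.
    by move=> v j /andP[Mj _] /=; rewrite nth_pad // sp.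
  apply: allowed_eq (ag W C x sx Hx) => v i iM /=.
  by apply: nth_prefix (prefix_pad _ _ _) _; rewrite sp.
- by rewrite ew /pad sw.
Qed.

End Fusion.

(** * Encoding of K in a generic sequence *)

Section Binary.
Variables (L : language) (nL : nat) (idx : L -> 'I_nL).
Hypothesis idx_inj : injective idx.
Hypothesis ar2 : forall s : L, (arity s <= 2)%N.

Definition brel : finType := {ffun 'I_nL -> bool}.
Definition bz : brel := [ffun=> false].

Definition mk V (e : V -> V -> brel) : interp L V := fun s =>
  [set t | match tval t with
    | [:: x] => e x x (idx s) : Prop
    | [:: x; y] => e x y (idx s) : Prop
    | _ => False end].

Definition eof V (I : interp L V) (x y : V) : brel :=
  [ffun i => `[< exists s, idx s = i /\ exists t : (arity s).-tuple V,
     I s t /\ (tval t = [:: x] /\ x = y \/ tval t = [:: x; y]) >]].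

Lemma mk_eof V (I : interp L V) : mk (eof I) = I.
Proof.
apply: functional_extensionality_dep => s; rewrite predeqE => t; rewrite /mk /=.
have P x y : (arity s == 1 -> x = y) -> (tval t = [:: x] \/ tval t = [:: x; y]) ->
    eof I x y (idx s) <-> I s t.
  move=> xy tE; rewrite /eof ffunE; split.
    move=> /asboolP[s' [/idx_inj ss [t' [It tt]]]]; subst s'.
    have st := size_tuple t; have st' := size_tuple t'.
    have -> // : t = t'.
    apply: val_inj => /=; case: tE tt => [E|E] [[E' E'']|E']; rewrite E E' //.
    - by move: st; rewrite E -st' E'.
    - by move: st; rewrite E -st' E'.
  move=> It; apply/asboolP; exists s; split=> //; exists t; split=> //.
  case: tE => E; [left; split=> //|by right].
  by apply: xy; rewrite -(size_tuple t) E.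
have st := size_tuple t; have := ar2 s; have := arity_gt0 s.
case E: (tval t) => [|x [|y [|z r]]] //=; rewrite -{1 2}st E //= => _ _.
- by apply: P => //; left.
- by apply: P => //; [rewrite -st E|right].
Qed.

Lemma mk_pullback U V (f : U -> V) e : mk (fun x y => e (f x) (f y)) = pullback f (mk e).
Proof.
apply: functional_extensionality_dep => s; rewrite predeqE => -[t st].
by rewrite /mk /pullback /=; case: t st => [|x [|y [|z r]]].
Qed.

Lemma irreducible_mk (B : structure L) (e : B -> B -> brel) :
  irreducible B -> @rel_of L B = mk e -> forall x y, x <> y -> e x y <> bz \/ e y x <> bz.
Proof.
move=> irB E x y xy; have [s [t [i [j []]]]] := irB x y xy.
rewrite E /mk /=; have st := size_tuple t.
rewrite !(tnth_nth x).
have : (i < size t)%N by rewrite st. have : (j < size t)%N by rewrite st.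
case: (tval t) => [|a [|b [|c r]]] //=.
  case: (nat_of_ord i) => [|//]; case: (nat_of_ord j) => [|//] /= _ _ _ ax ay.
  by case: xy; rewrite -ax -ay.
case: (nat_of_ord i) => [|[|//]]; case: (nat_of_ord j) => [|[|//]] //= _ _ H ax ay; subst.
- by [].
- by left => Z; move: H; rewrite Z ffunE.
- by right => Z; move: H; rewrite Z ffunE.
- by [].
Qed.

End Binary.

Section Enriched.
Variables (L : language) (nL : nat) (idx : L -> 'I_nL).
Hypothesis idx_inj : injective idx.
Hypothesis ar2 : forall s : L, (arity s <= 2)%N.
Variables (F : set (structure L)) (K : structure L) (M0 : nat).
Notation M := M0.+1.
Hypothesis F_enum : forall B, F B ->
  exists s : seq {classic B}, [/\ uniq s, forall b, b \in s & (size s <= M)%N].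
Hypothesis F_irr : forall B, F B -> irreducible B.
Hypothesis F_K : forall B, F B -> ~ embeds B K.
Hypothesis F_inh : forall B, F B -> inhabited B.

Notation Q0 := (brel nL).
Notation z := (bz nL).
Notation mk := (mk idx).

Definition olabel : finType := {ffun 'I_M -> Q0 * Q0}.
Definition label : finType := ('I_M.+1 * {ffun 'I_M * 'I_M -> Q0} * olabel)%type.

(* The diagonal of a relation on [V] with values in [enr] tells the vertices
   of the L-structure, of diagonal [inl _], from the auxiliary points, of
   diagonal [inr None].  An auxiliary point [d] stands for [j] vertices which
   carry the structure [m]; the label [(j, m, o)] from [d] to a vertex [c] says
   that [c] has the type [o] over these vertices. *)
Definition enr : finType := (Q0 + option label)%type.
Definition enr0 : enr := inl z.
Definition star : enr := inr None.

Definition proj (q : enr) : Q0 := if q is inl r then r else z.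

Definition comb W (m : {ffun 'I_M * 'I_M -> Q0}) (o : W -> olabel)
    (C : W -> W -> Q0) (u v : 'I_M + W) : Q0 :=
  match u, v with
  | inl i, inl j => m (i, j)
  | inl i, inr c => (o c i).1
  | inr c, inl i => (o c i).2
  | inr c, inr d => C c d
  end.

Definition bad V (e : V -> V -> enr) : Prop :=
  ((forall x, exists q, e x x = inl q) /\ exists B, F B /\ exists f : B -> V,
     injective f /\ @rel_of L B = mk (fun x y => proj (e (f x) (f y)))) \/
  (exists d, e d d = star /\ exists (j : 'I_M.+1) m (o : V -> olabel),
     (forall c, c <> d -> e d c = inr (Some (j, m, o c))) /\
     exists B, F B /\ exists f : B -> 'I_M + V,
     [/\ injective f, forall b i, f b = inl i -> (i < j)%N,
         forall b c, f b = inr c -> c <> d, exists b c, f b = inr c &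
         @rel_of L B = mk (fun x y =>
           comb m o (fun c c' => proj (e c c')) (f x) (f y))]).

Lemma bad_star V (e : V -> V -> enr) :
  (forall x y : V, x = y) -> (forall x, e x x = star) -> ~ bad e.
Proof.
move=> sub st; case=> G; last first.
  case: G => d [_]; case=> j; case=> m; case=> o [_]; case=> B [_].
  case=> f [_ _ nd [b [c fb]] _].
  by case: (nd b c fb); apply: sub.
case: G => al [B [FB [f _]]].
have [b] := F_inh FB; by have [q] := al (f b); rewrite st.
Qed.

Definition eK (u v : K) : Q0 := eof idx (@rel_of L K) u v.

Lemma noK (B : structure L) (psi : B -> K) : F B -> injective psi ->
  @rel_of L B = mk (fun x y => eK (psi x) (psi y)) -> False.
Proof.
move=> FB inj E; apply: (F_K FB); constructor; apply: (@Emb L B K psi); split=> //.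
by rewrite E mk_pullback mk_eof.
Qed.

Variables (pos : K -> nat) (Sg : nat -> seq {classic K}).
Hypothesis pos_inj : injective pos.
Hypothesis Sg_ex : forall (s : seq {classic K}) v, (size s <= M)%N ->
  (forall u, u \in s -> (pos u <= pos v)%N) ->
  exists n, [/\ (n < pos v)%N, forall u, pos u <> n & Sg n = s].

Definition vat n : option K :=
  if pselect (exists u, pos u = n) is left H then Some (sval (cid H)) else None.

Lemma vat_pos u : vat (pos u) = Some u.
Proof.
rewrite /vat; case: pselect => [H|[]]; last by exists u.
by congr Some; apply: pos_inj; case: cid.
Qed.

Lemma vatS n u : vat n = Some u -> pos u = n.
Proof. by rewrite /vat; case: pselect => // H [<-]; case: cid. Qed.

Lemma vatN n : (forall u, pos u <> n) -> vat n = None.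
Proof. by move=> H; case E: (vat n) => [u|//]; case: (H u); apply: vatS. Qed.

Definition olab (s : seq {classic K}) (x : K) : olabel :=
  [ffun i : 'I_M => (eK (nth (x : {classic K}) s i) x, eK x (nth (x : {classic K}) s i))].
Definition mlab (s : seq {classic K}) (x : K) : {ffun 'I_M * 'I_M -> Q0} :=
  [ffun p : 'I_M * 'I_M => if ((p.1 < size s) && (p.2 < size s))%N
    then eK (nth (x : {classic K}) s p.1) (nth (x : {classic K}) s p.2) else z].

Lemma mlab_eq s x y : mlab s x = mlab s y.
Proof.
apply/ffunP => p; rewrite !ffunE; case: ifP => // /andP[p1 p2].
by rewrite !(set_nth_default (y : {classic K}) (x : {classic K})).
Qed.

Definition labelled n x := [/\ uniq (Sg n), (size (Sg n) <= M)%N,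
  forall u, u \in Sg n -> (pos u < pos x)%N & (n < pos x)%N].

Definition lab n (x : K) : enr :=
  if pselect (labelled n x) then inr (Some (inord (size (Sg n)), mlab (Sg n) x, olab (Sg n) x))
  else enr0.

Lemma labP n x l : lab n x = inr l ->
  labelled n x /\ l = Some (inord (size (Sg n)), mlab (Sg n) x, olab (Sg n) x).
Proof. by rewrite /lab; case: pselect => //= H [<-]. Qed.

Definition deco i j : enr :=
  match vat i, vat j with
  | Some u, Some v => inl (eK u v)
  | None, Some x => lab i x
  | Some _, None => enr0
  | None, None => if i == j then star else enr0
  end.

Lemma decoLL u v : deco (pos u) (pos v) = inl (eK u v).
Proof. by rewrite /deco !vat_pos. Qed.

Lemma deco_star i : deco i i = star -> vat i = None.
Proof. by rewrite /deco; case: vat. Qed.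

Lemma deco_inl i q : deco i i = inl q -> exists u, vat i = Some u.
Proof. by rewrite /deco; case E: (vat i) => [u|]; [exists u|rewrite eqxx]. Qed.

Lemma deco_label i j l : deco i j = inr (Some l) ->
  vat i = None /\ exists u, vat j = Some u /\ lab i u = inr (Some l).
Proof.
rewrite /deco; case: (vat i) => [u|]; case: (vat j) => [v|] //; last by case: eqP.
by move=> E; split=> //; exists v.
Qed.

Notation allowed := (allowed enr0 bad).

Section Types.
Variables (W : Type) (w : W -> K) (C : W -> W -> enr).

Definition vx (p : K + W) : K := match p with inl u => u | inr c => w c end.

Definition tot (p q : K + W) : Q0 :=
  match p, q with
  | inr c, inr d => proj (C c d)
  | _, _ => eK (vx p) (vx q)
  end.

Lemma totr u p : tot p (inl u) = eK (vx p) u. Proof. by case: p. Qed.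

Lemma decode V (e : V -> V -> enr) (d : V) n j m (o : V -> olabel)
    (B : structure L) (f : B -> 'I_M + V)
    (rho : V -> K + W) :
  F B -> (forall c, c <> d -> e d c = inr (Some (j, m, o c))) ->
  injective f -> (forall b i, f b = inl i -> (i < j)%N) ->
  (forall b c, f b = inr c -> c <> d) -> (exists b c, f b = inr c) ->
  @rel_of L B = mk (fun x y => comb m o (fun c c' => proj (e c c')) (f x) (f y)) ->
  (forall c, c <> d -> e d c = lab n (vx (rho c))) ->
  (forall c c', c <> d -> c' <> d -> rho c = rho c' -> c = c') ->
  (forall c c', c <> d -> c' <> d -> proj (e c c') = tot (rho c) (rho c')) ->
  exists psi : B -> K + W, [/\ injective psi,
    @rel_of L B = mk (fun x y => tot (psi x) (psi y)) &
    forall b u, psi b = inl u -> (exists2 c, c <> d & rho c = inl u) \/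
      forall c, c <> d -> (pos u < pos (vx (rho c)))%N].
Proof.
move=> FB ed fi fj fd [b0 [c0 fb0]] E elab rinj etot.
have d0 := fd _ _ fb0; pose s := Sg n.
have lb c : c <> d -> [/\ labelled n (vx (rho c)), (j = size s :> nat),
    m = mlab s (vx (rho c)) & o c = olab s (vx (rho c))].
  move=> cd; have := elab c cd; rewrite ed // => /esym/labP[lbl [-> -> ->]].
  by split=> //; rewrite inordK // ltnS; case: lbl.
have [[us sM _ _] js _ _] := lb c0 d0.
pose k0 := vx (rho c0).
exists (fun b => match f b with inl i => inl (nth (k0 : {classic K}) s i) | inr c => rho c end).
split.
- move=> b b'; case fb: (f b) => [i|c]; case fb': (f b') => [i'|c'].
  + have := fj _ _ fb; have := fj _ _ fb'; rewrite js => is' is1 [] H.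
    apply: fi; rewrite fb fb'; congr inl; apply: ord_inj; apply/eqP.
    by rewrite -(nth_uniq (k0 : {classic K}) is1 is' us); apply/eqP; exact: H.
  + have cd := fd _ _ fb'; have [[_ _ ps _] _ _ _] := lb _ cd.
    move=> H; have := ps (nth (k0 : {classic K}) s i); rewrite -H /=.
    by rewrite mem_nth ?ltnn -?js; [move=> /(_ isT)|apply: fj fb].
  + have cd := fd _ _ fb; have [[_ _ ps _] _ _ _] := lb _ cd.
    move=> H; have := ps (nth (k0 : {classic K}) s i'); rewrite H /=.
    by rewrite mem_nth ?ltnn -?js; [move=> /(_ isT)|apply: fj fb'].
  + move=> H; apply: fi; rewrite fb fb'; congr inr; apply: rinj => //.
    exact: fd fb. exact: fd fb'.
- rewrite E; congr mk; apply/funext => b; apply/funext => b'.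
  case fb: (f b) => [i|c]; case fb': (f b') => [i'|c'] /=.
  + have [_ _ -> _] := lb c0 d0; have := fj _ _ fb; have := fj _ _ fb'.
    by rewrite js ffunE /= => -> ->.
  + have [_ _ _ ->] := lb _ (fd _ _ fb'); have := fj _ _ fb; rewrite js => si.
    by rewrite ffunE /= (set_nth_default (k0 : {classic K})).
  + have [_ _ _ ->] := lb _ (fd _ _ fb); have := fj _ _ fb'; rewrite js => si.
    by rewrite ffunE totr /= (set_nth_default (k0 : {classic K})).
  + by rewrite etot //; [exact: fd fb|exact: fd fb'].
- move=> b u; case fb: (f b) => [i|c] => [[<-]|rc].
    right=> c cd; have [[_ _ ps _] _ _ _] := lb c cd.
    by apply: ps; rewrite mem_nth // -js; apply: fj fb.
  by left; exists c => //; apply: fd fb.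
Qed.

Section Kill.
Variables (v : K) (x : W -> seq (letter enr)).
Hypothesis wv : forall c, (pos v < pos (w c))%N.
Hypothesis xw : forall c i, (i <= pos v)%N ->
  nth (a0 enr0) (x c) i = (deco i (pos (w c)), deco (pos (w c)) i).

(* The auxiliary point attached to the vertices of [B] below the level of [v]
   comes before [v]. *)
Lemma killed (B : structure L) (psi : B -> K + W) : F B -> injective psi ->
  (forall b u, psi b = inl u -> (pos u <= pos v)%N) ->
  @rel_of L B = mk (fun b b' => tot (psi b) (psi b')) -> ~ allowed deco (pos v) C x.
Proof.
move=> FB pinj pv E al.
have [[b0 [c0 pb0]]|no] := pselect (exists b c, psi b = inr c); last first.
  have /choice[k kP] : forall b, exists u, psi b = inl u.
    by move=> b; case pb: (psi b) => [u|c]; [exists u|case: no; exists b, c].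
  apply: (@noK B k) => // [b b' kk|]; first by apply: pinj; rewrite !kP kk.
  by rewrite E; congr mk; apply/funext => b; apply/funext => b'; rewrite !kP.
have [sB [_ sBin sBM]] := F_enum FB.
pose s : seq {classic K} := undup (pmap (fun b : {classic B} =>
  if psi b is inl u then Some (u : {classic K}) else None) sB).
have sP b u : psi b = inl u -> (u : {classic K}) \in s.
  move=> pb; rewrite mem_undup mem_pmap; apply/mapP; exists (b : {classic B}) => //.
  by rewrite pb.
have sv u : u \in s -> (pos u <= pos v)%N.
  rewrite mem_undup mem_pmap => /mapP[b _]; case pb: (psi b) => [u'|//] [->].
  exact: pv pb.
have sM : (size s <= M)%N.
  apply: leq_trans (size_undup _) _; apply: leq_trans sBM.
  by rewrite size_pmap count_size.
have [n [nv nL' nS]] := Sg_ex sM sv.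
have vn : vat n = None by apply: vatN.
have lbl c : lab n (w c) = inr (Some (inord (size s), mlab s (w c), olab s (w c))).
  rewrite /lab; case: pselect => [lb|[]]; first by rewrite nS.
  rewrite /labelled nS; split=> //; first exact: undup_uniq.
    by move=> u /sv us; apply: leq_ltn_trans (wv c).
  exact: ltn_trans (wv c).
pose V := option {c : W | exists b, psi b = inr c}.
pose f0 (y : V) : nat + W := if y is Some c then inr (sval c) else inl n.
have e0 c : cmb enr0 deco C x (f0 None) (f0 (Some c)) =
    inr (Some (inord (size s), mlab s (w c0), olab s (w (sval c)))).
  rewrite /= xw; last exact: ltnW.
  by rewrite /= /deco vn vat_pos lbl (mlab_eq _ _ (w c0)).
have /choice[f fP] : forall b, exists y : 'I_M + V, match psi b with
    | inl u => y = inl (inord (index (u : {classic K}) s))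
    | inr c => exists H, y = inr (Some (exist _ c H)) end.
  move=> b; case pb: (psi b) => [u|c]; first by eexists.
  have H : exists b, psi b = inr c by exists b.
  by exists (inr (Some (exist _ c H))); exists H.
have ind b u : psi b = inl u -> (index (u : {classic K}) s < size s)%N.
  by move=> /sP; rewrite index_mem.
have indM b u : psi b = inl u -> (index (u : {classic K}) s < M)%N.
  by move=> /ind /leq_trans; apply.
apply: (al V f0).
- move=> [[c hc]|] [[c' hc']|] //= [] cc; subst c'.
  by rewrite (Prop_irrelevance hc hc').
- by case.
- have ir (c c' : {c : W | exists b, psi b = inr c}) : c <> c' ->
      C (sval c) (sval c') <> enr0 \/ C (sval c') (sval c) <> enr0.
    case: c c' => c [b pb] [c' [b' pb']] cc /=.
    have bb : b <> b'.
      move=> bb; apply: cc; have E0 : c = c' by move: pb'; rewrite -bb pb => -[].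
      by subst c'; congr exist; apply: Prop_irrelevance.
    have := irreducible_mk (F_irr FB) E bb; rewrite pb pb' /=.
    by case=> H; [left|right] => Z; apply: H; rewrite Z.
  move=> [c|] [c'|] //= cc; [|by right; have := e0 c => /= ->|by left; have := e0 c' => /= ->].
  by apply: ir => c_; apply: cc; rewrite c_.
- right; exists None; split; first by rewrite /= /deco vn eqxx.
  exists (inord (size s)), (mlab s (w c0)),
    (fun y => if y is Some c then olab s (w (sval c)) else olab s (w c0)).
  split; first by move=> [c|//] _; apply: e0.
  exists B; split=> //; exists f; split.
  + move=> b b' ff; apply: pinj; have := fP b; have := fP b'; rewrite ff.
    case pb: (psi b) => [u|c]; case pb': (psi b') => [u'|c'].
    * move=> -> [] /(congr1 (@nat_of_ord _)).
      rewrite !inordK ?(indM _ _ pb) ?(indM _ _ pb') // => ii; congr inl.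
      by rewrite -(nth_index (u : {classic K}) (sP _ _ pb)) -(nth_index (u : {classic K}) (sP _ _ pb')) ii.
    * by move=> [H ->].
    * by move=> -> [H].
    * by move=> [H ->] [H' [->]].
  + move=> b i; have := fP b; case pb: (psi b) => [u|c]; last by move=> [H ->].
    move=> -> [<-]; rewrite !inordK ?ltnS //; [exact: ind pb|exact: indM pb].
  + move=> b y; have := fP b; case pb: (psi b) => [u|c]; first by move=> ->.
    by move=> [H ->] [<-].
  + by exists b0; have := fP b0; rewrite pb0 => -[H ->]; exists (Some (exist _ c0 H)).
  + rewrite {1}E; congr mk; apply/funext => b; apply/funext => b'.
    have := fP b; have := fP b'.
    case pb: (psi b) => [u|c]; case pb': (psi b') => [u'|c'].
    * move=> -> -> /=; rewrite ffunE /= !inordK ?(indM _ _ pb) ?(indM _ _ pb') //.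
      by rewrite (ind _ _ pb) (ind _ _ pb') /= !nth_index // ?(sP _ _ pb) ?(sP _ _ pb').
    * move=> [H ->] -> /=; rewrite ffunE inordK ?(indM _ _ pb) //=.
      by rewrite nth_index // (sP _ _ pb).
    * move=> -> [H ->] /=; rewrite ffunE inordK ?(indM _ _ pb') //=.
      by rewrite nth_index // (sP _ _ pb').
    * by move=> [H ->] [H' ->].
Qed.

Lemma vertex_level : allowed deco (pos v) C x -> allowed deco (pos v).+1 C x.
Proof.
move=> al V f finj fb ir bd.
have xwf y i : (i < (pos v).+1)%N -> nth (a0 enr0) (x y) i = (deco i (pos (w y)), deco (pos (w y)) i).
  by rewrite ltnS; apply: xw.
pose e p q := cmb enr0 deco C x (f p) (f q).
pose real p (y : K + W) := match y with inl u => f p = inl (pos u) | inr c => f p = inr c end.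
have rtot p q y y' : real p y -> real q y' -> proj (e p q) = tot y y'.
  rewrite /e; case: y y' => [u|c] [u'|c'] /= fp fq; have := fb p; have := fb q; rewrite fp fq /= => Hq Hp.
  - by rewrite decoLL.
  - by rewrite xwf //= decoLL.
  - by rewrite xwf //= decoLL.
  - by [].
have rinj p q y : real p y -> real q y -> p = q.
  by case: y => [u|c] /= fp fq; apply: finj; rewrite fp fq.
have rle p u : real p (inl u) -> (pos u <= pos v)%N.
  by move=> /= fp; have := fb p; rewrite fp.
case: (bd) => G.
  case: G => al1 [B [FB [phi [pinj E]]]].
  have /choice[rho rP] : forall p, exists y, real p y.
    move=> p; have [q] := al1 p; case fp: (f p) => [i|c] /=; last by exists (inr c).
    by move=> /deco_inl[u /vatS ui]; exists (inl u); rewrite /= ui.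
  apply: (@killed B (rho \o phi)) => //.
  - move=> b b' rr; apply: pinj; apply: (rinj _ _ (rho (phi b))) => //.
    by have := rP (phi b'); rewrite /= in rr; rewrite rr.
  - by move=> b u pu; apply: (rle (phi b)); have := rP (phi b); rewrite /= in pu; rewrite pu.
  - by rewrite {1}E; congr mk; apply/funext => b; apply/funext => b'; apply: rtot.
case: G => d [ed]; case=> j; case=> m; case=> o [eo]; case=> B [FB].
case=> phi [pinj pj pd pex E].
have edl c : c <> d -> exists l, e d c = inr (Some l).
  by move=> cd; exists (j, m, o c); apply: eo.
have dn n : f d = inl n -> vat n = None /\ (n < pos v)%N.
  move=> fd; have nn : vat n = None by apply: deco_star; move: ed; rewrite fd.
  split=> //; have := fb d; rewrite fd /= ltnS leq_eqVlt => /orP[/eqP E'|//].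
  by move: nn; rewrite E' vat_pos.
have [[c1 [i1 [c1d fc1]]]|no] := pselect (exists c i, c <> d /\ f c = inl i); last first.
  apply: (al V f finj _ ir bd) => p; case fp: (f p) => [i|//].
  have [pd'|pd'] := pselect (p = d); first by apply: (dn i _).2; rewrite -pd'.
  by case: no; exists p, i.
case fd: (f d) => [n|c0]; last first.
  have [l] := edl c1 c1d; rewrite /e fc1 fd /= xwf; last by have := fb c1; rewrite fc1.
  by rewrite /deco vat_pos; case: vat.
have [nn nv'] := dn n fd; have nv : (n < (pos v).+1)%N by apply: ltnW.
have /choice[rho rP] : forall p, exists y, p <> d -> real p y /\ e d p = lab n (vx y).
  move=> p; have [->|pd'] := pselect (p = d); first by exists (inl v).
  have [l] := edl p pd'; rewrite /e fd; case fp: (f p) => [i|c] /=.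
    move=> /[dup] dl /deco_label[_ [u [ui lu]]]; exists (inl u) => _; split=> /=.
      by rewrite fp (vatS ui).
    by rewrite dl lu.
  move=> _; exists (inr c) => _; split=> //=; rewrite xwf //=.
  by rewrite /deco nn vat_pos.
have [psi [psinj Epsi psile]] := @decode V e d n j m o B phi rho FB eo pinj pj pd pex E
  (fun c cd => (rP c cd).2)
  (fun c c' cd cd' rr => rinj c c' (rho c) (rP c cd).1 (eq_ind_r (real c') (rP c' cd').1 rr))
  (fun c c' cd cd' => rtot _ _ _ _ (rP c cd).1 (rP c' cd').1).
apply: (@killed B psi) => // b u /psile[[c cd rc]|/(_ c1 c1d)].
  by apply: (rle c); have [] := rP c cd; rewrite rc.
have [+ _] := rP c1 c1d; case: (rho c1) => [u1|c'] /= fc1' ur; last by rewrite fc1 in fc1'.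
by apply: leq_trans (ltnW ur) _; apply: (rle c1).
Qed.

End Kill.
End Types.

Lemma deco_valid : valid enr0 bad deco.
Proof.
move=> n V f finj fb ir; case=> G.
  case: G => al1 [B [FB [phi [pinj E]]]].
  have /choice[k kP] : forall p, exists u, f p = pos u.
    by move=> p; have [q /deco_inl[u /vatS <-]] := al1 p; exists u.
  apply: (@noK B (k \o phi)) => // [b b' /= kk|].
    by apply: pinj; apply: finj; rewrite !kP kk.
  by rewrite E; congr mk; apply/funext => b; apply/funext => b' /=; rewrite !kP decoLL.
case: G => d [ed]; case=> j; case=> m; case=> o [eo]; case=> B [FB].
case=> phi [pinj pj pd pex E].
have [b0 [c0 fb0]] := pex.
have key c : c <> d -> exists u, f c = pos u /\ deco (f d) (f c) = lab (f d) u.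
  move=> cd; have dl := eo c cd; have [_ [u [uc lu]]] := deco_label dl.
  by exists u; rewrite dl lu (vatS uc).
have [u0 _] := key c0 (pd _ _ fb0).
have /choice[k kP] : forall c, exists u, c <> d -> f c = pos u /\ deco (f d) (f c) = lab (f d) u.
  by move=> c; have [->|/key[u]] := pselect (c = d); [exists u0|exists u].
pose w (c : void) : K := u0; pose C (c c' : void) := enr0.
have h1 c c' : c <> d -> c' <> d -> inl (k c) = inl (k c') :> K + void -> c = c'.
  by move=> /kP[fc _] /kP[fc' _] [kk]; apply: finj; rewrite fc fc' kk.
have h2 c c' : c <> d -> c' <> d ->
    proj (deco (f c) (f c')) = tot w C (inl (k c)) (inl (k c')).
  by move=> /kP[fc _] /kP[fc' _]; rewrite fc fc' decoLL.
have [psi [psinj Epsi _]] := @decode void w C V (fun p q => deco (f p) (f q)) d (f d) j m o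
  B phi (fun c => inl (k c)) FB eo pinj pj pd pex E (fun c cd => (kP c cd).2) h1 h2.
have /choice[r rP] : forall b, exists u, psi b = inl u by move=> b; case: (psi b) => [u|[]]; exists u.
apply: (@noK B r) => // [b b' rr|]; first by apply: psinj; rewrite !rP rr.
by rewrite {1}Epsi; congr mk; apply/funext => b; apply/funext => b'; rewrite !rP.
Qed.

(* Only sets of at most [M] vertices matter at the level of an auxiliary point. *)
Lemma aux_level n W (C : W -> W -> enr) (x : W -> seq (letter enr)) :
  vat n = None -> (forall c, (nth (a0 enr0) (x c) n).2 = enr0) ->
  (forall m (y : 'I_m -> W), injective y -> (0 < m <= M)%N ->
     allowed deco n (fun i i' => C (y i) (y i')) (x \o y) ->
     allowed deco n.+1 (fun i i' => C (y i) (y i')) (x \o y)) ->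
  allowed deco n C x -> allowed deco n.+1 C x.
Proof.
move=> nn xz H al V f finj fb ir bd.
have [[v0 fv0]|no] := pselect (exists v, f v = inl n); last first.
  apply: (al V f finj _ ir bd) => v; have := fb v; case fv: (f v) => [i|//] /=.
  rewrite ltnS leq_eqVlt => /orP[/eqP E|//]; by case: no; exists v; rewrite fv E.
case: bd => G.
  case: G => /(_ v0)[q]; rewrite fv0 /= => /deco_inl[u]; by rewrite nn.
case: G => d [ed]; case=> j; case=> m; case=> o [eo]; case=> B [FB].
case=> phi [pinj pj pd pex E].
have fd : f d = inl n.
  have [<-//|d0] := pselect (v0 = d); have := eo v0 d0; rewrite fv0.
  case: (f d) => [i|c] /=; first by move=> /deco_label[_ [u]]; rewrite nn => -[].
  by rewrite xz.
have kap c : c <> d -> exists c', f c = inr c'.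
  move=> cd; have := eo c cd; have := fb c; rewrite fd; case: (f c) => [i|c' _ _]; last by exists c'.
  move=> /= ni /deco_label[_ [u [/vatS ui /labP[[_ _ _ nu] _]]]].
  by move: ni; rewrite -ui ltnS leqNgt nu.
have [sB [_ sBin sBM]] := F_enum FB; have [b1 [c1 pb1]] := pex.
have [w1 fc1] := kap c1 (pd _ _ pb1).
pose l : seq {classic W} := undup (pmap (fun b : {classic B} =>
  if phi b is inr c then (if f c is inr c' then Some (c' : {classic W}) else None) else None) sB).
have lP b c c' : phi b = inr c -> f c = inr c' -> (c' : {classic W}) \in l.
  move=> pb fc; rewrite mem_undup mem_pmap; apply/mapP; exists (b : {classic B}) => //.
  by rewrite pb fc.
pose y (i : 'I_(size l)) : W := nth (w1 : {classic W}) l i.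
have yinj : injective y.
  move=> i i' yy; apply: ord_inj; apply/eqP.
  rewrite -(nth_uniq (w1 : {classic W}) (ltn_ord i) (ltn_ord i') (undup_uniq _)).
  by apply/eqP; exact: yy.
have lM : (0 < size l <= M)%N.
  apply/andP; split; first by have := lP _ _ _ pb1 fc1; case: (l).
  apply: leq_trans (size_undup _) _; apply: leq_trans sBM.
  by rewrite size_pmap count_size.
have ay : allowed deco n (fun i i' => C (y i) (y i')) (x \o y).
  by apply: (@allowed_emb _ _ _ _ _ _ _ _ _ _ _ _ _ y) al.
pose up (p : nat + 'I_(size l)) : nat + W := match p with inl i => inl i | inr i => inr (y i) end.
pose V' := {v | v = d \/ exists b, phi b = inr v}.
have /choice[f' f'P] : forall v : V', exists p, f (sval v) = up p.
  case=> v hv; have [vd|[b pb]] := hv; first by exists (inl n); rewrite /= vd fd.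
  have [c' fc] := kap v (pd _ _ pb); have cl := lP _ _ _ pb fc.
  have il : (index (c' : {classic W}) l < size l)%N by rewrite index_mem.
  by exists (inr (Ordinal il)); rewrite fc /= /y nth_index.
have sinj (v v' : V') : sval v = sval v' -> v = v'.
  by case: v v' => v hv [v' hv'] /= vv; subst v'; congr exist; apply: Prop_irrelevance.
have cE (v v' : V') : cmb enr0 deco C x (f (sval v)) (f (sval v')) =
    cmb enr0 deco (fun i i' => C (y i) (y i')) (x \o y) (f' v) (f' v').
  by rewrite !f'P; case: (f' v) (f' v') => [?|?] [?|?].
have /funext/= cE' : forall v : V', (fun v' => cmb enr0 deco (fun i i' => C (y i) (y i')) (x \o y)
    (f' v) (f' v')) = (fun v' => cmb enr0 deco C x (f (sval v)) (f (sval v'))).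
  by move=> v; apply/funext => v'; rewrite cE.
apply: (H _ y yinj lM ay V' f').
- by move=> v v' ff; apply: sinj; apply: finj; rewrite !f'P ff.
- by move=> v; have := fb (sval v); rewrite f'P; case: (f' v).
- by rewrite cE' => v v' vv; apply: ir => vv'; apply: vv; apply: sinj.
- rewrite cE'; right; exists (exist _ d (or_introl erefl)); split=> //.
  exists j, m, (fun v => o (sval v)); split.
    by move=> c cd /=; apply: eo => cd'; apply: cd; apply: sinj.
  pose up' (p : 'I_M + V') : 'I_M + V := match p with inl i => inl i | inr v => inr (sval v) end.
  have /choice[phi' phP] : forall b, exists p, phi b = up' p.
    move=> b; case pb: (phi b) => [i|c]; first by exists (inl i).
    by exists (inr (exist _ c (or_intror (ex_intro _ b pb)))).
  exists B; split=> //; exists phi'; split.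
  + by move=> b b' pp; apply: pinj; rewrite !phP pp.
  + by move=> b i pp; apply: (pj b); rewrite phP pp.
  + by move=> b c pp cd; apply: (pd b (sval c)); rewrite ?phP ?pp ?cd.
  + by exists b1; have := phP b1; rewrite pb1; case: (phi' b1) => [//|c] _; exists c.
  + by rewrite {1}E; congr mk; apply/funext => b; apply/funext => b'; rewrite !phP;
      case: (phi' b) (phi' b') => [?|?] [?|?].
Qed.

End Enriched.

(** * Terms and envelopes *)

Section Envelope.
Variables (L : language) (nL : nat) (idx : L -> 'I_nL).
Hypothesis idx_inj : injective idx.
Hypothesis ar2 : forall s : L, (arity s <= 2)%N.
Variables (F : set (structure L)) (K : structure L) (M0 : nat).
Notation M := M0.+1.
Hypothesis F_enum : forall B, F B ->
  exists s : seq {classic B}, [/\ uniq s, forall b, b \in s & (size s <= M)%N].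
Hypothesis F_irr : forall B, F B -> irreducible B.
Hypothesis F_K : forall B, F B -> ~ embeds B K.
Variables (pos : K -> nat) (Sg : nat -> seq {classic K}).
Hypothesis pos_inj : injective pos.
Hypothesis Sg_ex : forall (s : seq {classic K}) v, (size s <= M)%N ->
  (forall u, u \in s -> (pos u <= pos v)%N) ->
  exists n, [/\ (n < pos v)%N, forall u, pos u <> n & Sg n = s].
Hypothesis Sg0 : Sg 0 = [::].

Notation enr := (enr nL M0).
Notation enr0 := (enr0 nL M0).
Notation bad := (bad idx F (M0 := M0)).
Notation deco := (deco idx M0 pos Sg).
Notation lab := (lab idx M0 pos Sg).
Notation eK := (@eK L nL idx K).
Notation vat := (vat pos).
Notation allowed := (allowed enr0 bad).
Notation word := (seq (letter enr)).
Notation z0 := (a0 enr0).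

Definition term : finType :=
  (option bool + {m : 'I_M.+1 & {ffun 'I_m * 'I_m -> enr}})%type.
Definition t_zero : term := inl None.
Definition t_pos : term := inl (Some false).
Definition t_split : term := inl (Some true).
Definition t_kill (m : 'I_M.+1) (C : {ffun 'I_m * 'I_m -> enr}) : term :=
  inr (existT _ m C).

Definition ltr i (x : K) : letter enr := (deco i (pos x), deco (pos x) i).

Definition event (t : term) (xs : 'I_M0.+2 -> K) i : Prop :=
  match t with
  | inl None => True
  | inl (Some false) => False
  | inl (Some true) => ltr i (xs ord0) <> ltr i (xs ord_max)
  | inr (existT m C) => ~ allowed deco i.+1 (fun a b => C (a, b))
      (fun a : 'I_m => wd deco (pos (xs (inord a))))
  end.

Lemma lev_ex t (xs : 'I_M0.+2 -> K) :
  exists i, `[< (exists a, (pos (xs a) <= i)%N) \/ event t xs i >].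
Proof. by exists (pos (xs ord0)); apply/asboolP; left; exists ord0. Qed.

Definition lev t xs := ex_minn (lev_ex t xs).

Lemma levP t xs : (exists a, (pos (xs a) <= lev t xs)%N) \/ event t xs (lev t xs).
Proof. by rewrite /lev; case: ex_minnP => i /asboolP. Qed.

Lemma lev_pos t xs a : (lev t xs <= pos (xs a))%N.
Proof. by rewrite /lev; case: ex_minnP => i _; apply; apply/asboolP; left; exists a. Qed.

Lemma lev_event t xs i : event t xs i -> (lev t xs <= i)%N.
Proof. by rewrite /lev; case: ex_minnP => j _ H ev; apply: H; apply/asboolP; right. Qed.

Lemma pos_gt0 v : (0 < pos v)%N.
Proof. by have [n [/(leq_ltn_trans (leq0n _))]] := @Sg_ex [::] v isT ltac:(by []). Qed.

Lemma wd_ltr i x : (i < pos x)%N -> nth z0 (wd deco (pos x)) i = ltr i x.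
Proof. exact: nth_wd. Qed.

Lemma ltr_aux i x : vat i = None -> (ltr i x).2 = enr0.
Proof. by rewrite /ltr /deco /= vat_pos // => ->. Qed.

Lemma lev_vertex t xs u : lev t xs = pos u -> exists a, u = xs a.
Proof.
move=> E; have [[a ale]|ev] := levP t xs.
  by exists a; apply: pos_inj; apply/eqP; rewrite -E eqn_leq lev_pos ale.
have [[a ale]|no] := pselect (exists a, (pos (xs a) <= pos u)%N).
  by exists a; apply: pos_inj; apply/eqP; rewrite eqn_leq -{1}E lev_pos ale.
have up a : (pos u < pos (xs a))%N by rewrite ltnNge; apply/negP => H; apply: no; exists a.
exfalso; move: ev (E); rewrite E; case: t E => [[[|]|]|[m C]] E //= ev _.
- have [n [nu nn nS]] := @Sg_ex [:: (u : {classic K})] u isT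
    ltac:(by move=> u'; rewrite inE => /eqP ->).
  have : (lev (inl (Some true)) xs <= n)%N; last by rewrite E leqNgt nu.
  apply: lev_event => /= EE; apply: ev.
  have vn : vat n = None by apply: vatN.
  have lb a : lab n (xs a) = inr (Some (inord 1, mlab idx M0 [:: (u : {classic K})] (xs a),
      olab idx M0 [:: (u : {classic K})] (xs a))).
    rewrite /lab; case: pselect => [lb|[]]; first by rewrite nS.
    rewrite /labelled nS; split=> //; last exact: ltn_trans nu (up a).
    by move=> u'; rewrite inE => /eqP ->.
  move: EE; rewrite /ltr /deco vn !vat_pos // !lb => -[_ /ffunP/(_ ord0)].
  by rewrite !ffunE /= => -[-> ->].
- by have := @lev_event (inl None) xs 0 I; rewrite E leqn0; have := pos_gt0 u; case: (pos u).
- have pu := pos_gt0 u; apply: ev.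
  have al : allowed deco (pos u) (fun a b => C (a, b))
      (fun a : 'I_m => wd deco (pos (xs (inord a)))).
    apply: contrapT => na; have : (lev (inr (existT _ m C)) xs <= (pos u).-1)%N.
      by apply: lev_event => /=; rewrite prednK.
    by rewrite E leqNgt prednK // leqnn.
  have wl (a : 'I_m) i : (i <= pos u)%N ->
      nth z0 (wd deco (pos (xs (inord a)))) i = ltr i (xs (inord a)).
    by move=> iu; apply: wd_ltr; apply: leq_ltn_trans iu (up _).
  exact: (@vertex_level L nL idx idx_inj ar2 F K M0 F_enum F_irr F_K pos Sg pos_inj Sg_ex
    _ (fun a : 'I_m => xs (inord a)) _ u _ (fun a => up _) wl al).
Qed.

Section Embedding.
Variables (n : nat) (f : 'I_n -> K).

Definition eterm : finType := (term * {ffun 'I_M0.+2 -> 'I_n})%type.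
Definition elev (t : eterm) := lev t.1 (f \o t.2).
Definition evs := sort leq (undup [seq elev t | t <- enum eterm]).
Definition ht i := if (i < size evs)%N then nth 0 evs i else (i + (\sum_(e <- evs) e).+1)%N.
Definition nev := size evs.

Lemma mem_evs p : p \in evs <-> exists t, elev t = p.
Proof.
rewrite mem_sort mem_undup; split=> [/mapP[t _ ->]|[t <-]]; first by exists t.
by apply/mapP; exists t => //; rewrite mem_enum.
Qed.

Lemma evs_sorted : sorted ltn evs.
Proof. by rewrite ltn_sorted_uniq_leq sort_uniq undup_uniq sort_sorted //; exact: leq_total. Qed.

Lemma ht_evs i : (i < nev)%N -> ht i = nth 0 evs i. Proof. by rewrite /ht => ->. Qed.

Lemma ht_mem i : (i < nev)%N -> ht i \in evs.
Proof. by move=> ni; rewrite ht_evs // mem_nth. Qed.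

Lemma ht_index p : p \in evs -> ht (index p evs) = p.
Proof. by move=> pe; rewrite ht_evs ?nth_index // /nev index_mem. Qed.

Lemma index_ht i : (i < nev)%N -> index (ht i) evs = i.
Proof.
move=> ni; rewrite ht_evs // index_uniq //.
by have := evs_sorted; rewrite ltn_sorted_uniq_leq => /andP[].
Qed.

Lemma evs_le_sum e : e \in evs -> (e <= \sum_(e <- evs) e)%N.
Proof. by move=> ee; rewrite (big_rem e) //= leq_addr. Qed.

Lemma ht_lt i j : (i < j)%N -> (ht i < ht j)%N.
Proof.
rewrite /ht => ij; case: ifP => iN; case: ifP => jN.
- exact: (sorted_ltn_nth ltn_trans 0 evs_sorted).
- apply: leq_ltn_trans (evs_le_sum (mem_nth 0 iN)) _.
  by rewrite addnS ltnS leq_addl.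
- by have := ltn_trans ij jN; rewrite iN.
- lia.
Qed.

Lemma ht_ltE i j : (ht i < ht j)%N = (i < j)%N.
Proof.
case: (ltngtP i j) => [/ht_lt->//|/ht_lt ji|->]; last by rewrite ltnn.
by apply/negbTE; rewrite -leqNgt ltnW.
Qed.

Definition env i j := deco (ht i) (ht j).

Lemma env_valid : valid enr0 bad env.
Proof.
move=> k; apply: (@freeon_emb _ _ _ _ _ _ (fun i : nat => (i < ht k)%N : Prop) _ _ ht).
- move=> i j _ _ hh; have := ht_ltE i j; have := ht_ltE j i; rewrite hh ltnn.
  by case: ltngtP.
- by move=> i ik; apply: ht_lt.
- by [].
- exact: (@deco_valid L nL idx idx_inj ar2 F K M0 F_K pos Sg pos_inj).
Qed.

Lemma pos_evs a : pos (f a) \in evs.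
Proof.
apply/mem_evs; exists (t_pos, [ffun=> a]); rewrite /elev /=.
have [[b]|//] := levP t_pos (f \o [ffun=> a]).
rewrite /= ffunE => le; apply/eqP; rewrite eqn_leq le andbT.
by have := lev_pos t_pos (f \o [ffun=> a]) ord0; rewrite /= ffunE.
Qed.

Lemma zero_evs (a : 'I_n) : 0 \in evs.
Proof.
apply/mem_evs; exists (t_zero, [ffun=> a]); apply/eqP; rewrite -leqn0.
exact: (@lev_event t_zero).
Qed.

Lemma split_evs a a' p : (p < pos (f a))%N -> (p < pos (f a'))%N -> ltr p (f a) <> ltr p (f a') ->
  exists e, [/\ e \in evs, (e <= p)%N & ltr e (f a) <> ltr e (f a')].
Proof.
move=> pa pa' ne; pose xs : {ffun 'I_M0.+2 -> 'I_n} := [ffun i => if i == ord0 then a else a'].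
have le : (elev (t_split, xs) <= p)%N by apply: lev_event; rewrite /= !ffunE.
exists (elev (t_split, xs)); split=> //; first by apply/mem_evs; exists (t_split, xs).
have [[b]|] := levP t_split (f \o xs); last by rewrite /= !ffunE.
by rewrite /= ffunE leqNgt; case: ifP => _ /negP[]; apply: leq_ltn_trans le _.
Qed.

Lemma vertex_evs e u : e \in evs -> vat e = Some u -> exists a, u = f a.
Proof.
by move=> /mem_evs[t <-] /vatS /esym /lev_vertex[a ->]; eexists.
Qed.

Definition cand (t : word) p a := (p < pos (f a))%N /\
  forall j, (j < nev)%N -> (ht j < p)%N -> nth z0 t j = ltr (ht j) (f a).
Definition env_letter t p := if p \in evs then nth z0 t (index p evs)
  else if [pick a | `[< cand t p a >]] is Some a then ltr p (f a) else z0.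
Definition env_map t : word := mkseq (env_letter t) (ht (size t)).

Lemma cand_ltr t p a a' : cand t p a -> cand t p a' -> p \notin evs ->
  ltr p (f a) = ltr p (f a').
Proof.
move=> [pa ca] [pa' ca'] pe; apply: contrapT => ne.
have [e [ee ep nee]] := split_evs pa pa' ne; apply: nee.
have ep' : (e < p)%N by rewrite ltn_neqAle ep andbT; apply: contraNneq pe => <-.
have ie : (index e evs < nev)%N by rewrite /nev index_mem.
by have := ca _ ie; have := ca' _ ie; rewrite ht_index // => /(_ ep') <- /(_ ep').
Qed.

Lemma cand_le t p q a : (q <= p)%N -> cand t p a -> cand t q a.
Proof.
move=> qp [pa ca]; split=> [|j jn jq]; first exact: leq_ltn_trans pa.
by apply: ca => //; apply: leq_trans qp.
Qed.

Lemma env_letter_cand t q p a : cand t q a -> (p <= q)%N -> (q \in evs -> (p < q)%N) ->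
  env_letter t p = ltr p (f a).
Proof.
move=> c pq qe; rewrite /env_letter; case: ifP => pe.
  have pq' : (p < q)%N by rewrite ltn_neqAle pq andbT; apply/negP => /eqP E;
    have := qe; rewrite -E pe ltnn => /(_ isT).
  have [_ /(_ (index p evs))] := c; rewrite ht_index // => -> //.
  by rewrite /nev index_mem.
case: pickP => [a' /asboolP c'|/(_ a)]; last by rewrite (asboolT (cand_le pq c)).
by apply: (cand_ltr c' (cand_le pq c)); rewrite pe.
Qed.

Lemma env_letter_none t p : p \notin evs -> (forall a, ~ cand t p a) -> env_letter t p = z0.
Proof.
move=> /negbTE pe nc; rewrite /env_letter pe; case: pickP => // a /asboolP ca.
by case: (nc a).
Qed.

Lemma wd_env i p : (i < nev)%N -> (p < ht i)%N ->
  env_letter (wd env i) p = (deco p (ht i), deco (ht i) p).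
Proof.
move=> ni pi; case pe: (p \in evs).
  have ip : (index p evs < i)%N by rewrite -ht_ltE ht_index.
  by rewrite /env_letter pe nth_wd // /env ht_index.
case vi: (vat (ht i)) => [u|].
  have [a ua] := vertex_evs (ht_mem ni) vi; have {}ua : ht i = pos (f a) by rewrite -ua (vatS vi).
  rewrite ua; apply: (@env_letter_cand _ p) => //; last by rewrite pe.
  split=> [|j jn jp]; first by rewrite -ua.
  have ji : (j < i)%N by rewrite -ht_ltE (ltn_trans jp).
  by rewrite (nth_wd _ _ ji) /env ua.
have d1 q : (q < ht i)%N -> deco q (ht i) = enr0 /\ deco (ht i) q = enr0.
  move=> qi; rewrite /deco vi; case vq: (vat q) => [u|]; last first.
    by rewrite ltn_eqF // gtn_eqF.
  split=> //; rewrite /lab; case: pselect => // lb; exfalso; case: lb => _ _ _.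
  by rewrite (vatS vq) ltnNge (ltnW qi).
have [-> ->] := d1 _ pi; apply: env_letter_none; rewrite ?pe // => a [pa /(_ (index 0 evs))].
have p0 : (0 < p)%N by case: (p) pe => // ; rewrite (zero_evs a).
have i0 : (index 0 evs < nev)%N by rewrite /nev index_mem (zero_evs a).
rewrite ht_index ?(zero_evs a) // => /(_ i0 p0).
have ii : (index 0 evs < i)%N by rewrite -ht_ltE ht_index ?(zero_evs a) // (ltn_trans p0).
rewrite nth_wd // /env ht_index ?(zero_evs a) //.
have [-> _] := d1 0 (ltn_trans p0 pi) => -[].
rewrite /deco vat_pos // vatN; last by move=> u E; have := pos_gt0 u; rewrite E.
rewrite /lab; case: pselect => // nl _ _; apply: nl; rewrite /labelled Sg0; split=> //.
exact: pos_gt0.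
Qed.

(* A level which loses age is the level of a term, hence an event. *)
Lemma env_skip q : q \notin evs -> forall W (C : W -> W -> enr) (x : W -> word),
  allowed deco q C (fun c => mkseq (env_letter (x c)) q) ->
  allowed deco q.+1 C (fun c => mkseq (env_letter (x c)) q.+1).
Proof.
move=> qe W C x al.
have pad W' (C' : W' -> W' -> enr) x' : allowed deco q C' (fun c => mkseq (env_letter (x' c)) q) <->
    allowed deco q C' (fun c => mkseq (env_letter (x' c)) q.+1).
  by split; apply: allowed_eq => c i iq; rewrite !nth_mkseq // ltnW.
have nz t : ~ (exists a, cand t q a) -> forall j, (q <= j < q.+1)%N ->
    nth z0 (mkseq (env_letter t) q.+1) j = z0.
  move=> nc j; rewrite ltnS => qj; have -> : j = q by apply/eqP; rewrite eqn_leq andbC.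
  by rewrite nth_mkseq // env_letter_none // => a ca; apply: nc; exists a.
apply: (allowed_zero (leqnSn q) _ nz); last exact/pad.
move=> W' C' x' /choice[a ca].
pose X c : word := mkseq (env_letter (x' c)) q.+1; rewrite -/X => al'.
have Xl c i : (i <= q)%N -> nth z0 (X c) i = ltr i (f (a c)).
  move=> iq; rewrite nth_mkseq ?ltnS //; apply: env_letter_cand (ca c) iq _.
  by rewrite (negbTE qe).
have qa c : (q < pos (f (a c)))%N by case: (ca c).
case vq: (vat q) => [v|].
  have qv := vatS vq; subst q.
  apply: (@vertex_level L nL idx idx_inj ar2 F K M0 F_enum F_irr F_K pos Sg pos_inj Sg_ex
    _ (fun c => f (a c))) al' => [c|c i iv]; first exact: qa.
  exact: Xl.
have H1 c : (nth z0 (X c) q).2 = enr0 by rewrite Xl // ltr_aux.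
apply: (aux_level F_enum vq H1) al'.
move=> m y yi /andP[m0 mM] al'; apply: contrapT => nal.
have mM' : (m < M.+1)%N by rewrite ltnS.
pose C1 : {ffun 'I_(Ordinal mM') * 'I_(Ordinal mM') -> enr} :=
  [ffun p : 'I_m * 'I_m => C' (y p.1) (y p.2)].
pose xs : {ffun 'I_M0.+2 -> 'I_n} := [ffun i : 'I_M0.+2 => a (y (insubd (Ordinal m0) (i : nat)))].
have xsE (i : 'I_m) : xs (inord i) = a (y i).
  rewrite ffunE inordK; last by rewrite (leq_trans (ltn_ord i)) // ltnW.
  by congr (a (y _)); apply: val_inj; rewrite val_insubd ltn_ord.
have wdE i p : (p <= q)%N -> nth z0 (wd deco (pos (f (a (y i))))) p = nth z0 (X (y i)) p.
  by move=> pq; rewrite Xl // wd_ltr // (leq_ltn_trans pq).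
have C1E : (fun u v : 'I_m => C1 (u, v)) = (fun i i' => C' (y i) (y i')).
  by apply/funext => u; apply/funext => v; rewrite ffunE.
have ev k : (k <= q)%N -> event (t_kill C1) (f \o xs) k <->
    ~ allowed deco k.+1 (fun i i' => C' (y i) (y i')) (X \o y).
  move=> kq; rewrite /= C1E; split=> H H'; apply: H; apply: allowed_eq H' => i p pk /=.
    by rewrite xsE wdE // (leq_trans _ kq).
  by rewrite xsE wdE // (leq_trans _ kq).
have le : (lev (t_kill C1) (f \o xs) <= q)%N by apply: lev_event; apply/ev.
case/negP: qe; apply/mem_evs; exists (t_kill C1, xs); apply/eqP; rewrite eqn_leq le /=.
rewrite leqNgt; apply/negP => lt; have [[i]|/(ev _ le)[]] := levP (t_kill C1) (f \o xs).
  by rewrite /= ffunE leqNgt (leq_ltn_trans le).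
exact: allowed_le al'.
Qed.

Lemma env_ages q : forall j, (j <= nev)%N ->
  (forall i, (i < nev)%N -> (i < j)%N = (ht i < q)%N) ->
  forall W (C : W -> W -> enr) (x : W -> word), allowed env j C x ->
  allowed deco q C (fun c => mkseq (env_letter (x c)) q).
Proof.
elim: q => [|q IH] j jn jq W C x al.
  by apply: (@allowed_emb _ _ _ _ _ _ _ _ _ _ _ _ _ id) al.
case qe: (q \in evs); last first.
  apply: env_skip; rewrite ?qe //; apply: IH jn _ _ _ _ al => i ni.
  rewrite jq // ltnS leq_eqVlt; case: eqP => [E|//].
  by move: qe; rewrite -E ht_mem.
pose k := index q evs; have kn : (k < nev)%N by rewrite /nev index_mem.
have hk : ht k = q by rewrite ht_index.
have kj : (k < j)%N by rewrite jq // hk.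
have jk : j = k.+1.
  apply/eqP; rewrite eqn_leq kj andbT leqNgt; apply/negP => kj'.
  by have := jq k.+1 (leq_trans kj' jn); rewrite kj' -hk ltnS leqNgt ht_lt.
subst j; have IHk := IH k (ltnW kn).
have {}IHk := IHk ltac:(by move=> i ni; rewrite -hk ht_ltE).
move/allowedS: al => /IHk al; apply/allowedS.
have E : addv enr0 deco q C (fun c => mkseq (env_letter (x c)) q.+1) = addv enr0 env k C x.
  have nq c : nth z0 (mkseq (env_letter (x c)) q.+1) q = nth z0 (x c) k.
    by rewrite nth_mkseq // /env_letter qe.
  by apply/funext => -[c|]; apply/funext => -[d|] //=; rewrite ?nq // /env hk.
rewrite E; apply: allowed_eq al => -[c|] i iq /=.
  by rewrite !nth_mkseq // ltnW.
by rewrite nth_mkseq // wd_env ?hk // nth_wd.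
Qed.

Lemma env_mor : morn enr0 bad nev env deco ht env_map.
Proof.
split.
- by move=> t _; rewrite size_mkseq.
- move=> t s tn; rewrite /env_map size_rcons.
  pose ts := rcons t s; rewrite -/ts.
  have G p : (p < ht (size t))%N -> env_letter t p = env_letter ts p.
    move=> pt; rewrite /env_letter; case: ifP => pe.
      have ip : (index p evs < size t)%N by rewrite -ht_ltE ht_index.
      by rewrite nth_rcons ip.
    have -> // : [pick a | `[< cand t p a >]] = [pick a | `[< cand ts p a >]].
    apply: eq_pick => a; apply: asbool_equiv_eq; split=> -[pa ca]; split=> // j jn jp;
      have jt : (j < size t)%N by rewrite -ht_ltE (ltn_trans jp).
      by rewrite nth_rcons jt ca.
    by rewrite -ca // nth_rcons jt.
  have -> : rcons (mkseq (env_letter t) (ht (size t))) s = mkseq (env_letter ts) (ht (size t)).+1.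
    rewrite mkseqS; congr rcons; last first.
      rewrite /env_letter ht_mem ?(ltnW tn) // index_ht ?(ltnW tn) //.
      by rewrite nth_rcons ltnn eqxx.
    by apply/eq_in_map => p; rewrite mem_iota add0n => /andP[_]; apply: G.
  have /subnKC <- : (ht (size t) < ht (size t).+1)%N by apply: ht_lt.
  by rewrite /mkseq iotaD map_cat prefix_prefix.
- move=> i ni; split=> //; rewrite /env_map size_wd.
  apply: (@eq_from_nth _ z0); rewrite ?size_wd ?size_mkseq // => p pi.
  by rewrite nth_wd // nth_mkseq // wd_env.
- move=> i W C x ni sx al.
  have := @env_ages (ht i) i (ltnW ni) (fun k _ => esym (ht_ltE k i)) W C x al.
  by apply: allowed_eq => c j _ /=; rewrite /env_map sx.
Qed.

End Embedding.

Definition similar n (f g : 'I_n -> K) :=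
  [/\ forall t t', (elev f t < elev f t')%N = (elev g t < elev g t')%N,
      forall t a, deco (elev f t) (pos (f a)) = deco (elev g t) (pos (g a)) &
      forall a a', eK (f a) (f a') = eK (g a) (g a')].

Section Similar.
Variables (n : nat) (f g : 'I_n -> K) (fg : similar f g).

Let eqfg t t' : (elev f t == elev f t') = (elev g t == elev g t').
Proof. by case: fg => lt _ _; rewrite !eqn_leq !(leqNgt (elev _ _)) !lt. Qed.

Let evsE : exists s : nat -> nat, (forall t, s (elev f t) = elev g t) /\ evs g = map s (evs f).
Proof.
pose s v := if [pick t | elev f t == v] is Some t then elev g t else 0.
have sE t : s (elev f t) = elev g t.
  rewrite /s; case: pickP => [t'|/(_ t)]; last by rewrite eqxx.
  by rewrite eqfg => /eqP.
exists s; split=> //; apply: (irr_sorted_eq ltn_trans ltnn (evs_sorted g)).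
  rewrite sorted_map; apply: (@sub_in_sorted _ (mem (evs f)) ltn) (evs_sorted f).
    move=> p q /mem_evs[t <-] /mem_evs[t' <-] /=; rewrite !sE.
    by case: fg => lt _ _; rewrite lt.
  exact/allP.
move=> p; apply/idP/idP => [/mem_evs[t <-]|/mapP[q /mem_evs[t <-] ->]].
  by rewrite -sE map_f //; apply/mem_evs; exists t.
by rewrite sE; apply/mem_evs; exists t.
Qed.

Lemma similar_nev : nev f = nev g.
Proof. by have [s [_]] := evsE; rewrite /nev => ->; rewrite size_map. Qed.

Lemma similar_ht i : (i < nev f)%N -> exists t, ht f i = elev f t /\ ht g i = elev g t.
Proof.
move=> ni; have [s [sE E]] := evsE; have /mem_evs[t tE] := ht_mem ni; exists t.
split=> //; rewrite (ht_evs (f := g)) -?similar_nev // E (nth_map 0) //.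
by rewrite -sE tE ht_evs.
Qed.

Lemma similar_pos a : index (pos (f a)) (evs f) = index (pos (g a)) (evs g).
Proof.
have [s [sE E]] := evsE.
have pE k (k' : 'I_n -> K) : index (pos (k' a)) (evs k') = k -> (k < nev k')%N /\ ht k' k = pos (k' a).
  by move=> <-; rewrite ht_index ?pos_evs // /nev index_mem pos_evs.
have [kn kE] := pE _ f erefl; have [t [t1 t2]] := similar_ht kn.
set k := index (pos (f a)) (evs f) in kn kE t1 t2 *.
suff H : ht g k = pos (g a) by rewrite -H index_ht // -similar_nev.
pose ta : eterm n := (t_pos, [ffun=> a]).
have tE (k' : 'I_n -> K) : elev k' ta = pos (k' a).
  have [[b]|//] := levP t_pos (k' \o [ffun=> a]).
  rewrite /= ffunE => le; apply/eqP; rewrite eqn_leq le andbT.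
  by have := lev_pos t_pos (k' \o [ffun=> a]) ord0; rewrite /= ffunE.
by rewrite t2 -tE; apply/eqP; rewrite -eqfg -t1 kE tE.
Qed.

Lemma similar_env i j : (i < nev f)%N -> (j < nev f)%N -> env f i j = env g i j.
Proof.
move=> ni nj.
have vE k : (k < nev f)%N -> (exists a, ht f k = pos (f a) /\ ht g k = pos (g a)) \/
    (vat (ht f k) = None /\ vat (ht g k) = None).
  move=> nk; case vf: (vat (ht f k)) => [u|].
    have [a ua] := vertex_evs (ht_mem nk) vf; left; exists a.
    have E : ht f k = pos (f a) by rewrite -ua (vatS vf).
    split=> //; have : k = index (pos (f a)) (evs f) by rewrite -E index_ht.
    by rewrite similar_pos => ->; rewrite ht_index // pos_evs.
  case vg: (vat (ht g k)) => [u|]; last by right.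
  have nk' : (k < nev g)%N by rewrite -similar_nev.
  have [a ua] := vertex_evs (ht_mem nk') vg; left; exists a.
  have E : ht g k = pos (g a) by rewrite -ua (vatS vg).
  split=> //; have : k = index (pos (g a)) (evs g) by rewrite -E index_ht.
  by rewrite -similar_pos => ->; rewrite ht_index // pos_evs.
have [_ lE eE] := fg.
rewrite /env; case: (vE j nj) => [[a [-> ->]]|[jf jg]].
  case: (vE i ni) => [[a' [-> ->]]|_]; first by rewrite !decoLL // eE.
  by have [t [-> ->]] := similar_ht ni.
rewrite /deco jf jg; case: (vE i ni) => [[a' [-> ->]]|[-> ->]]; first by rewrite !vat_pos.
have hinj (k : 'I_n -> K) : (ht k i == ht k j) = (i == j).
  by rewrite !eqn_leq !(leqNgt (ht _ _)) !ht_ltE -!leqNgt.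
by rewrite !hinj.
Qed.

End Similar.
End Envelope.

(** * The expansion which controls all colourings *)

Lemma finite_enum T : finite_set [set: T] <-> exists s : seq {classic T}, uniq s /\ forall x, x \in s.
Proof.
split=> [|[s [_ sT]]].
  move=> /(@finite_seqP {classic T})[s E]; exists (undup s).
  rewrite undup_uniq; split=> // x; rewrite mem_undup.
  by have : [set: {classic T}] x by []; rewrite E.
by apply/(@finite_seqP {classic T}); exists s; apply/seteqP; split=> x // _; exact: sT.
Qed.

Lemma finite_bij T : finite_set [set: T] ->
  exists n (u : 'I_n -> T) (r : T -> 'I_n), cancel u r /\ cancel r u.
Proof.
move=> /finite_enum[s [us sT]].
have rP x : (index (x : {classic T}) s < size s)%N by rewrite index_mem.
exists (size s), (fun i => tnth (in_tuple s) i), (fun x => Ordinal (rP x)); split.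
  move=> i; apply: ord_inj => /=; rewrite (tnth_nth (tnth (in_tuple s) i)) /=.
  by rewrite index_uniq.
by move=> x; rewrite (tnth_nth (x : {classic T})) /= nth_index.
Qed.

Lemma eof_pullback (L : language) nL (idx : L -> 'I_nL) U V (f : U -> V) (I : interp L V) x y :
  injective f -> eof idx (pullback f I) x y = eof idx I (f x) (f y).
Proof.
move=> fi; apply/ffunP => i; rewrite !ffunE; apply: asbool_equiv_eq.
split=> -[s [si [t [It tE]]]]; exists s; split=> //.
  exists (map_tuple f t); split=> //.
  case: tE => [[E xy]|E]; [left|right]; rewrite /= E //.
  by split=> //; rewrite xy.
case: t It tE => t st /= It [[E /fi xy]|E]; subst t.
  exists (@Tuple _ _ [:: x] st); split; last by left.
  by move: It; congr (I s _); apply: val_inj.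
exists (@Tuple _ _ [:: x; y] st); split; last by right.
by move: It; congr (I s _); apply: val_inj.
Qed.

Section Limit.
Variables (L : language) (F : set (structure L)) (K : structure L).
Hypothesis fr : fraisse_limit (Forb F) K.

Lemma limit_age A : F A -> finite_structure A -> ~ embeds A K.
Proof.
case: fr => _ age _ FA fA AK; have [_ /(_ A FA)] := (age A fA).2 AK.
by apply; constructor; apply: emb_id.
Qed.

Lemma limit_inhabited A : F A -> finite_structure A -> inhabited A.
Proof.
move=> FA fA; apply: contrapT => nA; apply: (limit_age FA fA).
constructor; apply: (@Emb L A K (fun a => False_rect _ (nA (inhabits a)))).
split=> [a|]; first by case: nA.
apply: functional_extensionality_dep => s; rewrite predeqE => t.
by case: nA; constructor; exact: (tnth t (Ordinal (arity_gt0 s))).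
Qed.

Section Countable.
Variables (nL : nat) (idx : L -> 'I_nL).
Hypothesis ar2 : forall s : L, (arity s <= 2)%N.
Variables (P : nat -> Prop) (e : nat -> nat -> brel nL).

Definition segment n : structure L :=
  Structure (mk idx (fun x y : {k : nat | P k /\ (k < n)%N} => e (sval x) (sval y))).

Hypothesis seg_forb : forall n, Forb F (segment n).

Let lft n (x : segment n) : segment n.+1 :=
  exist _ (sval x) (conj (svalP x).1 (ltnW (svalP x).2)).

Let sval_inj n (x y : segment n) : sval x = sval y -> x = y.
Proof. by case: x y => x hx [y hy] /= xy; subst y; congr exist; apply: Prop_irrelevance. Qed.

Let lft_emb n : is_embedding (@lft n).
Proof.
split=> [x y /(congr1 sval) /= /sval_inj//|].
by rewrite /= -mk_pullback.
Qed.

Let extend n (f : emb (segment n) K) :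
  exists f' : emb (segment n.+1) K, forall x, f' (lft x) = f x.
Proof.
have [_ age uh] := fr.
have [g] := (age _ (seg_forb n.+1).1).1 (seg_forb n.+1).
have [a fa] := uh _ (seg_forb n).1 (emb_comp g (Emb (lft_emb n))) f.
by exists (emb_comp a g) => x; rewrite fa.
Qed.

Lemma embed_segments : exists io : nat -> option K,
  [/\ forall k, P k -> io k <> None,
      forall k k' v, P k -> P k' -> io k = Some v -> io k' = Some v -> k = k' &
      forall V (f : V -> nat) (f' : V -> K), (forall x, P (f x)) ->
        (forall x, io (f x) = Some (f' x)) ->
        pullback f' (@rel_of L K) = mk idx (fun x y => e (f x) (f y))].
Proof.
have [_ age _] := fr.
have [f0] := (age _ (seg_forb 0).1).1 (seg_forb 0).
pose st := fix st n : emb (segment n) K :=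
  if n is k.+1 then sval (cid (extend (st k))) else f0.
have stS n (x : segment n) : st n.+1 (lft x) = st n x by rewrite /=; case: cid.
pose io k := if pselect (P k) is left H then
  Some (st k.+1 (exist _ k (conj H (ltnSn k)))) else None.
have aux d k Pk (kd : (k < d + k.+1)%N) :
    st k.+1 (exist _ k (conj Pk (ltnSn k))) = st (d + k.+1)%N (exist _ k (conj Pk kd)).
  elim: d kd => [|d IH] kd; first by congr (st _ _); apply: sval_inj.
  have kd' : (k < d + k.+1)%N by lia.
  by rewrite (IH kd') -stS; congr (st _ _); apply: sval_inj.
have ioE n (x : segment n) : io (sval x) = Some (st n x).
  case: x => k [Pk kn] /=; rewrite /io; case: pselect => // H; congr Some.
  rewrite (Prop_irrelevance H Pk); have nE : n = (n - k.+1 + k.+1)%N by rewrite subnK.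
  by move: kn; rewrite nE => kn; apply: aux.
exists io; split.
- by move=> k Pk; rewrite /io; case: pselect.
- move=> k k' v Pk Pk'.
  have kn : (k < maxn k.+1 k'.+1)%N by lia.
  have kn' : (k' < maxn k.+1 k'.+1)%N by lia.
  have := ioE _ (exist _ k (conj Pk kn)); have := ioE _ (exist _ k' (conj Pk' kn')) => /= -> ->.
  move=> [<-] [/(embP (st _)).1 E]; have := congr1 sval E; by [].
- move=> V f f' Pf iof.
  apply: functional_extensionality_dep => s; rewrite predeqE => t.
  have := ar2 s; have := arity_gt0 s; case: t => t st'.
  have key n x y (hx : (f x < n)%N) (hy : (f y < n)%N) :
      (forall st1 : size [:: x] == arity s, rel_of (map_tuple f' (Tuple st1)) <->
        e (f x) (f x) (idx s)) /\
      (forall st1 : size [:: x; y] == arity s, rel_of (map_tuple f' (Tuple st1)) <->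
        e (f x) (f y) (idx s)).
    pose sx : segment n := exist _ (f x) (conj (Pf x) hx).
    pose sy : segment n := exist _ (f y) (conj (Pf y) hy).
    have fx : f' x = st n sx by have := ioE n sx; rewrite /= iof => -[].
    have fy : f' y = st n sy by have := ioE n sy; rewrite /= iof => -[].
    have [_ E] := embP (st n).
    split=> st1.
      have E1 : rel_of (map_tuple (st n) (@Tuple _ _ [:: sx] st1)) =
        (e (f x) (f x) (idx s) : Prop) := congr1 (fun I : interp L _ => I s _) E.
      rewrite (_ : map_tuple f' _ = map_tuple (st n) (@Tuple _ _ [:: sx] st1)) ?E1 //.
      by apply: val_inj; rewrite /= fx.
    have E1 : rel_of (map_tuple (st n) (@Tuple _ _ [:: sx; sy] st1)) =
      (e (f x) (f y) (idx s) : Prop) := congr1 (fun I : interp L _ => I s _) E.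
    rewrite (_ : map_tuple f' _ = map_tuple (st n) (@Tuple _ _ [:: sx; sy] st1)) ?E1 //.
    by apply: val_inj; rewrite /= fx fy.
  have := eqP st'; rewrite /pullback /mk /=.
  case: t st' => [|x [|y [|z r]]] st' sE a0 a2 /=; try by rewrite -sE in a0 a2.
    by have [H _] := key _ x x (ltnSn _) (ltnSn _); apply: H.
  by have [_ H] := key (maxn (f x) (f y)).+1 x y ltac:(lia) ltac:(lia); apply: H.
Qed.

End Countable.

Lemma segment_finite nL (idx : L -> 'I_nL) (P : nat -> Prop) (e : nat -> nat -> brel nL) n :
  finite_structure (segment idx P e n).
Proof.
apply/finite_enum; pose T := {k : nat | P k /\ (k < n)%N}.
pose s : seq {classic T} := pmap (fun k => if pselect (P k /\ (k < n)%N) is left H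
  then Some (exist _ k H : {classic T}) else None) (iota 0 n).
exists (undup s); split=> [|x]; first exact: undup_uniq.
rewrite mem_undup mem_pmap; apply/mapP; case: x => k H; exists k.
  by rewrite mem_iota add0n; case: H.
case: pselect => // H'; congr (Some _); congr exist; exact: Prop_irrelevance.
Qed.

End Limit.

(* Enumeration of the finite sequences of vertices, each one before its last
   vertex. *)
Lemma positions (K : Type) (code : K -> nat) M : injective code ->
  exists (pos : K -> nat) (Sg : nat -> seq {classic K}), [/\ injective pos, Sg 0 = [::] &
    forall (s : seq {classic K}) v, (size s <= M)%N ->
      (forall u, u \in s -> (pos u <= pos v)%N) ->
      exists n, [/\ (n < pos v)%N, forall u, pos u <> n & Sg n = s]].
Proof.
move=> ci.
pose bd k := \max_(s : M.-bseq 'I_k.+1) pickle (map (@nat_of_ord k.+1) s).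
pose p k := (\sum_(i < k.+1) (bd i).+1)%N.
have pS k : p k.+1 = (p k + (bd k.+1).+1)%N by rewrite /p big_ord_recr.
have plt j k : (j < k)%N -> (p j < p k)%N.
  elim: k => // k IH; rewrite ltnS leq_eqVlt => /orP[/eqP->|/IH]; rewrite pS; lia.
have bp k : (bd k < p k)%N by rewrite /p big_ord_recr /= addnS ltnS leq_addl.
pose vof k : option {classic K} :=
  if pselect (exists v, code v = k) is left H then Some (sval (cid H)) else None.
have vofK v : vof (code v) = Some v.
  by rewrite /vof; case: pselect => [H|[]]; [congr Some; apply: ci; case: cid|exists v].
pose Sg n : seq {classic K} := if n is k.+2 then
  (if unpickle k./2 is Some s then pmap vof (s : seq nat) else [::]) else [::].
exists (fun v => (p (code v)).*2.+1), Sg; split=> //.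
  move=> u v [/double_inj uv]; apply: ci.
  by case: (ltngtP (code u) (code v)) => // /plt; rewrite uv ltnn.
move=> s v sM sv; pose n := (pickle (map code s)).*2.+2.
have sc u : u \in s -> (code u < (code v).+1)%N.
  move=> /sv; rewrite ltnS leq_double ltnS leqNgt; apply: contraR; rewrite -ltnNge.
  exact: plt.
have sb : (pickle (map code s) <= bd (code v))%N.
  pose s' := [seq inord (code u) : 'I_(code v).+1 | u <- s].
  have sM' : (size s' <= M)%N by rewrite size_map.
  have -> : map code s = map (@nat_of_ord (code v).+1) (Bseq sM').
    rewrite /= /s' -map_comp.
    by apply: (proj1 (@seq.eq_in_map {classic K} nat code _ s)) => u us /=; rewrite inordK ?sc.
  exact: (leq_bigmax (Bseq sM')).
exists n; split.
- have := bp (code v); rewrite /n; lia.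
- by move=> u E; have := congr1 odd E; rewrite /n /= !odd_double.
- rewrite /n /Sg doubleK pickleK /=.
  by elim: (s) => //= u r ->; rewrite vofK.
Qed.

Section Requirements.
Variables (Q : finType) (q0 : Q) (Bad : forall V : Type, (V -> V -> Q) -> Prop).
Notation word := (seq (letter Q)).
Notation mor := (mor q0 Bad).
Variable g : nat -> nat -> Q.

Lemma requirements (I : Type) (l : list I) (R : I -> (nat -> nat) -> (word -> word) -> Prop) :
  (forall i h F h' F', mor g g h F -> mor g g h' F' -> R i h F -> R i (h \o h') (F \o F')) ->
  (forall i h F, List.In i l -> mor g g h F ->
    exists h' F', mor g g h' F' /\ R i (h \o h') (F \o F')) ->
  forall h F, mor g g h F ->
    exists h' F', mor g g h' F' /\ forall i, List.In i l -> R i (h \o h') (F \o F').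
Proof.
move=> stable; elim: l => [|i l IH] dense h F m.
  by exists id, id; split=> //; apply: mor_id.
have [h1 [F1 [m1 R1]]] := dense i h F (or_introl erefl) m.
have m1' := mor_comp m1 m.
have [|h2 [F2 [m2 R2]]] := IH _ _ _ m1'.
  by move=> j h' F' jl; apply: dense; right.
exists (h1 \o h2), (F1 \o F2); split=> [|j [<-|jl]]; first exact: mor_comp m2 m1.
  exact: (stable i _ _ h2 F2 m1' m2 R1).
exact: R2.
Qed.

Lemma morn_source n b b' h F : (forall i j, (i < n)%N -> (j < n)%N -> b i j = b' i j) ->
  morn q0 Bad n b g h F -> morn q0 Bad n b' g h F.
Proof.
move=> bb [s p v a]; have wE i : (i < n)%N -> wd b i = wd b' i.
  move=> ni; apply: (@eq_from_nth _ (a0 q0)); rewrite !size_wd // => j ji.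
  by rewrite !nth_wd // !bb // (ltn_trans ji).
split=> // [i ni|i W C x ni sx al]; first by rewrite -wE // -bb //; apply: v.
apply: a => //; apply: (@allowed_emb _ _ _ _ _ _ _ _ _ _ _ _ _ id) al => // j k ji ki.
by rewrite bb // (ltn_trans _ ni).
Qed.

End Requirements.

Section Universal.
Variables (L : language) (F : set (structure L)) (K : structure L).
Hypothesis finL : finite_set [set: L].
Hypothesis ar2 : forall s : L, (arity s <= 2)%N.
Hypothesis finF : finite_set F.
Hypothesis FP : forall A, F A -> finite_structure A /\ irreducible A.
Hypothesis fr : fraisse_limit (Forb F) K.

Section Data.
Variables (nL : nat) (idx : L -> 'I_nL).
Hypothesis idx_inj : injective idx.
Variable M0 : nat.
Notation M := M0.+1.
Hypothesis F_enum : forall B, F B ->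
  exists s : seq {classic B}, [/\ uniq s, forall b, b \in s & (size s <= M)%N].
Variables (pos : K -> nat) (Sg : nat -> seq {classic K}).
Hypothesis pos_inj : injective pos.
Hypothesis Sg_ex : forall (s : seq {classic K}) v, (size s <= M)%N ->
  (forall u, u \in s -> (pos u <= pos v)%N) ->
  exists n, [/\ (n < pos v)%N, forall u, pos u <> n & Sg n = s].
Hypothesis Sg0 : Sg 0 = [::].

Let F_irr B : F B -> irreducible B. Proof. by case/FP. Qed.
Let F_K B : F B -> ~ embeds B K.
Proof. by move=> FB; have [fB _] := FP FB; apply: (limit_age fr). Qed.

Notation enr := (enr nL M0).
Notation enr0 := (enr0 nL M0).
Notation bad := (bad idx F (M0 := M0)).
Notation deco := (deco idx M0 pos Sg).
Notation eK := (@eK L nL idx K).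
Notation word := (seq (letter enr)).
Notation term := (term nL M0).
Notation eterm := (@eterm nL M0).
Notation lev := (@lev L nL idx F K M0 pos Sg).
Notation elev := (@elev L nL idx F K M0 pos Sg).
Notation nev := (@nev L nL idx F K M0 pos Sg).
Notation evs := (@evs L nL idx F K M0 pos Sg).
Notation ht := (@ht L nL idx F K M0 pos Sg).
Notation env := (@env L nL idx F K M0 pos Sg).
Notation env_map := (@env_map L nL idx F K M0 pos Sg).
Notation mor := (mor enr0 bad).
Notation morn := (morn enr0 bad).
Notation k1 := M0.+2.

Definition sym : finType := (term * term + term * enr)%type.
Definition big_exp_lang : language :=
  @Language sym (fun=> (k1 + k1).+1) (fun=> ltn0Sn _).

Let fst_ V (t : ((k1 + k1).+1).-tuple V) (a : 'I_k1) := tnth t (inord a).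
Let snd_ V (t : ((k1 + k1).+1).-tuple V) (a : 'I_k1) := tnth t (inord (k1 + a)).

Definition big_exp_rel (s : sym) (t : ((k1 + k1).+1).-tuple K) : Prop :=
  match s with
  | inl p => (lev p.1 (fst_ t) < lev p.2 (snd_ t))%N
  | inr p => deco (lev p.1 (fst_ t)) (pos (tnth t ord_max)) = p.2
  end.

Definition big_exp : interp (lang_sum L big_exp_lang) K := fun s =>
  match s with
  | inl s => @rel_of L K s
  | inr s => [set t | big_exp_rel s t]
  end.

Lemma similar_exp n (f g : 'I_n -> K) : injective f -> injective g ->
  pullback f big_exp = pullback g big_exp -> similar idx F M0 pos Sg f g.
Proof.
move=> fi gi E.
have Es (s : lang_sum L big_exp_lang) (t : (arity s).-tuple 'I_n) :
  pullback f big_exp t <-> pullback g big_exp t by rewrite E.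
pose tup (t t' : eterm n) (a : 'I_n) : ((k1 + k1).+1).-tuple 'I_n :=
  [tuple if (i < k1)%N then t.2 (inord i) else
     if (i < k1 + k1)%N then t'.2 (inord (i - k1)) else a | i < (k1 + k1).+1].
have t1 (k : 'I_n -> K) t t' a : fst_ (map_tuple k (tup t t' a)) = k \o t.2.
  apply/funext => i; rewrite /fst_ tnth_map tnth_mktuple inordK; last by have := ltn_ord i; lia.
  by rewrite ltn_ord inord_val.
have t2 (k : 'I_n -> K) t t' a : snd_ (map_tuple k (tup t t' a)) = k \o t'.2.
  apply/funext => i; rewrite /snd_ tnth_map tnth_mktuple inordK; last by have := ltn_ord i; lia.
  by rewrite ltnNge leq_addr /= ltn_add2l ltn_ord addKn inord_val.
have t3 (k : 'I_n -> K) t t' a : tnth (map_tuple k (tup t t' a)) ord_max = k a.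
  by rewrite tnth_map tnth_mktuple /= ltnNge leq_addr /= ltnn.
split.
- move=> t t'; have := Es (inr (inl (t.1, t'.1))) (tup t t' (t.2 ord0)).
  rewrite /pullback /= !t1 !t2 => -[H1 H2].
  by apply/idP/idP.
- move=> t a; have := Es (inr (inr (t.1, deco (elev g t) (pos (g a))))) (tup t t a).
  rewrite /pullback /= !t1 !t3 => -[_ H].
  exact: H.
- move=> a a'; rewrite /(eK) -(eof_pullback idx (@rel_of L K) a a' fi).
  rewrite -(eof_pullback idx (@rel_of L K) a a' gi); congr (eof idx _ a a').
  apply: functional_extensionality_dep => s.
  exact: (congr1 (fun I : interp (lang_sum L big_exp_lang) _ => I (inl s)) E).
Qed.

Variables (g : nat -> nat -> enr) (gen : generic enr0 bad g).

Let Pg k := exists q, g k k = inl q.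
Let eg x y := proj (g x y).

Let seg_forb n : Forb F (segment idx Pg eg n).
Proof.
split; first exact: segment_finite.
move=> B FB [f]; have [_ fE] := embP f; have [vg _] := gen.
have E : @rel_of L B = mk idx (fun x y => eg (sval (f x)) (sval (f y))).
  by rewrite -fE /= -mk_pullback.
apply: (vg n B (fun b => sval (f b))).
- move=> b b' ff; apply: (embP f).1; case: (f b) (f b') ff => x hx [y hy] /= xy; subst y.
  by congr exist; apply: Prop_irrelevance.
- by move=> b; case: (f b) => x [].
- move=> x y xy; have := irreducible_mk (F_irr FB) E xy; rewrite /eg.
  by case=> H; [left|right] => Z; apply: H; rewrite Z.
- left; split; first by move=> b; case: (f b) => x [].
  by exists B; split=> //; exists id; split.
Qed.

Variables (k0 : nat -> nat) (F0 : word -> word) (m0 : mor deco g k0 F0).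

Definition test := {A : structure L & {r : nat & emb A K -> 'I_r}}.

Lemma universal_data (ts : seq test) :
  (forall x, List.In x ts -> finite_structure (projT1 x)) ->
  exists eta : emb K K, forall x, List.In x ts -> forall f f' : emb (projT1 x) K,
    pullback f big_exp = pullback f' big_exp ->
    projT2 (projT2 x) (emb_comp eta f) = projT2 (projT2 x) (emb_comp eta f').
Proof.
move=> fin_ts.
have [io [io1 io2 io3]] := embed_segments fr ar2 seg_forb.
have Pk h Fh v : mor deco g h Fh -> Pg (h (pos v)).
  by move=> m; exists (eK v v); rewrite (morn_rel (m (pos v).+1)) // decoLL.
have etaP h Fh : mor deco g h Fh -> exists eta : emb K K, forall v, io (h (pos v)) = Some (eta v).
  move=> m; have /choice[e eP] : forall v, exists u, io (h (pos v)) = Some u.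
    by move=> v; have := io1 _ (Pk h Fh v m); case: (io _) => // u _; exists u.
  have ee : is_embedding e.
    split=> [u v uv|].
      have := io2 _ _ (e u) (Pk h Fh u m) (Pk h Fh v m) (eP u); rewrite uv => /(_ (eP v)) hh.
      apply: pos_inj; have := @morn_lt _ _ _ _ _ _ _ _ (m (maxn (pos u) (pos v)).+1).
      move=> lt; case: (ltngtP (pos u) (pos v)) => // H.
        by have := lt (pos u) (pos v); rewrite hh ltnn H /=; lia.
      by have := lt (pos v) (pos u); rewrite hh ltnn H /=; lia.
    rewrite (io3 _ (fun v => h (pos v)) e (fun v => Pk h Fh v m) eP).
    rewrite -[RHS](mk_eof idx_inj ar2); congr mk; apply/funext => u; apply/funext => v.
    by rewrite /eg (morn_rel (m (maxn (pos u) (pos v)).+1)) ?ltnS ?leq_maxl ?leq_maxr // decoLL.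
  by exists (Emb ee).
pose R (x : test) (h : nat -> nat) (F1 : word -> word) :=
  forall h1 F2 (eta : emb K K), mor deco g h1 F2 ->
    (forall v, io (h (h1 (pos v))) = Some (eta v)) ->
    forall f f' : emb (projT1 x) K, pullback f big_exp = pullback f' big_exp ->
    projT2 (projT2 x) (emb_comp eta f) = projT2 (projT2 x) (emb_comp eta f').
suff [h [F1 [m RR]]] : exists h F1, mor g g h F1 /\ forall x, List.In x ts -> R x h F1.
  have [eta eP] := etaP _ _ (mor_comp m0 m).
  exists eta => x xts f f' E; exact: (RR x xts _ _ eta m0 eP f f' E).
have stable x h F1 h' F' : mor g g h F1 -> mor g g h' F' -> R x h F1 -> R x (h \o h') (F1 \o F').
  by move=> _ m' Rx h1 F2 eta m1 eP; apply: (Rx (h' \o h1) (F' \o F2)) eP; apply: mor_comp m1 m'.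
suff dense x h F1 : List.In x ts -> mor g g h F1 ->
    exists h' F', mor g g h' F' /\ R x (h \o h') (F1 \o F').
  by have [h' [F' [m' R']]] := requirements stable dense (mor_id enr0 bad g); exists h', F'.
move=> xts mh; case: x xts (fin_ts x xts) => A [r chi] xts /= fA.
have [n [u [v [uK vK]]]] := finite_bij fA.
have fu_inj (f : emb A K) : injective (f \o u).
  by apply: inj_comp; [case: (embP f)|exact: can_inj uK].
pose CT : finType := ({ffun eterm n * eterm n -> bool} * {ffun eterm n * 'I_n -> enr} *
    {ffun 'I_n * 'I_n -> brel nL})%type.
pose code (f : emb A K) : CT :=
  ([ffun p => (elev (f \o u) p.1 < elev (f \o u) p.2)%N],
   [ffun p => deco (elev (f \o u) p.1) (pos (f (u p.2)))],
   [ffun p => eK (f (u p.1)) (f (u p.2))]).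
have codeS f f' : code f = code f' -> similar idx F M0 pos Sg (f \o u) (f' \o u).
  move=> [/ffunP c1 /ffunP c2 /ffunP c3]; split=> [t t'|t a|a a'].
  - by have := c1 (t, t'); rewrite !ffunE.
  - by have := c2 (t, a); rewrite !ffunE.
  - by have := c3 (a, a'); rewrite !ffunE.
have codeE (f f' : emb A K) : pullback f big_exp = pullback f' big_exp -> code f = code f'.
  move=> E; have [] := @similar_exp n (f \o u) (f' \o u) (fu_inj f) (fu_inj f').
    by rewrite (pullback_comp u f big_exp) (pullback_comp u f' big_exp) E.
  by move=> s1 s2 s3; congr (_, _, _); apply/ffunP => p; rewrite !ffunE ?s1 ?s2 ?s3.
pose R1 th (h : nat -> nat) (F1 : word -> word) := forall h1 F2 (eta : emb K K),
    mor deco g h1 F2 -> (forall v, io (h (h1 (pos v))) = Some (eta v)) ->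
    forall f f' : emb A K, code f = th -> code f' = th ->
    chi (emb_comp eta f) = chi (emb_comp eta f').
have stable1 x h2 F2 h' F' : mor g g h2 F2 -> mor g g h' F' -> R1 x h2 F2 ->
    R1 x (h2 \o h') (F2 \o F').
  by move=> _ m' Rx h1 F3 eta m1 eP; apply: (Rx (h' \o h1) (F' \o F3)) eP; apply: mor_comp m1 m'.
suff dense th h2 F2 : List.In th (enum CT) -> mor g g h2 F2 ->
    exists h3 F3, mor g g h3 F3 /\ R1 th (h2 \o h3) (F2 \o F3).
  have [h' [F' [m' R']]] := @requirements enr enr0 bad g CT (enum CT) R1 stable1 dense h F1 mh.
  exists h', F'; split=> // h1 F2 eta m1 eP f f' /codeE cE.
  apply: (R' (code f) _ h1 F2 eta m1 eP) => //.
  have : code f \in enum CT by rewrite mem_enum.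
  by elim: (enum CT) => //= c l IH; rewrite inE => /orP[/eqP->|/IH]; [left|right].
move=> _ m2; have [[f0 cf0]|no] := pselect (exists f0, code f0 = th); last first.
  exists id, id; split; first exact: mor_id.
  by move=> h1 F3 eta _ _ f f' cf; case: no; exists f.
pose N := nev (f0 \o u); pose p a := index (pos (f0 (u a))) (evs (f0 \o u)).
have vb : valid enr0 bad (env (f0 \o u)).
  exact: (env_valid idx_inj ar2 F_K pos_inj).
pose S (h : nat -> nat) : set (emb A K) :=
  [set e | forall a, io (h2 (h (p a))) = Some (e (u a))].
pose c (h : nat -> nat) (F3 : word -> word) := chi (xget f0 (S h)).
have pN a : (p a < N)%N by rewrite -[N]/(size (evs (f0 \o u))) index_mem (pos_evs _ _ _ _ _ (f0 \o u)).
have cext : extl N c.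
  move=> h3 F3 h4 F4 [hh _]; rewrite /c; congr (chi (xget f0 _)).
  by apply/seteqP; split=> e eS a; have := eS a; rewrite hh.
have [h3 [F3 [m3 H3]]] := morphism_ramsey gen vb cext.
exists h3, F3; split=> // h1 F4 eta m1 eP f f' cf cf'.
have key (e : emb A K) : code e = th ->
    morn N (env (f0 \o u)) g (h1 \o ht (e \o u)) (F4 \o env_map (e \o u)) /\
    chi (emb_comp eta e) = c (h3 \o (h1 \o ht (e \o u))) (F3 \o (F4 \o env_map (e \o u))).
  move=> ce; have sim := codeS f0 e (etrans cf0 (esym ce)).
  split.
    have me := env_mor idx_inj ar2 F_enum F_irr F_K pos_inj Sg_ex Sg0 (e \o u).
    have NE : N = nev (e \o u) by apply: (similar_nev sim).
    have := morn_comp me m1; rewrite -NE; apply: morn_source => i j iN jN.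
    apply: esym; exact: (similar_env idx_inj ar2 F_enum F_irr F_K pos_inj Sg_ex sim iN jN).
  have Se : S (h3 \o (h1 \o ht (e \o u))) (emb_comp eta e).
    move=> a; rewrite /= -(eP (e (u a))) /=; congr (io (h2 (h3 (h1 _)))).
    have -> : p a = index (pos (e (u a))) (evs (e \o u)) by apply: (similar_pos sim).
    by rewrite ht_index // (pos_evs _ _ _ _ _ (e \o u)).
  rewrite /c; case: xgetP => [e' _ Se'|/(_ _ Se)//]; congr chi.
  apply: emb_ext => x; rewrite -(vK x).
  by have := Se (v x); rewrite (Se' (v x)) => -[].
have [mf ->] := key f cf; have [mf' ->] := key f' cf'.
exact: H3.
Qed.

End Data.

Theorem universal_expansion : exists M : language, finite_set [set: M] /\
  exists E : interp (lang_sum L M) K, reduct E = @rel_of L K /\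
  forall ts : seq test, (forall x, List.In x ts -> finite_structure (projT1 x)) ->
  exists eta : emb K K, forall x, List.In x ts -> forall f f' : emb (projT1 x) K,
    pullback f E = pullback f' E ->
    projT2 (projT2 x) (emb_comp eta f) = projT2 (projT2 x) (emb_comp eta f').
Proof.
have [nL [r0 [idx [_ idxK]]]] := finite_bij finL.
have idx_inj : injective idx by exact: can_inj idxK.
have /choice[nB nBP] : forall B : structure L, exists n, F B ->
    exists s : seq {classic B}, [/\ uniq s, forall b, b \in s & size s = n].
  move=> B; have [FB|nF] := pselect (F B); last by exists 0.
  have [fB _] := FP FB; have /finite_enum[s [us sT]] := fB.
  by exists (size s) => _; exists s.
have [M0 FM] : exists M0, forall B, F B -> (nB B <= M0.+1)%N.
  have [sF FE] := (@finite_seqP {classic (structure L)} F).1 finF.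
  exists (\sum_(B <- sF) nB B)%N => B FB.
  have BF : (B : {classic (structure L)}) \in sF by move: FB; rewrite FE.
  by rewrite (big_rem _ BF) /= leqW // leq_addr.
have F_enum B : F B -> exists s : seq {classic B}, [/\ uniq s, forall b, b \in s & (size s <= M0.+1)%N].
  by move=> FB; have [s [us sT sn]] := nBP B FB; exists s; split=> //; rewrite sn; apply: FM.
have [/countable_injP[code codeI] _ _] := fr.
have code_inj : injective code by move=> x y; apply: codeI; rewrite inE.
have [pos [Sg [pos_inj Sg0 Sg_ex]]] := positions M0.+1 code_inj.
have F_irr B : F B -> irreducible B by case/FP.
have F_K B : F B -> ~ embeds B K by move=> FB; have [fB _] := FP FB; apply: (limit_age fr).
have F_inh B : F B -> inhabited B by move=> FB; have [fB _] := FP FB; apply: (limit_inhabited fr).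
have st (V : Type) (e : V -> V -> enr nL M0) := @bad_star L nL idx F M0 F_inh V e.
have [g gen] := generic_exists (enr0 nL M0) st.
have [k0 [F0 m0]] := mor_exists gen (deco_valid idx_inj ar2 F_K pos_inj (Sg := Sg)).
exists (big_exp_lang nL M0); split; first exact: finite_finset.
exists (@big_exp nL idx M0 pos Sg); split=> // ts fts.
exact: (universal_data idx_inj F_enum pos_inj Sg_ex Sg0 gen m0 fts).
Qed.

End Universal.

(** * Existence of a big Ramsey structure *)

Local Open Scope card_scope.

Lemma card_le_image T U (A : set T) (B : set U) (g : U -> T) : A `<=` g @` B -> A #<= B.
Proof. by move=> /subset_card_le /card_le_trans; apply; apply: card_image_le. Qed.

Section Code.
Variable L : language.
Hypothesis finL : finite_set [set: L].

Lemma arity_bound : exists R, forall s : L, (arity s <= R)%N.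
Proof.
have /finite_enum[l [_ lT]] := finL; exists (\sum_(s <- l) arity (s : L))%N => s.
by rewrite (big_rem _ (lT s)) /= leq_addr.
Qed.

Lemma pullback_local R V (I J : interp L V) : (forall s : L, (arity s <= R)%N) ->
  (forall u : 'I_R -> V, pullback u I = pullback u J) -> I = J.
Proof.
move=> aR H; apply: functional_extensionality_dep => s; rewrite predeqE => t.
pose x0 := tnth t (Ordinal (arity_gt0 s)).
pose u (i : 'I_R) := nth x0 t i.
pose t' : (arity s).-tuple 'I_R := [tuple widen_ord (aR s) i | i < arity s].
have E : t = map_tuple u t'.
  apply: eq_from_tnth => i; rewrite tnth_map tnth_mktuple /u /=.
  by rewrite (tnth_nth x0).
by rewrite E; have := congr1 (fun I : interp L _ => I s t') (H u); rewrite /pullback /= => ->.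
Qed.

Lemma interp_code n : exists (C : finType) (code : interp L 'I_n -> C), injective code.
Proof.
have [R aR] := arity_bound; have [m [a [b [_ bK]]]] := finite_bij finL.
pose tp (s : L) (w : {ffun 'I_R -> 'I_n}) : (arity s).-tuple 'I_n :=
  [tuple w (widen_ord (aR s) i) | i < arity s].
exists {ffun 'I_m * {ffun 'I_R -> 'I_n} -> bool}, (fun I =>
  [ffun p => `[< I (a p.1) (tp (a p.1) p.2) >]]) => I J /ffunP E.
apply: functional_extensionality_dep => s; rewrite predeqE => t.
pose x0 := tnth t (Ordinal (arity_gt0 s)).
pose w : {ffun 'I_R -> 'I_n} := [ffun i : 'I_R => nth x0 t i].
have tE : t = tp s w.
  by apply: eq_from_tnth => i; rewrite tnth_mktuple ffunE /= (tnth_nth x0).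
have := E (b s, w); rewrite !ffunE /= bK -tE => H.
by split=> It; apply/asboolP; [rewrite -H|rewrite H]; apply/asboolP.
Qed.

Lemma interp_code_fin V : finite_set [set: V] ->
  exists (C : finType) (code : interp L V -> C), injective code.
Proof.
move=> /finite_bij[n [u [v [uK vK]]]]; have [C [code ci]] := interp_code n.
exists C, (fun I => code (pullback u I)) => I J /ci E.
have vE (I' : interp L V) : I' = pullback v (pullback u I').
  by rewrite -pullback_comp (_ : u \o v = id) ?pullback_id //; apply/funext => x /=; rewrite vK.
by rewrite (vE I) E -vE.
Qed.

End Code.

Section Reduction.
Variables (L M : language) (Kcl : set (structure L)) (K : structure L).
Hypothesis finL : finite_set [set: L].
Hypothesis finM : finite_set [set: M].
Hypothesis Kcl_fin : forall A, Kcl A -> finite_structure A.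
Hypothesis Kcl_emb : forall A, Kcl A -> embeds A K.
Notation LM := (lang_sum L M).
Variable E : interp LM K.
Hypothesis E_reduct : reduct E = @rel_of L K.
Hypothesis E_univ : forall ts : seq (test K),
  (forall x, List.In x ts -> finite_structure (projT1 x)) ->
  exists eta : emb K K, forall x, List.In x ts -> forall f f' : emb (projT1 x) K,
    pullback f E = pullback f' E ->
    projT2 (projT2 x) (emb_comp eta f) = projT2 (projT2 x) (emb_comp eta f').

Lemma finLM : finite_set [set: LM].
Proof.
have -> : [set: LM] = (fun x : L => inl x : LM) @` [set: L] `|` (fun x : M => inr x : LM) @` [set: M].
  by apply/seteqP; split=> // -[x|x] _; [left|right]; exists x.
by rewrite finite_setU; split; apply: finite_image.
Qed.

Definition types (eta : emb K K) (A : structure L) : set (interp LM A) :=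
  [set pullback (emb_comp eta f) E | f in [set: emb A K]].
Arguments types eta A : clear implicits.

Lemma types_comp eta theta A : types (emb_comp eta theta) A `<=` types eta A.
Proof.
move=> _ [f _ <-]; exists (emb_comp theta f) => //.
Qed.

Section Local.
Variables (R : nat) (aR : forall s : LM, (arity s <= R)%N).
Variables (C : finType) (code : interp LM 'I_R -> C).
Hypothesis code_inj : injective code.

Let CC : finType := (C * {ffun 'I_R * 'I_R -> bool})%type.
Let P (f : 'I_R -> K) : CC :=
  (code (pullback f E), [ffun p => `[< f p.1 = f p.2 >]]).

Definition uniform (eta : emb K K) := forall f f' : 'I_R -> K, P f = P f' ->
  pullback (eta \o f) E = pullback (eta \o f') E.

Let graph (eta : emb K K) : {set CC * C} :=
  [set p | `[< exists f : 'I_R -> K, p = (P f, code (pullback (eta \o f) E)) >]].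

Let fam (c : {set CC * C}) (A : structure L) : set (interp LM A) :=
  [set J | exists f : emb A K, forall u : 'I_R -> A, (P (f \o u), code (pullback u J)) \in c].

Lemma uniform_fam eta A : uniform eta -> types eta A = @fam (graph eta) A.
Proof.
move=> un; apply/seteqP; split=> J.
  move=> [f _ <-]; exists f => u; rewrite inE; apply/asboolP; exists (f \o u).
  by rewrite -pullback_comp.
move=> [f fJ]; exists f => //; apply: (pullback_local aR) => u.
have := fJ u; rewrite inE => /asboolP[f' [Pf1 Pf2 cJ]].
apply: code_inj; rewrite cJ; congr code; rewrite -pullback_comp /=.
by apply: (un (f \o u) f'); exact: (congr2 pair Pf1 Pf2).
Qed.

Lemma uniform_exists (eta1 : emb K K) : exists eta : emb K K, uniform (emb_comp eta1 eta).
Proof.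
pose real (th : CC) := exists f : 'I_R -> K, P f = th.
pose S (f : 'I_R -> K) : structure L :=
  @Structure L {x : K | exists i, f i = x} (pullback sval (@rel_of L K)).
have finS f : finite_structure (S f).
  have fP i : exists i', f i' = f i by exists i.
  apply: (@sub_finite_set _ _ [set (exist _ (f i) (fP i) : S f) | i in [set: 'I_R]]).
    case=> x [i fi] _; exists i => //; subst x; congr exist; exact: Prop_irrelevance.
  by apply: finite_image; exact: finite_finset.
pose chi f (e : emb (S f) K) : 'I_#|C| := enum_rank (code (pullback (fun i =>
  eta1 (e (exist _ (f i) (ex_intro _ i erefl)))) E)).
pose tst f : test K := existT _ (S f) (existT _ #|C| (chi f)).
pose ts := pmap (fun th => if pselect (real th) is left H then Some (tst (sval (cid H))) else None)
  (enum CC).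
have In_ts f : exists f0, P f0 = P f /\ List.In (tst f0) ts.
  have rf : real (P f) by exists f.
  have [f0 [Pf0 H0]] : exists f0, P f0 = P f /\
      (if pselect (real (P f)) is left H then Some (tst (sval (cid H))) else None) = Some (tst f0).
    by case: pselect => // H; exists (sval (cid H)); split=> //; case: cid.
  exists f0; split=> //; have : P f \in enum CC by rewrite mem_enum.
  rewrite /ts; elim: (enum CC) => //= th l IH; rewrite inE => /orP[/eqP<-|/IH H].
    by rewrite H0 /=; left.
  by case: pselect => //= ?; right.
have [|eta etaP] := @E_univ ts.
  move=> x; rewrite /ts; elim: (enum CC) => //= th l IH.
  by case: pselect => [H|_] //= [<-|/IH//]; apply: finS.
exists eta => f f' Pff'.
have [f0 [Pf0 f0ts]] := In_ts f.
have ker g x y : P g = P f0 -> (g x = g y) <-> (f0 x = f0 y).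
  move=> [_ /ffunP/(_ (x, y))]; rewrite !ffunE /= => H.
  by split=> e; apply/asboolP; [rewrite -H|rewrite H]; apply/asboolP.
have lift g : P g = P f0 -> exists e : emb (S f0) K,
    (forall i, e (exist _ (f0 i) (ex_intro _ i erefl)) = g i) /\
    pullback e E = pullback sval E.
  move=> Pg; have /choice[e eP] : forall x : S f0, exists y, forall i, f0 i = sval x -> y = g i.
    case=> x [i fi]; exists (g i) => j fj /=; apply/(ker g _ _ Pg); by rewrite fi.
  have eE i : e (exist _ (f0 i) (ex_intro _ i erefl)) = g i by apply: eP.
  have pE : pullback e E = pullback sval E.
    apply: (pullback_local aR) => u.
    have /choice[v vP] : forall i : 'I_R, exists j, f0 j = sval (u i) by move=> i; case: (u i).
    have [/code_inj PE _] := Pg.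
    rewrite -!pullback_comp (_ : e \o u = g \o v); last by apply/funext => i; apply: eP.
    rewrite (_ : sval \o u = f0 \o v); last by apply/funext => i; rewrite /= vP.
    by rewrite (pullback_comp v g E) (pullback_comp v f0 E) PE.
  have ee : is_embedding e.
    split=> [[x [i fi]] [y [j fj]] exy|].
      have aux : forall a b : S f0, sval a = sval b -> a = b.
        by move=> [a ha] [b' hb] /= ab; subst b'; congr exist; apply: Prop_irrelevance.
      have E1 := eP (exist _ x (ex_intro _ i fi)) i fi.
      have E2 := eP (exist _ y (ex_intro _ j fj)) j fj.
      move: exy; rewrite E1 E2 => /(ker g _ _ Pg) fij.
      by apply: aux; rewrite /= -fi -fj fij.
    apply: functional_extensionality_dep => s; rewrite /= -E_reduct.
    exact: (congr1 (fun I : interp LM _ => I (inl s)) pE).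
  by exists (Emb ee).
have [e [e1 e2]] := lift f (esym Pf0).
have [e' [e1' e2']] := lift f' (esym (etrans Pf0 Pff')).
have := etaP _ f0ts e e' (etrans e2 (esym e2')).
rewrite /= /chi => /enum_rank_inj /code_inj.
rewrite (_ : (fun i => _) = eta1 \o (eta \o f)).
  rewrite (_ : (fun i => _) = eta1 \o (eta \o f')) //.
  by apply/funext => i /=; rewrite e1'.
by apply/funext => i /=; rewrite e1.
Qed.

Lemma stable_types : exists eta0 : emb K K, forall (eta : emb K K) A,
  types (emb_comp eta0 eta) A = types eta0 A.
Proof.
pose N (eta : emb K K) := #|[set c : {set CC * C} | `[< forall A, @fam c A `<=` types eta A >]]%SET|.
have Nle eta theta : (forall A, types eta A `<=` types theta A) -> (N eta <= N theta)%N.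
  move=> H; apply: subset_leq_card; apply/fintype.subsetP => c; rewrite !inE => /asboolP Hc.
  by apply/asboolP => A; apply: subset_trans (Hc A) (H A).
have exN : exists n, `[< exists eta, N eta = n >] by exists (N (emb_id K)); apply/asboolP; exists (emb_id K).
have [eta1 minN] : exists eta1, forall eta, (N eta1 <= N eta)%N.
  case: (ex_minnP exN) => n /asboolP[eta1 <-] H; exists eta1 => eta.
  by apply: H; apply/asboolP; exists eta.
have [theta un] := uniform_exists eta1.
pose eta0 := emb_comp eta1 theta.
have min0 eta : (N eta0 <= N eta)%N.
  by apply: leq_trans (minN eta); apply: Nle => A; apply: types_comp.
exists eta0 => eta A; apply/seteqP; split; first exact: types_comp.
have sub : [set c | `[< forall A, @fam c A `<=` types (emb_comp eta0 eta) A >]]%SET =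
    [set c | `[< forall A, @fam c A `<=` types eta0 A >]]%SET.
  apply/eqP; rewrite eqEcard; apply/andP; split; last exact: min0.
  apply/fintype.subsetP => c; rewrite !inE => /asboolP Hc; apply/asboolP => B.
  by apply: subset_trans (Hc B) _; apply: types_comp.
have : graph eta0 \in [set c | `[< forall A, @fam c A `<=` types eta0 A >]]%SET.
  by rewrite inE; apply/asboolP => B; rewrite uniform_fam.
by rewrite -sub inE => /asboolP/(_ A); rewrite -uniform_fam.
Qed.

End Local.

Theorem big_ramsey_exists : exists K' : interp LM K, big_ramsey_structure Kcl K'.
Proof.
have [R aR] := arity_bound finLM; have [C [code ci]] := interp_code finLM R.
have [eta0 stab] := stable_types aR ci.
pose K' : interp LM K := pullback eta0 E.
have K'r : reduct K' = @rel_of L K.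
  rewrite -[RHS](embP eta0).2 -E_reduct.
  by apply: functional_extensionality_dep.
have exE A : expansions K' A = types eta0 A.
  apply/seteqP; split=> I.
    move=> [rI [e]]; have [ei eE] := embP e.
    have fe : is_embedding (e : A -> K).
      split=> //; rewrite -rI -K'r; apply: functional_extensionality_dep => s.
      exact: (congr1 (fun I : interp LM _ => I (inl s)) eE).
    by exists (Emb fe) => //; rewrite -[RHS]eE /= /K' -pullback_comp.
  move=> [f _ <-]; split.
    have pc : pullback (emb_comp eta0 f) E = pullback f K' := pullback_comp f eta0 E.
    rewrite pc -[RHS](embP f).2 -K'r; exact: functional_extensionality_dep.
  constructor; apply: (@Emb LM (Structure _) (Structure K') f).
  by split; [case: (embP f)|rewrite /= /K' -pullback_comp].
have fin A : Kcl A -> finite_set (types eta0 A).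
  move=> KA; have [D [cd cdi]] := interp_code_fin finLM (Kcl_fin KA).
  have [f0] := Kcl_emb KA.
  apply: (@card_le_finite _ _ _ [set: D]); last exact: finite_finset.
  apply: (@card_le_image _ _ _ _ (fun c => xget (pullback (emb_comp eta0 f0) E) [set I | cd I = c])).
  by move=> I _; exists (cd I) => //; case: xgetP => [J _ /cdi//|/(_ I)[]].
exists K'; split=> //.
- by move=> A KA; rewrite exE; apply: fin.
- move=> A KA; rewrite exE; have [n nE] := fin A KA; exists n => //.
  have /andP[nle nge] : (types eta0 A #<= `I_n) && (`I_n #<= types eta0 A) by rewrite -card_eq_le.
  have [f0] := Kcl_emb KA.
  split=> [r chi|m bm].
    have [|eta etaP] := @E_univ [:: existT _ A (existT _ r chi)].
      by move=> x [<-|//]; apply: Kcl_fin.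
    have {}etaP := etaP _ (or_introl erefl); rewrite /= in etaP.
    exists (emb_comp eta eta0).
    apply: card_le_trans nle.
    apply: (@card_le_image _ _ _ _ (fun I => chi (emb_comp eta (emb_comp eta0
      (xget f0 [set f | pullback (emb_comp eta0 f) E = I]))))).
    move=> _ [_ [f _ <-] <-]; exists (pullback (emb_comp eta0 f) E); first by exists f.
    have -> : emb_comp (emb_comp eta eta0) f = emb_comp eta (emb_comp eta0 f) by apply: emb_ext.
    by apply: etaP; case: xgetP => [f' _ //|/(_ f)[]].
  have [D [cd cdi]] := interp_code_fin finLM (Kcl_fin KA).
  pose chi (f : emb A K) : 'I_#|D| := enum_rank (cd (pullback (emb_comp eta0 f) E)).
  have [eta etaP] := bm _ chi.
  rewrite -card_le_II; apply: card_le_trans etaP; apply: card_le_trans nge _.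
  rewrite -(stab eta A).
  apply: (@card_le_image _ _ _ _ (fun c => xget (pullback (emb_comp eta0 f0) E)
    [set I | enum_rank (cd I) = c])).
  move=> _ [f _ <-]; exists (chi (emb_comp eta f)).
    by exists (emb_comp eta f) => //; exists f.
  case: xgetP => [I _ /enum_rank_inj/cdi -> //|/(_ (pullback (emb_comp eta0 (emb_comp eta f)) E))[]//].
- move=> A KA eta; rewrite exE -(stab eta A) (_ : [set _ | _ in _] = types (emb_comp eta0 eta) A).
    exact: card_eqxx.
  by apply/seteqP; split=> _ [f _ <-]; exists f => //; rewrite /K' -pullback_comp.
Qed.

End Reduction.

Section Codes.
Variables (T : Type) (C : finType) (code : T -> C).

Definition codes (A : set T) : {set C} := [set c | `[< exists2 x, A x & code x = c >]]%SET.

Lemma in_codes A c : c \in codes A <-> exists2 x, A x & code x = c.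
Proof. by rewrite inE; split=> /asboolP. Qed.

Lemma card_codes (A : set T) n : {in A &, injective code} -> A #= `I_n -> #|codes A| = n.
Proof.
move=> ci /card_set_bijP[f [f1 f2 f3]].
have /choice[r rP] : forall i : 'I_n, exists x, A x /\ f x = i.
  by move=> i; have [x Ax fx] := f3 i (ltn_ord i); exists x.
have ri : injective (code \o r).
  move=> i j /= rr; apply: ord_inj; have [A1 <-] := rP i; have [A2 <-] := rP j.
  by congr f; apply: ci; rewrite ?inE.
have -> : codes A = (code \o r) @: [set: 'I_n]%SET.
  apply/setP => c; apply/idP/imsetP => [/in_codes[x Ax <-]|[i _ ->]].
    have fx : (f x < n)%N by exact: f1.
    exists (Ordinal fx) => //; have [Ar fr] := rP (Ordinal fx).
    have E : x = r (Ordinal fx) by apply: f2; rewrite ?inE.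
    by rewrite /= -E.
  by apply/in_codes; exists (r i) => //; case: (rP i).
by rewrite card_imset // cardsT card_ord.
Qed.

End Codes.

Lemma expansions_pullback (L M : language) (K A : structure L) (K' : interp (lang_sum L M) K) :
  reduct K' = @rel_of L K ->
  expansions K' A = [set pullback f K' | f in [set: emb A K]].
Proof.
move=> K'r; apply/seteqP; split=> I.
  move=> [rI [e]]; have [ei eE] := embP e.
  have fe : is_embedding (e : A -> K).
    split=> //; rewrite -rI -K'r; apply: functional_extensionality_dep => s.
    exact: (congr1 (fun I : interp (lang_sum L M) _ => I (inl s)) eE).
  by exists (Emb fe).
move=> [f _ <-]; split.
  rewrite -[RHS](embP f).2 -K'r; exact: functional_extensionality_dep.
by constructor; apply: (@Emb _ (Structure _) (Structure K') f); split; [case: (embP f)|].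
Qed.

Section Colors.
Variables (L M : language) (F : set (structure L)) (K : structure L).
Hypothesis finL : finite_set [set: L].
Hypothesis finM : finite_set [set: M].
Hypothesis fr : fraisse_limit (Forb F) K.
Notation LM := (lang_sum L M).
Variable K' : interp LM K.
Hypothesis br : big_ramsey_structure (Forb F) K'.

Definition exps (A : structure L) : set (interp LM A) :=
  [set pullback f K' | f in [set: emb A K]].
Arguments exps A : clear implicits.

Lemma exps_code (A : structure L) : finite_structure A -> exists (C : finType) (code : interp LM A -> C), injective code.
Proof. exact: (interp_code_fin (finLM finL finM)). Qed.

Lemma emb_forb (A : structure L) : finite_structure A -> emb A K -> Forb F A.
Proof. by move=> fA f; have [_ age _] := fr; apply/(age A fA). Qed.

(* A finite set has no proper subset of the same cardinality. *)
Lemma exps_stable (A : structure L) (eta : emb K K) : finite_structure A ->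
  [set pullback (emb_comp eta f) K' | f in [set: emb A K]] = exps A.
Proof.
move=> fA; apply/seteqP; split=> [_ [f _ <-]|I]; first by exists (emb_comp eta f).
move=> /[dup] EI [f0 _ _]; have FA := emb_forb fA f0.
have [C [code ci]] := exps_code fA; have [K'r efin _ est] := br.
have cin (B : set (interp LM A)) : {in B &, injective code} by move=> x y _ _; exact: ci.
have := est A FA eta; have [n nE] := efin A FA; have nE' := nE.
move: nE'; rewrite expansions_pullback // -/(exps A) => nE' /card_eq_trans/(_ nE') bE.
set B := [set _ | _ in _] in bE *.
have BE : B `<=` exps A by move=> _ [f _ <-]; exists (emb_comp eta f).
have cBE : codes code B = codes code (exps A).
  apply/eqP; rewrite eqEcard (card_codes (cin _) nE') (card_codes (cin _) bE) leqnn andbT.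
  by apply/fintype.subsetP => c /in_codes[x /BE Ex <-]; apply/in_codes; exists x.
have : code I \in codes code (exps A) by apply/in_codes; exists I.
by rewrite -cBE => /in_codes[J BJ /ci <-].
Qed.

(* The pair of a color and of a type takes, after composition, at most as many
   values as the type alone, so the color is a function of the type. *)
Lemma color_types (A : structure L) r (chi : emb A K -> 'I_r) (eta1 : emb K K) : finite_structure A ->
  exists eta2 : emb K K, forall h h' : emb A K,
    pullback (emb_comp eta1 (emb_comp eta2 h)) K' = pullback (emb_comp eta1 (emb_comp eta2 h')) K' ->
    chi (emb_comp eta1 (emb_comp eta2 h)) = chi (emb_comp eta1 (emb_comp eta2 h')).
Proof.
move=> fA; have [[f0]|nof] := pselect (inhabited (emb A K)); last first.
  by exists (emb_id K) => h; case: nof; constructor.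
have FA := emb_forb fA f0; have [C [code ci]] := exps_code fA.
have [K'r _ deg _] := br; have [n nE [bd _]] := deg A FA.
move: nE; rewrite expansions_pullback // -/(exps A) => nE.
pose P : finType := ('I_r * C)%type.
pose chi2 (h : emb A K) : 'I_#|P| :=
  enum_rank (chi (emb_comp eta1 h), code (pullback (emb_comp eta1 h) K')).
have [eta2] := bd _ chi2; set S := [set _ | _ in _] => Sn; exists eta2.
have [m mE] : finite_set S by apply: finite_finset.
have mn : (m <= n)%N.
  by rewrite -card_le_II; apply: card_le_trans Sn; move: mE; rewrite card_eq_le => /andP[].
have Sm : #|codes id S| = m by apply: card_codes => // x y _ _.
pose pr (x : 'I_#|P|) : C := (enum_val x).2.
have prE : pr @: codes id S = codes code (exps A).
  apply/setP => c; apply/idP/idP => [/imsetP[x /in_codes[y Sy <-] ->]|/in_codes[I + <-]].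
    apply/in_codes; case: Sy => _ [h _ <-] <-; exists (pullback (emb_comp eta1 (emb_comp eta2 h)) K').
      by exists (emb_comp eta1 (emb_comp eta2 h)).
    by rewrite /pr /chi2 enum_rankK.
  rewrite -(exps_stable (emb_comp eta1 eta2) fA) => -[h _ <-].
  apply/imsetP; exists (chi2 (emb_comp eta2 h)).
    by apply/in_codes; exists (chi2 (emb_comp eta2 h)) => //; exists (emb_comp eta2 h) => //; exists h.
  by rewrite /pr /chi2 enum_rankK.
have : {in codes id S &, injective pr}.
  apply/imset_injP; rewrite prE Sm (card_codes _ nE); last by move=> x y _ _; exact: ci.
  by rewrite eqn_leq mn andbT -Sm -(card_codes (fun x y _ _ => @ci x y) nE) -prE leq_imset_card.
move=> pri h h' hh; have inS k : chi2 (emb_comp eta2 k) \in codes id S.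
  by apply/in_codes; exists (chi2 (emb_comp eta2 k)) => //; exists (emb_comp eta2 k) => //; exists k.
have := pri _ _ (inS h) (inS h'); rewrite /pr /chi2 !enum_rankK /= hh => /(_ erefl).
by move=> /enum_rank_inj[].
Qed.

Lemma color_types_seq (I : Type) (l : seq I) (A : I -> structure L) (r : I -> nat)
    (chi : forall i, emb (A i) K -> 'I_(r i)) :
  (forall i, finite_structure (A i)) ->
  exists eta : emb K K, forall i, List.In i l -> forall h h' : emb (A i) K,
    pullback (emb_comp eta h) K' = pullback (emb_comp eta h') K' ->
    chi i (emb_comp eta h) = chi i (emb_comp eta h').
Proof.
move=> fA; elim: l => [|i l [eta1 IH]]; first by exists (emb_id K).
have [eta2 H2] := color_types (@chi i) eta1 (fA i).
have cE B (h : emb B K) : emb_comp (emb_comp eta1 eta2) h = emb_comp eta1 (emb_comp eta2 h).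
  exact: emb_ext.
exists (emb_comp eta1 eta2) => j [<-|jl] h h'; rewrite !cE; first exact: H2.
exact: IH.
Qed.

End Colors.

(** * The flow of expansions *)

Section Topology.

Lemma ultra_value T (G : set_system T) (C : finType) (c : T -> C) : UltraFilter G ->
  exists a, G [set x | c x = a].
Proof.
move=> UG; suff H (s : seq C) : G [set x | c x \in s] -> exists a, G [set x | c x = a].
  by apply: (H (enum C)); apply: filterS filterT => x _ /=; rewrite mem_enum.
elim: s => [|a s IH] Gs.
  by exfalso; apply: (@filter_not_empty _ G _); apply: filterS Gs => x.
have [Ga|Ga] := in_ultra_setVsetC [set x | c x = a] UG; first by exists a.
by apply: IH; apply: filterS2 Gs Ga => x /=; rewrite inE => /orP[/eqP|].
Qed.

Lemma compact_continuous_bij (X Y : topologicalType) (f : X -> Y) :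
  compact [set: X] -> hausdorff_space Y -> continuous f -> bijective f -> homeomorphism f.
Proof.
move=> cX hY cf [g fK gK]; split=> //; exists g; split=> //; apply/continuous_closedP => A cA.
have -> : g @^-1` A = f @` A.
  apply/seteqP; split=> y; first by exists (g y).
  by move=> [x Ax <-]; rewrite /preimage /= fK.
apply: compact_closed => //; apply: continuous_compact.
  exact: continuous_subspaceT.
exact: subclosed_compact cA cX _.
Qed.

Variables (L : language) (A B : structure L).

Lemma nbhs_emb (g : emb A B) x : nbhs g [set h : emb A B | h x = g x].
Proof.
pose P := {ptws A -> discrete_topology {classic B}}.
have H : nbhs (emb_ptws g : P) [set h : P | h x = g x].
  have /cvg_sup/(_ x) H0 : nbhs (emb_ptws g : P) --> (emb_ptws g : P) by exact: cvg_id.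
  apply: H0; apply: open_nbhs_nbhs; split=> //.
  by exists [set g x : discrete_topology {classic B}] => //; exact: discrete_open.
exact: (@initial_continuous _ _ (@emb_ptws L A B) g _ H).
Qed.

Lemma cvg_emb (G : set_system (emb A B)) (FG : Filter G) (g : emb A B) :
  (forall x, G [set h | h x = g x]) -> G --> g.
Proof.
move=> H U; rewrite nbhsE => -[W [openW Wg] WU]; apply: filterS WU _.
case: openW => W' openW' WE; rewrite -WE.
have : (@emb_ptws L A B) @ G --> (emb_ptws g : {ptws A -> discrete_topology {classic B}}).
  apply/cvg_sup => x V; rewrite nbhsE => -[V1 [[V2 openV2 VE] Vg] V1V].
  apply: filterS V1V _; rewrite -VE; apply: filterS (H x) => h /= hx.
  by rewrite /preimage /= /emb_ptws hx; move: Vg; rewrite -VE.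
by apply; apply: open_nbhs_nbhs; split=> //; rewrite -WE in Wg.
Qed.

End Topology.

Definition eventually_list (V : Type) : set_system (seq {classic V}) :=
  [set P | exists l0 : seq {classic V}, forall l, {subset l0 <= l} -> P l].

#[global] Instance eventually_list_filter V : ProperFilter (@eventually_list V).
Proof.
apply: Build_ProperFilter_ex.
  by move=> P [l0 H]; exists l0; apply: H.
split.
- by exists [::].
- move=> P Q [l1 H1] [l2 H2]; exists (l1 ++ l2) => l sub; split.
    by apply: H1 => x xl; apply: sub; rewrite mem_cat xl.
  by apply: H2 => x xl; apply: sub; rewrite mem_cat xl orbT.
- by move=> P Q PQ [l0 H]; exists l0 => l /H /PQ.
Qed.

Section Sub.
Variables (L : language) (K : structure L).

Definition sub (l : seq {classic K}) : structure L :=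
  @Structure L {x : K | (x : {classic K}) \in l} (pullback sval (@rel_of L K)).

Definition inc_fun l : sub l -> K := @sval _ _.

Lemma inc_emb l : is_embedding (@inc_fun l).
Proof.
split=> // -[x hx] [y hy] /= xy; subst y; congr exist; exact: Prop_irrelevance.
Qed.

Definition inc l : emb (sub l) K := Emb (@inc_emb l).

Lemma sub_finite l : finite_structure (sub l).
Proof.
apply/finite_enum; pose T := {x : K | (x : {classic K}) \in l}.
pose s : seq {classic T} := pmap (fun x : {classic K} => if pselect (x \in l) is left H
  then Some (exist _ x H : {classic T}) else None) l.
exists (undup s); split=> [|x]; first exact: undup_uniq.
rewrite mem_undup mem_pmap; apply/mapP; case: x => x H; exists x => //.
case: pselect => // H'; congr (Some _); congr exist; exact: Prop_irrelevance.
Qed.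

Definition map_sub_fun l (f : emb K K) (x : sub l) : sub [seq (f y : {classic K}) | y <- l] :=
  exist _ (f (sval x)) (map_f (fun y : {classic K} => f y : {classic K}) (svalP x)).

Lemma map_sub_emb l (f : emb K K) : is_embedding (@map_sub_fun l f).
Proof.
have [fi fE] := embP f; split.
  by move=> x y /(congr1 sval) /= /fi xy; apply: (inc_emb l).1.
by rewrite -[RHS](inc_emb l).2 -[in RHS]fE -[in LHS](inc_emb _).2 -!pullback_comp.
Qed.

Definition map_sub l f : emb (sub l) _ := Emb (@map_sub_emb l f).

Hypothesis uh : ultrahomogeneous K.

Lemma aut_extend l (f : emb (sub l) K) : exists a : aut K, forall x : sub l, a (sval x) = f x.
Proof.
have [a E] := uh (sub_finite l) (inc l) f.
by exists a => x; rewrite E.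
Qed.

End Sub.

Section SpaceOf.
Variables (L LM : language) (K : structure L) (K' : interp LM K).

(* The orbit closure of [K'], described by its finite types. *)
Definition in_space (z : interp LM K) := forall l : seq {classic K},
  exists f : emb (sub l) K, pullback (inc l) z = pullback f K'.

Definition expansion_space := {z : interp LM K | in_space z}.
HB.instance Definition _ := gen_eqMixin expansion_space.
HB.instance Definition _ := gen_choiceMixin expansion_space.

Definition agree_on (l : seq {classic K}) (z z' : interp LM K) :=
  pullback (inc l) z = pullback (inc l) z'.

Lemma agree_sub l l' z z' : {subset l <= l'} -> agree_on l' z z' -> agree_on l z z'.
Proof.
move=> ll; pose i (x : sub l) : sub l' := exist _ (sval x) (ll _ (svalP x)).
rewrite /agree_on (_ : inc l = inc l' \o i :> (_ -> _)); last exact/funext.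
by rewrite !pullback_comp => ->.
Qed.

Lemma agree_atom (s : LM) (t : (arity s).-tuple K) z z' :
  agree_on (tval t) z z' -> z s t <-> z' s t.
Proof.
move=> E; have tP i : (tnth t i : {classic K}) \in (tval t : seq {classic K}) by apply/tnthP; exists i.
pose t' : (arity s).-tuple (sub (tval t)) := [tuple exist _ (tnth t i) (tP i) | i < arity s].
have tE : t = map_tuple (inc (tval t)) t'.
  by apply: eq_from_tnth => i; rewrite tnth_map tnth_mktuple.
have := congr1 (fun I : interp LM _ => I s t') E.
by rewrite /pullback /= -tE => ->.
Qed.

Lemma agree_all z z' : (forall l, agree_on l z z') -> z = z'.
Proof.
move=> H; apply: functional_extensionality_dep => s; rewrite predeqE => t.
exact: agree_atom.
Qed.

Lemma agree_pullback l z z' (f : emb K K) :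
  agree_on [seq (f x : {classic K}) | x <- l] z z' ->
  agree_on l (pullback f z) (pullback f z').
Proof.
move=> E; rewrite /agree_on -!pullback_comp.
by rewrite (_ : f \o inc l = inc _ \o map_sub l f) // !pullback_comp E.
Qed.

Lemma in_space_pullback (z : interp LM K) (f : emb K K) : in_space z -> in_space (pullback f z).
Proof.
move=> zin l; have [g gE] := zin [seq (f x : {classic K}) | x <- l].
exists (emb_comp g (map_sub l f)); rewrite -pullback_comp.
by rewrite (_ : f \o inc l = inc _ \o map_sub l f) // pullback_comp gE -pullback_comp.
Qed.

Lemma agree_pullback_eq l (z : interp LM K) (f g : emb K K) :
  (forall x : {classic K}, x \in l -> f x = g x) -> agree_on l (pullback f z) (pullback g z).
Proof.
move=> fg; rewrite /agree_on -!pullback_comp; congr (pullback _ z).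
by apply/funext => -[x xl] /=; apply: fg.
Qed.

Definition space_nbhs (z : expansion_space) : set_system expansion_space :=
  [set B | exists l, forall z' : expansion_space, agree_on l (sval z) (sval z') -> B z'].

HB.instance Definition _ := hasNbhs.Build expansion_space space_nbhs.

Let space_nbhs_filter (z : expansion_space) : ProperFilter (nbhs z).
Proof.
apply: Build_ProperFilter_ex; first by move=> B [l H]; exists z; apply: H.
split.
- by exists [::].
- move=> B C [l1 H1] [l2 H2]; exists (l1 ++ l2) => z' E; split.
    by apply: H1; apply: agree_sub E => x; rewrite mem_cat => ->.
  by apply: H2; apply: agree_sub E => x; rewrite mem_cat orbC => ->.
- by move=> B C BC [l H]; exists l => z' /H /BC.
Qed.

Let space_nbhs_singleton (z : expansion_space) B : nbhs z B -> B z.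
Proof. by move=> [l H]; apply: H. Qed.

Let space_nbhs_nbhs (z : expansion_space) B : nbhs z B -> nbhs z (nbhs^~ B).
Proof.
move=> [l H]; exists l => z' E; exists l => z'' E'; apply: H.
by rewrite /agree_on E E'.
Qed.

HB.instance Definition _ := Nbhs_isNbhsTopological.Build expansion_space
  space_nbhs_filter space_nbhs_singleton space_nbhs_nbhs.

Lemma nbhs_agree (z : expansion_space) l : nbhs z [set z' | agree_on l (sval z) (sval z')].
Proof. by exists l. Qed.

Lemma space_hausdorff : hausdorff_space expansion_space.
Proof.
move=> z z' H; have E : sval z = sval z'.
  apply: agree_all => l; have [y [/= zy z'y]] := H _ _ (nbhs_agree z l) (nbhs_agree z' l).
  by rewrite /agree_on zy z'y.
case: z z' E {H} => z hz [z' hz'] /= E; subst z'; congr exist; exact: Prop_irrelevance.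
Qed.

Lemma space_compact : finite_set [set: LM] -> compact [set: expansion_space].
Proof.
move=> finLM; rewrite compact_ultra => G UG _.
pose z : interp LM K := fun s => [set t | G [set y | sval y s t]].
have agr l : G [set y | agree_on l z (sval y)].
  have [C [code ci]] := interp_code_fin finLM (sub_finite l).
  have [a Ga] := ultra_value (fun y : expansion_space => code (pullback (inc l) (sval y))) UG.
  have [y0 y0a] := filter_ex Ga.
  suff E : pullback (inc l) z = pullback (inc l) (sval y0).
    by apply: filterS Ga => y ya; rewrite /agree_on E; apply: ci; rewrite y0a ya.
  apply: functional_extensionality_dep => s; rewrite predeqE => t; rewrite /pullback /=.
  have key y : code (pullback (inc l) (sval y)) = a ->
      sval y s (map_tuple (inc l) t) <-> sval y0 s (map_tuple (inc l) t).
    move=> ya; have /ci E : code (pullback (inc l) (sval y)) = code (pullback (inc l) (sval y0)).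
      by rewrite ya y0a.
    by have := congr1 (fun I : interp LM _ => I s t) E; rewrite /pullback /= => ->.
  split=> [Gt|y0t].
    by have [y [/= yt /key ya]] := filter_ex (filterI Gt Ga); apply/ya.
  by apply: filterS Ga => y /key /= ->.
have zin : in_space z.
  move=> l; have [y yl] := filter_ex (agr l); have [f fE] := svalP y l.
  by exists f; rewrite -fE yl.
exists (exist _ z zin); split=> // B [l H].
by apply: filterS (agr l) => y; apply: H.
Qed.

Definition space_act (z : expansion_space) (f : emb K K) : expansion_space :=
  exist _ (pullback f (sval z)) (in_space_pullback f (svalP z)).

Lemma nbhs_emb_seq (f : emb K K) (l : seq {classic K}) :
  nbhs f [set g : emb K K | forall x : {classic K}, x \in l -> g x = f x].
Proof.
elim: l => [|x l IH]; first by apply: filterS filterT.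
apply: filterS2 IH (nbhs_emb f (x : K)) => g Hl Hx y; rewrite inE => /orP[/eqP->//|].
exact: Hl.
Qed.

Lemma space_act_continuous : continuous (fun p : expansion_space * emb K K => space_act p.1 p.2).
Proof.
move=> [z f] B [l H] /=.
exists ([set z' | agree_on [seq (f x : {classic K}) | x <- l] (sval z) (sval z')],
        [set g : emb K K | forall x : {classic K}, x \in l -> g x = f x]) => /=.
  by split; [exact: nbhs_agree|exact: nbhs_emb_seq].
move=> [z' g] /= [zz' gf]; apply: H => /=.
rewrite /agree_on (agree_pullback zz'); symmetry.
exact: agree_pullback_eq.
Qed.

Lemma space_ext (z z' : expansion_space) : sval z = sval z' -> z = z'.
Proof. by case: z z' => z hz [z' hz'] /= E; subst z'; congr exist; exact: Prop_irrelevance. Qed.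

End SpaceOf.

Section CompletionFlow.
Variables (L M : language) (F : set (structure L)) (K : structure L).
Hypothesis finL : finite_set [set: L].
Hypothesis finM : finite_set [set: M].
Hypothesis fr : fraisse_limit (Forb F) K.
Notation LM := (lang_sum L M).
Variable K' : interp LM K.
Hypothesis br : big_ramsey_structure (Forb F) K'.

Let uh : ultrahomogeneous K. Proof. by case: fr. Qed.

Let X0 := expansion_space K'.
Let act0 (z : X0) (g : aut K) : X0 := space_act z g.

Let act0_continuous : continuous (fun p : X0 * aut K => act0 p.1 p.2).
Proof.
move=> [z a] B [l H] /=.
have na : nbhs a [set b : aut K | forall x : {classic K}, x \in l -> b x = a x].
  exact: (@initial_continuous _ _ (@aut_emb L K) a _ (nbhs_emb_seq a l)).
exists ([set z' | agree_on [seq (a x : {classic K}) | x <- l] (sval z) (sval z')],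
        [set b : aut K | forall x : {classic K}, x \in l -> b x = a x]) => /=.
  by split; [exact: nbhs_agree|].
move=> [z' b] /= [zz' ba]; apply: H => /=.
rewrite /agree_on (agree_pullback zz'); symmetry.
exact: agree_pullback_eq.
Qed.

Let act0_1 z : act0 z 1%g = z.
Proof. by apply: space_ext; exact: pullback_id. Qed.

Let act0_M z g h : act0 z (g * h)%g = act0 (act0 z g) h.
Proof. by apply: space_ext; exact: pullback_comp. Qed.

Definition expansion_flow : flow K := Flow
  (space_compact (K' := K') (finLM finL finM)) (@space_hausdorff _ _ _ K') act0_continuous act0_1 act0_M.

Lemma base_in_space : in_space K' K'.
Proof. by move=> l; exists (inc l). Qed.

Definition base_point : expansion_flow := exist _ K' base_in_space.

Definition expansion_act : expansion_flow -> emb K K -> expansion_flow := @space_act _ _ _ K'.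

Lemma expansion_act_extends : extends_action expansion_act.
Proof.
split=> //; first exact: space_act_continuous.
by move=> z f g; apply: space_ext; exact: pullback_comp.
Qed.

Lemma orbit_agree (eta : emb K K) (z : expansion_flow) l : exists a : aut K,
  agree_on l (sval z) (pullback a (pullback eta K')).
Proof.
have [f fE] := svalP z l.
have : exps K' (pullback f K') by exists f.
rewrite -(exps_stable finL finM fr br eta (sub_finite l)) => -[f' _ f'E].
have [a aE] := aut_extend uh f'; exists a.
rewrite /agree_on fE -f'E -!pullback_comp; congr (pullback _ K').
by apply/funext => x; rewrite /= -aE.
Qed.

Lemma base_completion_point : completion_point base_point.
Proof.
exists expansion_act; first exact: expansion_act_extends.
move=> eta O [z Oz] oO; have [l H] : nbhs z O by apply: open_nbhs_nbhs.
have [a aE] := orbit_agree eta z l.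
exists (act (expansion_act base_point eta) a); split; last by exists a.
exact: H.
Qed.

End CompletionFlow.

Import Order.TTheory GRing.Theory Num.Theory numFieldNormedType.Exports.
Local Open Scope ring_scope.

Section Basis.
Variables (L : language) (K : structure L).

Lemma emb_basis (g : emb K K) U : nbhs g U ->
  exists l : seq {classic K}, forall h : emb K K, (forall x : {classic K}, x \in l -> h x = g x) -> U h.
Proof.
pose G : set_system (emb K K) := [set P | exists l : seq {classic K},
  forall h : emb K K, (forall x : {classic K}, x \in l -> h x = g x) -> P h].
have FG : Filter G.
  split.
  - by exists [::].
  - move=> P P' [l1 H1] [l2 H2]; exists (l1 ++ l2) => h hg; split.
      by apply: H1 => x xl; apply: hg; rewrite mem_cat xl.
    by apply: H2 => x xl; apply: hg; rewrite mem_cat xl orbT.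
  - by move=> P P' PP' [l H]; exists l => h /H /PP'.
suff H : G --> g by move=> /H.
by apply: cvg_emb => x; exists [:: (x : {classic K})] => h; apply; rewrite inE.
Qed.

Lemma aut_basis (g : aut K) U : nbhs g U ->
  exists l : seq {classic K}, forall h : aut K, (forall x : {classic K}, x \in l -> h x = g x) -> U h.
Proof.
rewrite nbhsE => -[W [openW Wg] WU]; case: openW => W' openW' WE.
have [l H] : exists l : seq {classic K}, forall h : emb K K,
    (forall x : {classic K}, x \in l -> h x = aut_emb g x) -> W' h.
  by apply: emb_basis; apply: open_nbhs_nbhs; split=> //; rewrite -WE in Wg.
by exists l => h hg; apply: WU; rewrite -WE; apply: H.
Qed.

End Basis.

Lemma mem_In (T : eqType) (x : T) (s : seq T) : x \in s -> List.In x s.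
Proof. by elim: s => //= y s IH; rewrite inE => /orP[/eqP->|/IH]; [left|right]. Qed.

Lemma fmap_ultra (I T : Type) (p : I -> T) (G : set_system I) : UltraFilter G -> UltraFilter (p @ G).
Proof.
move=> UG; split; first exact: fmap_proper_filter.
move=> H FH GH; apply/seteqP; split=> // A HA.
case: (in_ultra_setVsetC (p @^-1` A) UG) => // GA.
have HnA : H (~` A) := GH _ GA.
by have [x []] := filter_ex (filterI HA HnA).
Qed.

Lemma ultra_cvg (I : Type) (G : set_system I) (X : topologicalType) (p : I -> X) :
  UltraFilter G -> compact [set: X] -> exists x : X, p @ G --> x.
Proof.
move=> UG; rewrite compact_ultra => /(_ (p @ G)) H.
have [x [_ px]] := H (fmap_ultra p UG) filterT; by exists x.
Qed.

Section Universality.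
Variable R : realType.
Variables (L M : language) (F : set (structure L)) (K : structure L).
Hypothesis finL : finite_set [set: L].
Hypothesis finM : finite_set [set: M].
Hypothesis fr : fraisse_limit (Forb F) K.
Notation LM := (lang_sum L M).
Variable K' : interp LM K.
Hypothesis br : big_ramsey_structure (Forb F) K'.
Notation X := (expansion_flow finL finM K').

Let uh : ultrahomogeneous K. Proof. by case: fr. Qed.

Variables (Y : flow K) (y0 : Y) (e : Y -> emb K K -> Y).
Hypothesis eP : extends_action e.
Hypothesis edense : forall eta, dense (orbit_of (e y0 eta)).

Definition observable := {f : Y -> R | continuous f /\ forall y, 0 <= f y <= 1}.

Let obs (f : observable) : Y -> R := sval f.

Let obs_cont (f : observable) : continuous (obs f).
Proof. by have [] := svalP f. Qed.

Let obs_near (f : observable) y (d : R) : 0 < d -> nbhs y [set y' | `|obs f y' - obs f y| < d].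
Proof.
move=> d0; have := @obs_cont f y; move=> /cvgrPdist_lt/(_ d d0).
by apply: filterS => y' /=; rewrite distrC.
Qed.

Let separate (y : Y) (B : set Y) : nbhs y B ->
  exists f : observable, obs f y = 0 /\ forall y', ~ B y' -> obs f y' = 1.
Proof.
move=> By; have nY : normal_space Y by apply: compact_normal; [exact: flow_hausdorff|exact: flow_compact].
have cy : closed [set y] by apply: compact_closed; [exact: flow_hausdorff|exact: compact_set1].
have cB : closed (~` B^°) by apply: open_closedC; exact: open_interior.
have dis : [set y] `&` ~` B^° = set0.
  by apply/seteqP; split=> // y' [-> H]; exact: H.
have /(@uniform_separatorP _ R)[f [cf f01 f0 f1]] := normal_uniform_separator nY cy cB dis.
have fP : continuous f /\ forall y, 0 <= f y <= 1.
  split=> // y'; have := f01 (f y') ltac:(by exists y'); by rewrite /= in_itv.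
exists (exist _ f fP); split; first by apply: f0; exists y.
move=> y' nB; apply: f1; exists y' => // /interior_subset; exact: nB.
Qed.

Let unif (f : observable) : exists l : seq {classic K}, forall y (u : aut K),
  (forall x : {classic K}, x \in l -> u x = x) -> `|obs f (act y u) - obs f y| < 1 / 16.
Proof.
pose P (l : seq {classic K}) (y : Y) := forall u : aut K,
  (forall x : {classic K}, x \in l -> u x = x) -> `|obs f (act y u) - obs f y| < 1 / 16.
suff : \forall l \near @eventually_list K, [set: Y] `<=` P l.
  by move=> /filter_ex[l H]; exists l => y u; apply: H.
have /compact_near_coveringP := @flow_compact _ _ Y; apply.
move=> y _.
have d32 : (0 : R) < 1 / 32 by lra.
have := @act_continuous _ _ Y (y, 1%g) _ (obs_near f (act y 1%g) d32).
rewrite /= act1 => -[[V U] /= [Vy U1] VU].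
have [l H] := aut_basis U1.
exists ([set y' | V y' /\ `|obs f y' - obs f y| < 1 / 32], [set l' | {subset l <= l'}]) => /=.
  split; first by apply: filterI => //; exact: obs_near.
  by exists l.
move=> [y' l'] /= [[Vy' fy'] ll'] u ul.
have /= := VU (y', u) (conj Vy' (H u (fun x xl => ul x (ll' x xl)))).
by move: fy'; rewrite /= !ltr_norml; lra.
Qed.

Let approx (f : observable) (a : emb K K) (l : seq {classic K}) : exists b : aut K,
  (forall x : {classic K}, x \in l -> b x = a x) /\ `|obs f (act y0 b) - obs f (e y0 a)| < 1 / 16.
Proof.
have [ec ea _] := eP; have d16 : (0 : R) < 1 / 16 by lra.
have := ec (y0, a) _ (obs_near f (e y0 a) d16) => /= -[[V U] /= [Vy Ua] VU].
have [l1 H] := emb_basis Ua.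
have [b bE] := aut_extend uh (emb_comp a (inc (l ++ l1))).
have ba x : x \in l ++ l1 -> b x = a x by move=> xl; exact: (bE (exist _ x xl)).
exists b; split=> [x xl|]; first by apply: ba; rewrite mem_cat xl.
rewrite -ea; apply: (VU (y0, aut_emb b)); split=> /=; first exact: nbhs_singleton.
by apply: H => x xl; apply: ba; rewrite mem_cat xl orbT.
Qed.

Let lof (f : observable) : seq {classic K} := sval (cid (unif f)).

Let lofP (f : observable) y (u : aut K) : (forall x : {classic K}, x \in lof f -> u x = x) ->
  `|obs f (act y u) - obs f y| < 1 / 16.
Proof. by rewrite /lof; case: cid => l /=; apply. Qed.

Let ext (l : seq {classic K}) (h : emb (sub l) K) : aut K := sval (cid (aut_extend uh h)).

Let extP l (h : emb (sub l) K) x : ext h (sval x) = h x.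
Proof. by rewrite /ext; case: cid. Qed.

Let near_ext (f : observable) (b : emb K K) :
  `|obs f (act y0 (ext (emb_comp b (inc (lof f))))) - obs f (e y0 b)| < 2 / 16.
Proof.
set c := ext _; have [b' [b'b fb']] := approx f b (lof f).
have cE : c = (b' * (b'^-1 * c))%g by rewrite mulgA mulgV mul1g.
have : `|obs f (act (act y0 b') (b'^-1 * c)%g) - obs f (act y0 b')| < 1 / 16.
  apply: lofP => x xl.
  have cx : c x = b' x by rewrite b'b //; exact: (extP (emb_comp b (inc (lof f))) (exist _ x xl)).
  have : (b'^-1 * b')%g x = x by rewrite mulVg.
  by rewrite /= cx.
by rewrite -actM -cE; move: fb'; rewrite !ltr_norml; lra.
Qed.

Let chi (f : observable) (h : emb (sub (lof f)) K) : 'I_17 :=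
  inord (Num.truncn (16 * obs f (act y0 (ext h)))).

Let chi_near (f : observable) (h h' : emb (sub (lof f)) K) : chi h = chi h' ->
  `|obs f (act y0 (ext h)) - obs f (act y0 (ext h'))| < 1 / 16.
Proof.
have tP (k : emb (sub (lof f)) K) : (Num.truncn (16 * obs f (act y0 (ext k))) < 17)%N /\
    (Num.truncn (16 * obs f (act y0 (ext k))))%:R <= 16 * obs f (act y0 (ext k)) <
    (Num.truncn (16 * obs f (act y0 (ext k)))).+1%:R.
  have [f0 f1] : 0 <= obs f (act y0 (ext k)) /\ obs f (act y0 (ext k)) <= 1.
    by have [_ /(_ (act y0 (ext k)))/andP[]] := svalP f.
  have x0 : 0 <= 16 * obs f (act y0 (ext k)) by rewrite mulr_ge0.
  split; last exact: truncn_itv.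
  rewrite ltnS truncn_le_nat; apply: (@le_lt_trans _ _ 16); first by lra.
  by rewrite ltr_nat.
have [t1 /andP[a1 b1]] := tP h; have [t2 /andP[a2 b2]] := tP h'.
move=> /(congr1 (@nat_of_ord _)); rewrite /chi !inordK // => E.
move: a1 b1 a2 b2; rewrite E; set n := Num.truncn _.
have nE : n.+1%:R = n%:R + 1 :> R by rewrite natr1.
by rewrite nE ltr_norml => *; lra.
Qed.

Let etas (s : seq {classic observable}) : exists eta : emb K K, forall f : observable,
  (f : {classic observable}) \in s -> forall a a' : aut K,
  agree_on (lof f) (pullback a (pullback eta K')) (pullback a' (pullback eta K')) ->
  `|obs f (act (e y0 eta) a) - obs f (act (e y0 eta) a')| < 5 / 16.
Proof.
have [eta etaP] := color_types_seq finL finM fr br (s : seq observable) chi (fun f => sub_finite (lof f)).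
exists eta => f fs a a' ag; have [_ ea em] := eP.
have eE (b : aut K) : act (e y0 eta) b = e y0 (emb_comp eta b) by rewrite -ea -em.
have := etaP f (mem_In fs) (emb_comp a (inc (lof f))) (emb_comp a' (inc (lof f))).
have cE (b : aut K) : emb_comp eta (emb_comp b (inc (lof f))) = emb_comp (emb_comp eta b) (inc (lof f)).
  exact: emb_ext.
rewrite !cE => /(_ _)/chi_near H.
have {}H := H ltac:(by move: ag; rewrite /agree_on -!pullback_comp).
have := near_ext f (emb_comp eta a); have := near_ext f (emb_comp eta a').
by move: H; rewrite !eE !ltr_norml; lra.
Qed.

Let idx := (seq {classic observable} * seq {classic K})%type.
Let eta_ (i : idx) : emb K K := sval (cid (etas i.1)).

Let etaP (i : idx) (f : observable) (a a' : aut K) : (f : {classic observable}) \in i.1 ->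
  agree_on (lof f) (pullback a (pullback (eta_ i) K')) (pullback a' (pullback (eta_ i) K')) ->
  `|obs f (act (e y0 (eta_ i)) a) - obs f (act (e y0 (eta_ i)) a')| < 5 / 16.
Proof. by rewrite /eta_; case: cid => eta H /= fi; exact: H. Qed.

(* [phi z] is the limit of [y0 * eta_i * g], where [K' * eta_i * g] approximates
   [z], along copies [eta_i] on which the values at [y0 * eta_i * g] of more and
   more observables are determined up to a small error by the type of
   [K' * eta_i * g] over a finite set. *)
Lemma universal_map : exists phi : X -> Y, [/\ continuous phi, equivariant phi & range phi = [set: Y]].
Proof.
have [U [UU subU]] := @ultraFilterLemma idx
  (filter_prod (@eventually_list observable) (@eventually_list K)) _.
have Uf (f : observable) : U [set i | (f : {classic observable}) \in i.1].
  apply: subU; exists ([set s | (f : {classic observable}) \in s], setT) => /=; last by move=> [s l] [].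
  by split; [exists [:: (f : {classic observable})] => l; apply; rewrite inE|exact: filterT].
have Ul (l : seq {classic K}) : U [set i | {subset l <= i.2}].
  apply: subU; exists (setT, [set l' | {subset l <= l'}]) => /=; last by move=> [s l'] [].
  by split; [exact: filterT|exists l].
have /choice[g gP] : forall p : X * idx, exists a : aut K,
    agree_on p.2.2 (sval p.1) (pullback a (pullback (eta_ p.2) K')).
  move=> [z i]; have /= := @orbit_agree _ _ _ _ finL finM fr K' br (eta_ i) z i.2; apply.
pose p z i := act (e y0 (eta_ i)) (g (z, i)).
have /choice[phi phiP] : forall z, exists y : Y, p z @ U --> y.
  by move=> z; apply: ultra_cvg; exact: flow_compact.
have pnear f z : U [set i | `|obs f (p z i) - obs f (phi z)| < 1 / 16].
  have d16 : (0 : R) < 1 / 16 by lra.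
  exact: (phiP z _ (obs_near f (phi z) d16)).
have gl z l : U [set i | agree_on l (sval z) (pullback (g (z, i)) (pullback (eta_ i) K'))].
  by apply: filterS (Ul l) => i li; apply: agree_sub li (gP (z, i)).
have key f z (a : idx -> aut K) :
    U [set i | agree_on (lof f) (sval z) (pullback (a i) (pullback (eta_ i) K'))] ->
    U [set i | `|obs f (act (e y0 (eta_ i)) (a i)) - obs f (phi z)| < 6 / 16].
  move=> Ua; apply: filterS3 (filterI Ua (gl z (lof f))) (Uf f) (pnear f z) => i [/= za zg] fi pn.
  have ag : agree_on (lof f) (pullback (a i) (pullback (eta_ i) K'))
      (pullback (g (z, i)) (pullback (eta_ i) K')) by rewrite /agree_on -za zg.
  by have := etaP fi ag; move: pn; rewrite /p !ltr_norml; lra.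
have close f z z' : agree_on (lof f) (sval z) (sval z') -> `|obs f (phi z') - obs f (phi z)| < 7 / 16.
  move=> zz'; have H := key f z' (fun i => g (z, i)).
  have {}H := H ltac:(apply: filterS (gl z (lof f)) => i /= zi; rewrite /agree_on -zz'; exact: zi).
  have [i [/= H1 H2]] := filter_ex (filterI H (pnear f z)).
  by move: H1 H2; rewrite /p !ltr_norml; lra.
have cphi : continuous phi.
  move=> z B Bz; have [f [f0 f1]] := separate Bz.
  exists (lof f) => z' /close; rewrite f0 => H.
  by apply: contrapT => /f1 E; move: H; rewrite E ltr_norml; lra.
exists phi; split=> //.
- move=> z h; apply: contrapT => ne.
  have By : nbhs (phi (act z h)) (~` [set act (phi z) h]).
    apply: open_nbhs_nbhs; split=> //; apply: closed_openC.
    by apply: compact_closed; [exact: flow_hausdorff|exact: compact_set1].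
  have [f [f0 f1]] := separate By.
  have {}f1 : obs f (act (phi z) h) = 1 by apply: f1 => H; exact: H.
  have H := key f (act z h) (fun i => g (z, i) * h)%g.
  have {}H := H ltac:(apply: filterS (gl z [seq (h x : {classic K}) | x <- lof f]) => i /= zi;
    have := agree_pullback zi;
    rewrite -(pullback_comp h (g (z, i)) (pullback (eta_ i) K')); exact: id).
  have d16 : (0 : R) < 1 / 16 by lra.
  have := @act_continuous _ _ Y (phi z, h) _ (obs_near f (act (phi z) h) d16).
  move=> /= [[V W] /= [Vy Wh] VW].
  have H2 : U [set i | V (p z i)] by exact: (phiP z V Vy).
  have [i [/= H1 /= H3]] := filter_ex (filterI H H2).
  have := VW (p z i, h) (conj H3 (nbhs_singleton Wh)).
  by rewrite /= /p -actM; move: H1; rewrite f0 f1 !ltr_norml; lra.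
- apply/seteqP; split=> // y _; apply: contrapT => ny.
  have By : nbhs y (~` range phi).
    apply: open_nbhs_nbhs; split; last exact: ny.
    apply: closed_openC; apply: compact_closed; first exact: flow_hausdorff.
    by apply: continuous_compact; [exact: continuous_subspaceT|exact: (@flow_compact _ _ X)].
  have [f [f0 f1]] := separate By.
  have d16 : (0 : R) < 1 / 16 by lra.
  have [W [Wopen Wy] Wf] : exists2 W, open_nbhs y W & W `<=` [set y' | `|obs f y' - obs f y| < 1 / 16].
    by have := obs_near f y d16; rewrite nbhsE => -[W oW sW]; exists W.
  have /choice[a aP] : forall i, exists a, W (act (e y0 (eta_ i)) a).
    move=> i; have [y' [Wy' [a _ aE]]] := edense (eta_ i) (ex_intro _ y Wy) Wopen.
    by exists a; rewrite aE.
  pose zz i : X := act (expansion_act (base_point finL finM K') (eta_ i)) (a i).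
  have [z zP] := ultra_cvg zz UU (@flow_compact _ _ X).
  have H := key f z a (zP _ (nbhs_agree (z : expansion_space K') (lof f))).
  have [i /= Hi] := filter_ex H.
  have := Wf _ (aP i); rewrite /= f0.
  have : obs f (phi z) = 1 by apply: f1 => nz; apply: nz; exists z.
  by move=> E; move: Hi; rewrite E !ltr_norml; lra.
Qed.

End Universality.

(** * Rigidity and metrizability *)

Lemma equivariant_extends (L : language) (K : structure L) (X Y : flow K)
    (eX : X -> emb K K -> X) (eY : Y -> emb K K -> Y) (phi : X -> Y) :
  ultrahomogeneous K -> extends_action eX -> extends_action eY ->
  continuous phi -> equivariant phi -> forall x eta, phi (eX x eta) = eY (phi x) eta.
Proof.
move=> uh [cX aX _] [cY aY _] cphi ephi x eta.
have /choice[g gP] : forall l : seq {classic K}, exists a : aut K, forall y : sub l, a (sval y) = eta (sval y).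
  by move=> l; exact: (aut_extend uh (emb_comp eta (inc l))).
pose G := @eventually_list K; have FG : ProperFilter G := eventually_list_filter K.
have Geta : (fun l => aut_emb (g l)) @ G --> eta.
  apply: cvg_emb => y; exists [:: (y : {classic K})] => l yl /=.
  have yin : (y : {classic K}) \in l by apply: yl; rewrite inE.
  exact: (gP l (exist _ y yin)).
have hY : hausdorff_space Y by exact: flow_hausdorff.
have lim (Z : flow K) (eZ : Z -> emb K K -> Z) z :
    continuous (fun p : Z * emb K K => eZ p.1 p.2) -> (fun l => eZ z (g l)) @ G --> eZ z eta.
  move=> cZ B Bz; have [[V W] /= [Vz We] VW] := cZ (z, eta) B Bz.
  have GW : G [set l | W (g l)] := Geta W We.
  suff : G [set l | B (eZ z (g l))] by [].
  apply: filterS GW => l /= Wl.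
  by apply: (VW (z, aut_emb (g l))); split=> //=; exact: nbhs_singleton.
have L1 : (fun l => phi (eX x (g l))) @ G --> phi (eX x eta).
  by move=> B Bz; exact: (lim _ _ x cX _ (cphi _ B Bz)).
have L2 : (fun l => phi (eX x (g l))) @ G --> eY (phi x) eta.
  have -> : (fun l => phi (eX x (g l))) = (fun l => eY (phi x) (g l)).
    by apply/funext => l; rewrite aX aY ephi.
  exact: lim.
exact: (cvg_unique hY L1 L2).
Qed.

Section Rigidity.
Variables (L M : language) (F : set (structure L)) (K : structure L).
Hypothesis finL : finite_set [set: L].
Hypothesis finM : finite_set [set: M].
Hypothesis fr : fraisse_limit (Forb F) K.
Notation LM := (lang_sum L M).
Variable K' : interp LM K.
Hypothesis br : big_ramsey_structure (Forb F) K'.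
Notation X := (expansion_flow finL finM K').
Notation x0 := (base_point finL finM K').

Let uh : ultrahomogeneous K. Proof. by case: fr. Qed.

Variable theta : X -> X.
Hypothesis ctheta : continuous theta.
Hypothesis etheta : equivariant theta.
Hypothesis otheta : range theta = [set: X].

Let w : interp LM K := sval (theta x0).

Let theta_orbit (eta : emb K K) (a : aut K) :
  sval (theta (act (expansion_act x0 eta) a)) = pullback a (pullback eta w).
Proof.
have := equivariant_extends uh (expansion_act_extends finL finM K') (expansion_act_extends finL finM K')
  ctheta etheta x0 eta.
by rewrite etheta => ->.
Qed.

Let theta_dense (eta : emb K K) (z : X) l : exists a : aut K,
  agree_on l (sval z) (pullback a (pullback eta K')) /\
  agree_on l (sval (theta z)) (pullback a (pullback eta w)).
Proof.
have [l' H] := ctheta (nbhs_agree (theta z : expansion_space K') l).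
have [a aE] := orbit_agree fr br eta z (l ++ l').
exists a; split; first by apply: agree_sub aE => x xl; rewrite mem_cat xl.
have := H (act (expansion_act x0 eta) a); rewrite /= theta_orbit; apply.
by apply: agree_sub aE => x xl; rewrite mem_cat xl orbT.
Qed.

(* Over a suitable copy, the pair of the types of [K'] and of [w] takes as many
   values as the type of [K'], and the type of [w] takes all these values as
   [theta] is onto; hence each of the two types determines the other. *)
Let types_determined (l : seq {classic K}) : exists eta : emb K K, forall h h' : emb (sub l) K,
  pullback (emb_comp eta h) w = pullback (emb_comp eta h') w ->
  pullback (emb_comp eta h) K' = pullback (emb_comp eta h') K'.
Proof.
have fA := sub_finite l; have [C [code ci]] := exps_code finL finM fA.
have [eta etaP] := color_types finL finM fr br
  (fun h : emb (sub l) K => enum_rank (code (pullback h w))) (emb_id K) fA.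
pose c1 h := code (pullback (emb_comp eta h) K'); pose c2 h := code (pullback (emb_comp eta h) w).
have c12 h h' : c1 h = c1 h' -> c2 h = c2 h'.
  move=> /ci E; have := etaP h h'; have idc g : emb_comp (emb_id K) g = g :> emb (sub l) K by exact: emb_ext.
  by rewrite !idc => /(_ E)/enum_rank_inj.
pose D : {set C * C} := codes (fun h : emb (sub l) K => (c1 h, c2 h)) setT.
have inD h : (c1 h, c2 h) \in D by apply/in_codes; exists h.
have D1 : [set p.1 | p in D]%SET = codes code (exps (A := sub l) K').
  apply/setP => c; apply/imsetP/idP => [[p /in_codes[h _ <-] ->]|/in_codes[I + <-]].
    by apply/in_codes; exists (pullback (emb_comp eta h) K') => //; exists (emb_comp eta h).
  by rewrite -(exps_stable finL finM fr br eta fA) => -[h _ <-]; exists (c1 h, c2 h).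
have D2 : codes code (exps (A := sub l) K') \subset [set p.2 | p in D]%SET.
  apply/fintype.subsetP => c /in_codes[_ [f _ <-] <-].
  have [a aE] := aut_extend uh f.
  have [z _ zE] : range theta (act x0 a) by rewrite otheta.
  have [b [_ bE]] := theta_dense eta z l.
  apply/imsetP; exists (c1 (emb_comp b (inc l)), c2 (emb_comp b (inc l))); first exact: inD.
  congr code; move: bE; rewrite /agree_on zE /=.
  rewrite -(pullback_comp (inc l) a K') -(pullback_comp (inc l) b (pullback eta w)).
  rewrite -(pullback_comp (b \o inc l) eta w) => <-.
  by congr (pullback _ K'); apply/funext => x /=; rewrite -aE.
have /imset_injP i1 : #|[set p.1 | p in D]%SET| == #|D|.
  apply/imset_injP => _ _ /in_codes[h _ <-] /in_codes[h' _ <-] /= E.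
  by rewrite E (c12 _ _ E).
have /imset_injP i2 : #|[set p.2 | p in D]%SET| == #|D|.
  rewrite eqn_leq leq_imset_card /= -(card_in_imset i1) D1; exact: subset_leq_card.
exists eta => h h' E; apply: ci; have := i2 _ _ (inD h) (inD h').
by rewrite /= /c2 E => /(_ erefl)[].
Qed.

Lemma expansion_flow_rigid : injective theta.
Proof.
move=> z z' zz'; apply: space_ext; apply: agree_all => l.
have [eta etaP] := types_determined l.
have [a [a1 a2]] := theta_dense eta z l; have [b [b1 b2]] := theta_dense eta z' l.
have cE (I : interp LM K) (c : aut K) :
    pullback (inc l) (pullback c (pullback eta I)) = pullback (emb_comp eta (emb_comp c (inc l))) I.
  by rewrite -(pullback_comp (inc l) c) -(pullback_comp (c \o inc l) eta).
move: a1 a2 b1 b2; rewrite /agree_on zz' !cE => -> -> ->; exact: etaP.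
Qed.

End Rigidity.

Section Metrizability.
Variables (R : realType) (L M : language) (K : structure L).
Variables (K' : interp (lang_sum L M) K) (code : K -> nat).
Hypothesis code_inj : injective code.

Definition metric_space of injective code : Type := expansion_space K'.
HB.instance Definition _ := gen_eqMixin (metric_space code_inj).
HB.instance Definition _ := gen_choiceMixin (metric_space code_inj).
Let T := metric_space code_inj.

Let agree_below n (z z' : T) := forall l : seq {classic K},
  (forall x : {classic K}, x \in l -> (code x < n)%N) -> agree_on l (sval z) (sval z').

Let agree_below_all z z' : z <> z' -> exists n, `[< ~ agree_below n z z' >].
Proof.
move=> zz'; apply: contrapT => H; apply: zz'.
apply: (@space_ext _ _ _ K'); apply: agree_all => l.
apply: contrapT => nl; apply: H; exists (\max_(x <- l) (code x).+1)%N.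
by apply/asboolP => /(_ l); apply: contra_not nl; apply => x xl; exact: leq_bigmax_seq.
Qed.

Let dist (z z' : T) : R :=
  if pselect (z <> z') is left H then (ex_minn (agree_below_all H)).+1%:R^-1 else 0.

Let dist_lt z z' n : agree_below n z z' -> dist z z' < n.+1%:R^-1.
Proof.
rewrite /dist => zn; case: pselect => [H|_]; last by rewrite invr_gt0 ltr0n.
case: ex_minnP => m /asboolP nm _; rewrite ltf_pV2 ?posrE ?ltr0n // ltr_nat ltnS.
by rewrite ltnNge; apply/negP => mn; apply: nm => l lm; apply: zn => x /lm xm; exact: leq_trans xm mn.
Qed.

Let dist_ge z z' n : ~ agree_below n z z' -> n.+1%:R^-1 <= dist z z'.
Proof.
rewrite /dist => zn; case: pselect => [H|H]; last by case: zn => l _; have -> : z = z' by apply: contrapT.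
case: ex_minnP => m _ /(_ n) mn; rewrite lef_pV2 ?posrE ?ltr0n // ler_nat ltnS.
by apply: mn; apply/asboolP.
Qed.

Let dist_cases z z' : z = z' \/ exists2 n, ~ agree_below n z z' & dist z z' = n.+1%:R^-1.
Proof.
rewrite /dist; case: pselect => [H|H]; last by left; apply: contrapT.
by right; case: ex_minnP => n /asboolP nn _; exists n.
Qed.

Let distxx z : dist z z = 0.
Proof. by rewrite /dist; case: pselect => [H|//]; case: (H erefl). Qed.

Let dist_ge0 z z' : 0 <= dist z z'.
Proof. by rewrite /dist; case: pselect => // H; rewrite invr_ge0 ler0n. Qed.

Let dist_positivity z z' : dist z z' = 0 -> z = z'.
Proof.
have [//|[n _ ->]] := dist_cases z z'.
by move=> /eqP; rewrite invr_eq0 pnatr_eq0.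
Qed.

Let dist_sym z z' : dist z z' = dist z' z.
Proof.
have sym n u v : ~ agree_below n u v -> ~ agree_below n v u by move=> H E; apply: H => l /E.
have le u v : dist u v <= dist v u.
  by have [->//|[n /sym un ->]] := dist_cases u v; exact: dist_ge.
by apply/eqP; rewrite eq_le !le.
Qed.

Let dist_triangle y x z : dist x z <= dist x y + dist y z.
Proof.
have [->|[n nn ->]] := dist_cases x z; first by rewrite distxx addr_ge0.
have [xy|/dist_ge H] := pselect (agree_below n x y); last by apply: le_trans H _; rewrite lerDl.
have [yz|/dist_ge H] := pselect (agree_below n y z); last by apply: le_trans H _; rewrite lerDr.
by case: nn => l ln; rewrite /agree_on (xy l ln); exact: yz.
Qed.

HB.instance Definition _ := isMetric.Build R (metric_space code_inj)
  distxx dist_positivity dist_sym dist_triangle.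

Lemma expansion_space_metrizable : compact [set: expansion_space K'] -> metrizable R (expansion_space K').
Proof.
move=> cX; exists T, (id : expansion_space K' -> T); apply: compact_continuous_bij => //.
- exact: metric_hausdorff.
- move=> z B /nbhs_ballP[e /= e0 eB].
  have [n ne] : exists n, n.+1%:R^-1 < e.
    exists (Num.truncn e^-1); rewrite invf_plt ?posrE ?ltr0n //; exact: truncnS_gt.
  have [l lP] : exists l : seq {classic K}, forall x, (code x < n)%N -> (x : {classic K}) \in l.
    have fn : finite_set [set x : {classic K} | (code x < n)%N].
      apply: (@finite_preimage _ _ `I_n code); last exact: finite_II.
      by move=> x y _ _; exact: code_inj.
    by move/finite_seqP: fn => [l lE]; exists l => x xn; have : [set` l] x by rewrite -lE.
  rewrite ballEmdist in eB.
  exists l => z' zz'; apply: eB; apply: lt_trans ne; apply: dist_lt => l' l'n.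
  by apply: agree_sub zz' => x /l'n /lP.
- by exists id.
Qed.

End Metrizability.

Theorem theorem1p3 (R : realType) (L : language) (F : set (structure L))
    (K : structure L) :
  finite_set [set: L] ->
  (forall s : L, (arity s <= 2)%N) ->
  finite_set F ->
  (forall A, F A -> finite_structure A /\ irreducible A) ->
  fraisse_limit (Forb F) K ->
  (exists M : language, finite_set [set: M] /\
     exists K' : interp (lang_sum L M) K, big_ramsey_structure (Forb F) K') /\
  (exists X : flow K,
     [/\ universal_completion_flow X, metrizable R X &
         forall Y : flow K, universal_completion_flow Y ->
           flow_isomorphic X Y]).
Proof.
move=> finL ar2 finF FP fr; have [cK age uh] := fr.
have [M [finM [K' br]]] : exists M : language, finite_set [set: M] /\
    exists K' : interp (lang_sum L M) K, big_ramsey_structure (Forb F) K'.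
  have [M [finM [E [E_reduct E_univ]]]] := universal_expansion finL ar2 finF FP fr.
  exists M; split=> //; apply: (big_ramsey_exists finL finM _ _ E_reduct E_univ) => A [] // fA nA.
  by apply/age.
split; first by exists M; split=> //; exists K'.
pose X := expansion_flow finL finM K'.
have cX : completion_flow X.
  by exists (base_point finL finM K'); apply: base_completion_point br.
have uX : universal_completion_flow X.
  split=> // Y [y0 [e eP ed]]; exact: (universal_map R finL finM fr br eP ed).
exists X; split=> //.
  have [code code_inj] : exists code : K -> nat, injective code.
    by have /countable_injP[c ci] := cK; exists c => x y; apply: ci; rewrite inE.
  exact: (expansion_space_metrizable R (K' := K') code_inj (@flow_compact _ _ X)).
move=> Y [cY uY]; have [phi [cphi ephi ophi]] := uX.2 Y cY.
have [psi [cpsi epsi opsi]] := uY X cX.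
exists phi => //; apply: compact_continuous_bij => //.
- exact: flow_compact.
- exact: flow_hausdorff.
have inj : injective (psi \o phi).
  apply: (expansion_flow_rigid fr br) => //.
  - by move=> x; apply: continuous_comp; [exact: cphi|exact: cpsi].
  - by move=> x g /=; rewrite ephi epsi.
  - apply/seteqP; split=> // x _; have [y _ <-] : range psi x by rewrite opsi.
    by have [z _ <-] : range phi y; [rewrite ophi|exists z].
have /choice[r rK] : forall y, exists x, phi x = y.
  by move=> y; have [x _ <-] : range phi y; [rewrite ophi|exists x].
by exists r => // x; apply: inj; rewrite /= rK.
Qed.
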